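(* Let $G$ be a simply connected five dimensional two-step nilpotent Lie group with a left invariant Riemannian metric $\tilde a$, and let $\{E_1,\dots,E_5\}$ be an $\tilde a$-orthonormal basis of its Lie algebra $\mathfrak g$ in which the non-zero brackets have one of the following three forms: (i) (1-dimensional center) $[E_1,E_2]=\lambda E_5$, $[E_3,E_4]=\mu E_5$, with $\lambda\ge\mu>0$; (ii) (2-dimensional center) $[E_1,E_2]=\lambda E_4$, $[E_1,E_3]=\mu E_5$, with $\lambda\ge\mu>0$; (iii) (3-dimensional center) $[E_1,E_2]=\lambda E_3$, with $\lambda>0$. Let $F(x,y)=\sqrt{\tilde a(y,y)}+\tilde a(X(x),y)$ be a left invariant Randers metric of Douglas type on $G$, where $X$ is a left invariant vector field with $\sqrt{\tilde a(X,X)}<1$. Let $Y=y_1E_1+y_2E_2+y_3E_3+y_4E_4+y_5E_5\in\mathfrak g$ be non-zero. Then: (i) in case (i), $Y$ is a geodesic vector of $(G,F)$ if and only if $Y\in\operatorname{span}\{E_2,E_3,E_4\}$ or $Y\in\operatorname{span}\{E_5\}$; (ii) in case (ii), $Y$ is a geodesic vector of $(G,F)$ if and only if $Y\in\operatorname{span}\{E_1,E_2,E_3\}$, or $Y\in\operatorname{span}\{E_2,E_3,E_4,E_5\}$ and $\lambda y_2y_4+\mu y_3y_5=0$; (iii) in case (iii), $Y$ is a geodesic vector of $(G,F)$ if and only if $Y\in\operatorname{span}\{E_1,E_2,E_4,E_5\}$ or $Y\in\operatorname{span}\{E_3,E_4,E_5\}$.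
   Context: Brackets of basis elements not listed (and not obtained from listed ones by antisymmetry) are zero. A Finsler metric $F$ on a Lie group $G$ is left invariant if $F(x,y)=F(e,dl_{x^{-1}}y)$ for all $x\in G$, $y\in T_xG$, where $l_x$ is left translation. The spray coefficients of $F$ in a standard local coordinate system $(x,y)$ of the tangent bundle $TG$ are $G^i=\frac14 g^{il}\big([F^2]_{x^my^l}y^m-[F^2]_{x^l}\big)$, where $g_{ij}=\frac12\frac{\partial^2F^2}{\partial y^i\partial y^j}$ and $(g^{ij})$ is the inverse matrix of $(g_{ij})$. $F$ is of Douglas type if in every standard local coordinate system $G^i=\frac12\Gamma^i_{jk}(x)y^jy^k+P(x,y)y^i$ for some functions $\Gamma^i_{jk}(x)$ and some local function $P(x,y)$ positively homogeneous of degree one in $y$. A non-zero vector $Y\in\mathfrak g$ is a geodesic vector of $(G,F)$ if the curve $t\mapsto\exp(tY)$ is a geodesic of $(G,F)$.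
   Formalization: In conclusion (i), span{E_2,E_3,E_4} is replaced by span{E_1,E_2,E_3,E_4}; as printed it fails, since E_1 is a geodesic vector in case (i) (for example with X=0) but lies in neither printed span. *)

(* Defs.v *)
From HB Require Import structures.
From mathcomp Require Import all_boot all_order all_algebra.
From mathcomp Require Import all_classical all_reals all_analysis.

Set Implicit Arguments.
Unset Strict Implicit.
Unset Printing Implicit Defensive.

Import Order.TTheory GRing.Theory Num.Theory.
Import numFieldNormedType.Exports.

Local Open Scope classical_set_scope.
Local Open Scope ring_scope.

(* Only meaningful when A is open.  Differentiability is required at each
   order because the existence of all iterated directional derivatives does
   not even imply continuity. *)
Fixpoint Ck_on (R : realType) (U V : normedModType R) (k : nat) (A : set U)
    (f : U -> V) : Prop :=
  if k is k'.+1 then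
    (forall x, A x -> differentiable f x) /\
    (forall v : U, Ck_on k' A ('D_v f))
  else forall x, A x -> {for x, continuous f}.

Definition smooth_on (R : realType) (U V : normedModType R) (A : set U)
    (f : U -> V) : Prop := forall k, Ck_on k A f.

(* A homeomorphism from the open set [cdom] onto the open set
   [cmap @` cdom] of R^n, with inverse [cinv].  Both maps are total, their
   values outside of these two sets are irrelevant. *)
Record chart (R : realType) (n : nat) (M : topologicalType) := Chart {
  cdom : set M;
  cmap :> M -> 'rV[R]_n;
  cinv : 'rV[R]_n -> M;
  cdom_open : open cdom;
  cimg_open : open (cmap @` cdom);
  cmapK : forall p, cdom p -> cinv (cmap p) = p;
  cmap_continuous : forall p, cdom p -> {for p, continuous cmap};
  cinv_continuous :
    forall x, (cmap @` cdom) x -> {for x, continuous cinv}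
}.

Definition transition_smooth (R : realType) (n : nat) (M : topologicalType)
    (c c' : chart R n M) : Prop :=
  smooth_on (c @` (cdom c `&` cdom c')) (c' \o cinv c).

HB.mixin Record isSmoothManifold (R : realType) (n : nat) M
    of Topological M := {
  manifold_hausdorff : hausdorff_space M;
  manifold_second_countable : @second_countable M;
  atlas : set (chart R n M);
  atlas_cover : forall p : M, exists2 c, atlas c & cdom c p;
  atlas_smooth : forall c c', atlas c -> atlas c' -> transition_smooth c c';
  atlas_maximal : forall c : chart R n M,
    (forall c', atlas c' -> transition_smooth c c' /\ transition_smooth c' c) ->
    atlas c
}.

#[short(type="smoothManifoldType")]
HB.structure Definition SmoothManifold (R : realType) (n : nat) :=
  {M of isSmoothManifold R n M & Topological M}.

Arguments atlas {R n} M : rename.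

Definition chart_at (R : realType) (n : nat) (M : smoothManifoldType R n)
    (p : M) : chart R n M := s2val (cid2 (atlas_cover p)).

Lemma chart_at_atlas R n (M : smoothManifoldType R n) (p : M) :
  atlas M (chart_at p).
Proof. by rewrite /chart_at; case: cid2. Qed.

Lemma chart_at_dom R n (M : smoothManifoldType R n) (p : M) :
  cdom (chart_at p) p.
Proof. by rewrite /chart_at; case: cid2. Qed.

(* The charts of the smooth structure around a point. *)
Definition charts_at (R : realType) (n : nat) (M : smoothManifoldType R n)
    (p : M) : set (chart R n M) := [set c | atlas M c /\ cdom c p].

(* A tangent vector at p is the family of its coordinates y in all the charts
   (x, y) around p, related by the Jacobians of the coordinate changes; the
   value 0 at the other charts makes the representation unique. *)
Record tangent (R : realType) (n : nat) (M : smoothManifoldType R n)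
    (p : M) := Tangent {
  tcoord : chart R n M -> 'rV[R]_n;
  tcoord_change : forall c c', charts_at p c -> charts_at p c' ->
    tcoord c' = 'd (c' \o cinv c) (c p) (tcoord c);
  tcoord_out : forall c, ~ charts_at p c -> tcoord c = 0
}.

Section TangentSpace.
Variables (R : realType) (n : nat) (M : smoothManifoldType R n) (p : M).
Implicit Types (c : chart R n M) (u v : tangent p).

Lemma tangent_eqP u v : (forall c, tcoord u c = tcoord v c) -> u = v.
Proof.
case: u v => [f f1 f2] [g g1 g2] /= fg.
have {}fg : f = g by apply/funext.
move: f1 f2; rewrite fg => f1 f2.
by rewrite (Prop_irrelevance f1 g1) (Prop_irrelevance f2 g2).
Qed.

HB.instance Definition _ := gen_eqMixin (tangent p).
HB.instance Definition _ := gen_choiceMixin (tangent p).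

Fact tangent_zero_change c c' : charts_at p c -> charts_at p c' ->
  (0 : 'rV[R]_n) = 'd (c' \o cinv c) (c p) 0.
Proof. by rewrite linear0. Qed.

Definition tangent_zero : tangent p :=
  @Tangent R n M p (fun=> 0) tangent_zero_change (fun _ _ => erefl).

Fact tangent_opp_change u c c' : charts_at p c -> charts_at p c' ->
  - tcoord u c' = 'd (c' \o cinv c) (c p) (- tcoord u c).
Proof. by move=> cp c'p; rewrite linearN (tcoord_change u cp c'p). Qed.

Fact tangent_opp_out u c : ~ charts_at p c -> - tcoord u c = 0.
Proof. by move=> cp; rewrite (tcoord_out u cp) oppr0. Qed.

Definition tangent_opp u : tangent p :=
  Tangent (tangent_opp_change u) (tangent_opp_out u).

Fact tangent_add_change u v c c' : charts_at p c -> charts_at p c' ->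
  tcoord u c' + tcoord v c'
  = 'd (c' \o cinv c) (c p) (tcoord u c + tcoord v c).
Proof.
move=> cp c'p.
by rewrite linearD (tcoord_change u cp c'p) (tcoord_change v cp c'p).
Qed.

Fact tangent_add_out u v c : ~ charts_at p c -> tcoord u c + tcoord v c = 0.
Proof. by move=> cp; rewrite (tcoord_out u cp) (tcoord_out v cp) addr0. Qed.

Definition tangent_add u v : tangent p :=
  Tangent (tangent_add_change u v) (tangent_add_out u v).

Fact tangent_scale_change (k : R) u c c' :
  charts_at p c -> charts_at p c' ->
  k *: tcoord u c' = 'd (c' \o cinv c) (c p) (k *: tcoord u c).
Proof. by move=> cp c'p; rewrite linearZ (tcoord_change u cp c'p). Qed.

Fact tangent_scale_out (k : R) u c : ~ charts_at p c -> k *: tcoord u c = 0.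
Proof. by move=> cp; rewrite (tcoord_out u cp) scaler0. Qed.

Definition tangent_scale (k : R) u : tangent p :=
  Tangent (tangent_scale_change k u) (tangent_scale_out k u).

Fact tangent_addA : associative tangent_add.
Proof. by move=> u v w; apply: tangent_eqP => c /=; rewrite addrA. Qed.
Fact tangent_addC : commutative tangent_add.
Proof. by move=> u v; apply: tangent_eqP => c /=; rewrite addrC. Qed.
Fact tangent_add0 : left_id tangent_zero tangent_add.
Proof. by move=> u; apply: tangent_eqP => c /=; rewrite add0r. Qed.
Fact tangent_addN : left_inverse tangent_zero tangent_opp tangent_add.
Proof. by move=> u; apply: tangent_eqP => c /=; rewrite addNr. Qed.

HB.instance Definition _ := GRing.isZmodule.Build (tangent p)
  tangent_addA tangent_addC tangent_add0 tangent_addN.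

Fact tangent_scaleA a b u :
  tangent_scale a (tangent_scale b u) = tangent_scale (a * b) u.
Proof. by apply: tangent_eqP => c /=; rewrite scalerA. Qed.
Fact tangent_scale1 : left_id 1 tangent_scale.
Proof. by move=> u; apply: tangent_eqP => c /=; rewrite scale1r. Qed.
Fact tangent_scaleDr : right_distributive tangent_scale +%R.
Proof. by move=> a u v; apply: tangent_eqP => c /=; rewrite scalerDr. Qed.
Fact tangent_scaleDl u : {morph tangent_scale^~ u : a b / a + b}.
Proof. by move=> a b; apply: tangent_eqP => c /=; rewrite scalerDl. Qed.

HB.instance Definition _ := GRing.Zmodule_isLmodule.Build R (tangent p)
  tangent_scaleA tangent_scale1 tangent_scaleDr tangent_scaleDl.

Lemma transition_differentiable c c' :
  charts_at p c -> charts_at p c' -> differentiable (c' \o cinv c) (c p).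
Proof.
move=> [ac cp] [ac' c'p].
have [+ _] := atlas_smooth c c' ac ac' 1%N; apply.
by exists p.
Qed.

Lemma chart_img_nbhs c : charts_at p c ->
  \forall x \near c p, (c @` cdom c) x.
Proof.
by move=> [_ cp]; apply: open_nbhs_nbhs; split; [exact: cimg_open|exists p].
Qed.

Lemma diff_near_eq (f g : 'rV[R]_n -> 'rV[R]_n) x y :
  differentiable f x -> differentiable g x -> (\near x, f x = g x) ->
  'd f x y = 'd g x y.
Proof.
move=> df dg fg; have Ef := deriveE y df; have Eg := deriveE y dg.
apply: (etrans (esym Ef)); apply: (etrans _ Eg).
exact: (@near_eq_derive _ _ _ f g x y fg).
Qed.

Lemma diff_comp_at (f g : 'rV[R]_n -> 'rV[R]_n) x z y :
  differentiable f x -> f x = z -> differentiable g z ->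
  differentiable (g \o f) x /\ 'd g z ('d f x y) = 'd (g \o f) x y.
Proof.
move=> df <- dg; split; first exact: (differentiable_comp df dg).
by apply: esym; exact: (congr1 (@^~ y) (diff_comp df dg)).
Qed.

Fact tvec_change c (y : 'rV[R]_n) : charts_at p c ->
  forall c1 c2, charts_at p c1 -> charts_at p c2 ->
  'd (c2 \o cinv c) (c p) y
  = 'd (c2 \o cinv c1) (c1 p) ('d (c1 \o cinv c) (c p) y).
Proof.
move=> cp c1 c2 c1p c2p.
have [_ cdp] := cp; have [_ c1dp] := c1p.
have E : (c1 \o cinv c) (c p) = c1 p by rewrite /= (cmapK cdp).
have d1 := transition_differentiable cp c1p.
have d2 := transition_differentiable c1p c2p.
have [d21 D] := diff_comp_at y d1 E d2.
apply: etrans (esym D).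
apply: (diff_near_eq _ (transition_differentiable cp c2p) d21).
have : \forall x \near c p, cdom c1 (cinv c x).
  apply: (cinv_continuous (imageP c cdp)); rewrite cmapK//.
  by apply: open_nbhs_nbhs; split => //; exact: cdom_open.
by apply: filterS => x xc1; rewrite /= cmapK.
Qed.

Definition tvec_coord c (y : 'rV[R]_n) c' : 'rV[R]_n :=
  if `[< charts_at p c /\ charts_at p c' >] then 'd (c' \o cinv c) (c p) y
  else 0.

Fact tvec_coord_change c (y : 'rV[R]_n) c1 c2 :
  charts_at p c1 -> charts_at p c2 ->
  tvec_coord c y c2 = 'd (c2 \o cinv c1) (c1 p) (tvec_coord c y c1).
Proof.
move=> c1p c2p; rewrite /tvec_coord; case: (asboolP (_ /\ _)) => [[cp _]|cp].
  by rewrite asboolT//; exact: tvec_change.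
by rewrite asboolF ?linear0// => -[c0p _]; case: cp.
Qed.

Fact tvec_coord_out c (y : 'rV[R]_n) c' :
  ~ charts_at p c' -> tvec_coord c y c' = 0.
Proof. by move=> c'p; rewrite /tvec_coord; case: asboolP => // -[]. Qed.

(* The tangent vector y^i (d/dx^i) at p in the chart c; by convention it is 0
   when c is not a chart around p. *)
Definition tvec c (y : 'rV[R]_n) : tangent p :=
  @Tangent R n M p (tvec_coord c y) (@tvec_coord_change c y) (@tvec_coord_out c y).

Lemma charts_at_chart_at : charts_at p (chart_at p).
Proof. by split; [exact: chart_at_atlas|exact: chart_at_dom]. Qed.

Lemma tvecK c : charts_at p c -> cancel (tvec c) (fun v => tcoord v c).
Proof.
move=> cp y /=; rewrite /tvec_coord asboolT//.
have -> : 'd (c \o cinv c) (c p) y = 'd (@idfun 'rV[R]_n) (c p) y.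
  apply: diff_near_eq => //; first exact: transition_differentiable.
  have [_ cdp] := cp.
  have : \forall x \near c p, (c @` cdom c) x by exact: chart_img_nbhs.
  by apply: filterS => _ [q qc <-] /=; rewrite cmapK.
by rewrite (@diff_lin _ _ _ (@idfun 'rV[R]_n))// => z; exact: cvg_id.
Qed.

Lemma tcoordK c : charts_at p c ->
  cancel (fun v : tangent p => tcoord v c) (tvec c).
Proof.
move=> cp v; apply: tangent_eqP => c' /=.
rewrite /tvec_coord; case: asboolP => [[_ c'p]|c'p].
  by rewrite -(tcoord_change v cp c'p).
by rewrite tcoord_out// => c'p'; apply: c'p.
Qed.

Fact tangent_vect_axiom : Vector.axiom n (tangent p).
Proof.
exists (fun v => tcoord v (chart_at p)) => //.
exists (tvec (chart_at p)).
  exact/tcoordK/charts_at_chart_at.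
exact/tvecK/charts_at_chart_at.
Qed.

HB.instance Definition _ :=
  Lmodule_hasFinDim.Build R (tangent p) tangent_vect_axiom.

End TangentSpace.

Arguments tvec {R n M} p c y.

(* The differential of f at p, as a map into the tangent space at q; only
   meaningful when f p = q.  Keeping q apart avoids transports along
   equalities such as g * 1 = g. *)
Definition tangent_map (R : realType) (n m : nat)
    (M : smoothManifoldType R n) (N : smoothManifoldType R m) (f : M -> N)
    (p : M) (q : N) (u : tangent p) : tangent q :=
  tvec q (chart_at q)
    ('d (chart_at q \o f \o cinv (chart_at p)) (chart_at p p)
      (tcoord u (chart_at p))).

Section Curves.
Variables (R : realType) (n : nat) (M : smoothManifoldType R n).

Definition smooth_curve (gam : R -> M) : Prop :=
  continuous gam /\
  forall c, atlas M c -> smooth_on (gam @^-1` cdom c) (c \o gam).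

Definition velocity (gam : R -> M) (t : R) : tangent (gam t) :=
  tvec (gam t) (chart_at (gam t)) (derive1 (chart_at (gam t) \o gam) t).

End Curves.

Section VectorFields.
Variables (R : realType) (n : nat) (M : smoothManifoldType R n).

Definition vector_field := forall p : M, tangent p.

(* [V, W]^i = V^j (dW^i/dx^j) - W^j (dV^i/dx^j) *)
Definition vf_bracket (V W : vector_field) : vector_field := fun p =>
  let c := chart_at p in
  let coords (Z : vector_field) (x : 'rV[R]_n) := tcoord (Z (cinv c x)) c in
  tvec p c ('D_(tcoord (V p) c) (coords W) (c p)
            - 'D_(tcoord (W p) c) (coords V) (c p)).

End VectorFields.

Arguments vector_field {R n} M.

Section Finsler.
Variables (R : realType) (n : nat) (M : smoothManifoldType R n).

Definition metric_tensor := forall p : M, tangent p -> tangent p -> R.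

Definition riemannian_metric (a : metric_tensor) : Prop :=
  [/\ forall (p : M) (k : R) (u v w : tangent p),
        a p (k *: u + v) w = k * a p u w + a p v w,
      forall (p : M) (u v : tangent p), a p u v = a p v u,
      forall (p : M) (u : tangent p), u != 0 -> 0 < a p u u &
      forall c, atlas M c -> forall y z : 'rV[R]_n,
        smooth_on (c @` cdom c)
          (fun x => a (cinv c x) (tvec (cinv c x) c y) (tvec (cinv c x) c z)
             : R)].

Definition finsler_function := forall p : M, tangent p -> R.

Definition randers (a : metric_tensor) (X : vector_field M) :
    finsler_function :=
  fun p y => Num.sqrt (a p y y) + a p (X p) y.

Variable F : finsler_function.

Definition local_sqr (c : chart R n M) (x y : 'rV[R]_n) : R :=
  F (tvec (cinv c x) c y) ^+ 2.

Definition pderiv_x (i : 'I_n) (h : 'rV[R]_n -> 'rV[R]_n -> R)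
    (x y : 'rV[R]_n) : R := 'D_(delta_mx 0 i) (h^~ y) x.

Definition pderiv_y (i : 'I_n) (h : 'rV[R]_n -> 'rV[R]_n -> R)
    (x y : 'rV[R]_n) : R := 'D_(delta_mx 0 i) (h x) y.

Definition fundamental_tensor (c : chart R n M) (x y : 'rV[R]_n) : 'M[R]_n :=
  \matrix_(i, j) (2^-1 * pderiv_y j (pderiv_y i (local_sqr c)) x y).

Definition spray (c : chart R n M) (x y : 'rV[R]_n) : 'rV[R]_n :=
  \row_i (4^-1 * \sum_l invmx (fundamental_tensor c x y) i l *
    (\sum_m pderiv_y l (pderiv_x m (local_sqr c)) x y * y 0 m
     - pderiv_x l (local_sqr c) x y)).

(* The spray coefficients are defined for y != 0 only. *)
Definition douglas_type : Prop :=
  forall c, atlas M c ->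
  exists (Gam : 'I_n -> 'I_n -> 'I_n -> 'rV[R]_n -> R)
         (P : 'rV[R]_n -> 'rV[R]_n -> R),
    (forall x y t, (c @` cdom c) x -> y != 0 -> 0 < t ->
       P x (t *: y) = t * P x y) /\
    (forall x y i, (c @` cdom c) x -> y != 0 ->
       spray c x y 0 i
       = 2^-1 * (\sum_j \sum_k Gam i j k x * y 0 j * y 0 k)
         + P x y * y 0 i).

(* x''^i + 2 G^i(x, x') = 0 in every chart; G^i is defined only away from the
   zero section, whence the condition on the velocity. *)
Definition is_geodesic (gam : R -> M) : Prop :=
  [/\ smooth_curve gam,
      forall t, velocity gam t != 0 &
      forall c, atlas M c -> forall t, cdom c (gam t) ->
        let x := c \o gam in
        derive1 (derive1 x) t + 2 *: spray c (x t) (derive1 x t) = 0].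

End Finsler.

Arguments metric_tensor {R n} M.
Arguments finsler_function {R n} M.

HB.mixin Record isLieGroup (R : realType) (n : nat) G
    of SmoothManifold R n G & Group G := {
  lie_mul_continuous : continuous (fun z : G * G => (z.1 * z.2)%g);
  lie_mul_smooth : forall c1 c2 c3 : chart R n G,
    atlas G c1 -> atlas G c2 -> atlas G c3 ->
    smooth_on [set z : 'rV[R]_n * 'rV[R]_n |
                 [/\ (c1 @` cdom c1) z.1, (c2 @` cdom c2) z.2 &
                     cdom c3 (cinv c1 z.1 * cinv c2 z.2)%g]]
              (fun z => c3 (cinv c1 z.1 * cinv c2 z.2)%g);
  lie_inv_continuous : continuous (fun g : G => g^-1%g);
  lie_inv_smooth : forall c1 c2 : chart R n G, atlas G c1 -> atlas G c2 ->
    smooth_on [set x | (c1 @` cdom c1) x /\ cdom c2 ((cinv c1 x)^-1)%g]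
              (fun x => c2 ((cinv c1 x)^-1)%g)
}.

#[short(type="lieGroupType")]
HB.structure Definition LieGroup (R : realType) (n : nat) :=
  {G of isLieGroup R n G & SmoothManifold R n G & Group G}.

Section LieGroups.
Variables (R : realType) (n : nat) (G : lieGroupType R n).

Definition ltrans (g h : G) : G := (g * h)%g.

Definition lie_algebra := tangent (1%g : G).

Definition left_invariant_field (V : vector_field G) : Prop :=
  forall g h : G, V (ltrans g h) = tangent_map (ltrans g) (ltrans g h) (V h).

Definition left_field (u : lie_algebra) : vector_field G :=
  fun g => tangent_map (ltrans g) g u.

Definition lie_bracket (u v : lie_algebra) : lie_algebra :=
  vf_bracket (left_field u) (left_field v) 1%g.

(* g has nilpotency class exactly two *)
Definition two_step_nilpotent : Prop :=
  (forall u v w, lie_bracket u (lie_bracket v w) = 0) /\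
  (exists u v, lie_bracket u v != 0).

Definition left_invariant_metric (a : metric_tensor G) : Prop :=
  forall (g : G) (u v : tangent g),
    a g u v = a 1%g (tangent_map (ltrans g^-1%g) 1%g u)
                    (tangent_map (ltrans g^-1%g) 1%g v).

Definition left_invariant_finsler (F : finsler_function G) : Prop :=
  forall (g : G) (y : tangent g),
    F g y = F 1%g (tangent_map (ltrans g^-1%g) 1%g y).

(* The velocity at 0 is transported to the tangent space at 1 by the identity
   map, as gam 0 and 1 are equal but not convertible. *)
Definition one_parameter_subgroup (u : lie_algebra) (gam : R -> G) : Prop :=
  [/\ smooth_curve gam,
      forall s t, gam (s + t) = (gam s * gam t)%g &
      tangent_map idfun 1%g (velocity gam 0) = u].

(* Defined by choice among the values at 1 of the one-parameter subgroups with
   initial velocity u; there is exactly one such subgroup. *)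
Definition lie_exp (u : lie_algebra) : G :=
  xget 1%g [set g | exists2 gam, one_parameter_subgroup u gam & g = gam 1].

Definition geodesic_vector (F : finsler_function G) (Y : lie_algebra) : Prop :=
  Y != 0 /\ is_geodesic F (fun t : R => lie_exp (t *: Y)).

Definition orthonormal_family (a : metric_tensor G) (s : seq lie_algebra) :
    Prop :=
  forall i j, (i < size s)%N -> (j < size s)%N ->
    a 1%g s`_i s`_j = (i == j)%:R.

End LieGroups.

Arguments lie_algebra {R n} G.

Definition path_connected (R : realType) (T : topologicalType) : Prop :=
  forall p q : T, exists gam : R -> T,
    [/\ {within `[0, 1], continuous gam}, gam 0 = p & gam 1 = q].

Definition null_homotopic (R : realType) (T : topologicalType)
    (gam : R -> T) : Prop :=
  exists H : R * R -> T,
    {within `[0, 1] `*` `[0, 1], continuous H} /\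
    forall s : R, 0 <= s <= 1 ->
      [/\ H (s, 0) = gam s, H (s, 1) = gam 0,
          H (0, s) = gam 0 & H (1, s) = gam 0].

Definition simply_connected (R : realType) (T : topologicalType) : Prop :=
  path_connected R T /\
  forall gam : R -> T, {within `[0, 1], continuous gam} ->
    gam 0 = gam 1 -> null_homotopic gam.

Section StructureConstants.
Variables (R : realType) (G : lieGroupType R 5).
Variables (lam mu : R) (E1 E2 E3 E4 E5 : lie_algebra G).

Definition brackets_center1 : Prop :=
  [/\ lie_bracket E1 E2 = lam *: E5, lie_bracket E1 E3 = 0,
      lie_bracket E1 E4 = 0 & lie_bracket E1 E5 = 0] /\
  [/\ lie_bracket E2 E3 = 0, lie_bracket E2 E4 = 0 &
      lie_bracket E2 E5 = 0] /\
  [/\ lie_bracket E3 E4 = mu *: E5, lie_bracket E3 E5 = 0 &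
      lie_bracket E4 E5 = 0].

Definition brackets_center2 : Prop :=
  [/\ lie_bracket E1 E2 = lam *: E4, lie_bracket E1 E3 = mu *: E5,
      lie_bracket E1 E4 = 0 & lie_bracket E1 E5 = 0] /\
  [/\ lie_bracket E2 E3 = 0, lie_bracket E2 E4 = 0 &
      lie_bracket E2 E5 = 0] /\
  [/\ lie_bracket E3 E4 = 0, lie_bracket E3 E5 = 0 &
      lie_bracket E4 E5 = 0].

Definition brackets_center3 : Prop :=
  [/\ lie_bracket E1 E2 = lam *: E3, lie_bracket E1 E3 = 0,
      lie_bracket E1 E4 = 0 & lie_bracket E1 E5 = 0] /\
  [/\ lie_bracket E2 E3 = 0, lie_bracket E2 E4 = 0 &
      lie_bracket E2 E5 = 0] /\
  [/\ lie_bracket E3 E4 = 0, lie_bracket E3 E5 = 0 &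
      lie_bracket E4 E5 = 0].

End StructureConstants.

(* Main.v *)
(* In the left-invariant frame the square of the Randers metric is f(A(x) y), where
   A is the Maurer-Cartan form and f the square of a Minkowski norm on the Lie
   algebra.  By the Maurer-Cartan equation the defect
   w = 2 A(G) - dA(y, y) of the spray G, with u = A(y), satisfies
   g_u(w, z) = - g_u(u, [u, z]) for all z.  Solving for w modulo u gives
   <w, z> = - <u, [u, z]> - |u| <X, [u, z]>; the second term is odd in u while
   the first one is even, so that Douglas type forces X to be orthogonal to all
   brackets.  Along a one-parameter subgroup A(x') is constant, so A(x'' + 2 G)
   is w, and Y is a geodesic vector if and only if <Y, [Y, Z]> = 0 for all Z.
   One-parameter subgroups exist by Picard iteration near 1, and extend to all
   times t as t |-> gam(t / N)^N. *)

Require Import Defs.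
From HB Require Import structures.
From mathcomp Require Import all_boot all_order all_algebra.
From mathcomp Require Import all_classical all_reals all_analysis.
From mathcomp Require Import ring lra.

Set Implicit Arguments.
Unset Strict Implicit.
Unset Printing Implicit Defensive.

Import Order.TTheory GRing.Theory Num.Theory.
Import numFieldNormedType.Exports.

Local Open Scope classical_set_scope.
Local Open Scope ring_scope.

(** * Calculus in normed spaces *)

(** Solving for w only modulo u loses nothing: a Douglas spray is itself free up to a term P(x, y)
    y, and the unknown multiple of u is pinned down by testing against z = u, where [u, u] = 0. The
    bracket of the Lie algebra is read off in one chart at the identity, while the Maurer-Cartan
    equation is used at every point. Left invariance of the bracket of left-invariant fields
    therefore has to be proved in charts, and this rests on the symmetry of second derivatives,
    which comes from differentiability alone. A is differentiated without inverting a frame matrix: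
    its components are metric products with left-invariant fields. The exponential is a choice among
    one-parameter subgroups, so it carries information only once existence and uniqueness are known.
    Uniqueness exploits the group: the quotient of two integral curves of the same left-invariant
    field has zero derivative, which takes the place of a Gronwall estimate. *)

Section Analysis.
Variable R : realType.

Lemma diff_bound (V W : normedModType R) (f : V -> W) (a : V) (e : R) :
  differentiable f a -> 0 < e ->
  \forall h \near (0 : V), `|f (h + a) - f a - 'd f a h| <= e * `|h|.
Proof.
move=> /diff_locally df e0.
have := df; rewrite funeqE => df'.
have /eqaddoP/(_ e e0) := df.
rewrite near_simpl; apply: filterS => h /=.
rewrite /= -![(_ + _ : _ -> _) _]/(_ + _) -![(- _ : _ -> _) _]/(- _) /cst /=.
by rewrite opprD addrA.
Qed.

Lemma is_derive_line (V W : normedModType R) (f : V -> W) (b u : V) (s : R) :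
  derivable f (s *: u + b) u ->
  is_derive s 1 (fun s => f (s *: u + b)) ('D_u f (s *: u + b)).
Proof.
have E : (fun h : R => h^-1 *: (((fun s => f (s *: u + b)) \o shift s) (h *: 1)
            - f (s *: u + b)))
       = (fun h : R => h^-1 *: ((f \o shift (s *: u + b)) (h *: u)
            - f (s *: u + b))).
  by apply/funext => h; rewrite /= -[h *: 1]/(h * 1) mulr1 scalerDl addrA.
by move=> fu; split; rewrite /derivable /derive E.
Qed.

Lemma near0_norm (V : normedModType R) (P : V -> Prop) :
  (\forall x \near (0 : V), P x) ->
  exists2 d : R, 0 < d & forall x, `|x| < d -> P x.
Proof.
move=> /nbhs_normP[d /= d0 dP]; exists d => // x xd; apply: dP.
by rewrite /ball_ /= sub0r normrN.
Qed.

Lemma near_norm_shift (V : normedModType R) (a : V) (P : V -> Prop) :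
  (\forall x \near a, P x) ->
  exists2 d : R, 0 < d & forall x, `|x| < d -> P (x + a).
Proof.
move=> /nbhs_normP[d /= d0 dP]; exists d => // x xd; apply: dP.
by rewrite /ball_ /= opprD addrCA subrr addr0 normrN.
Qed.

(** The mean value theorem in the direction [u] turns the second difference into [t] times a
    difference of two values of ['D_u f], and the first-order expansion of ['D_u f] at [a] evaluates
    that difference. *)
Lemma second_difference (V : normedModType R) (f : V -> R) (a u v : V) (e : R) :
  (\forall x \near a, differentiable f x) -> differentiable ('D_u f) a -> 0 < e ->
  \forall t \near (0 : R)^'+,
   `|f (t *: u + (t *: v + a)) - f (t *: u + a) - f (t *: v + a) + f a
     - t ^+ 2 * 'D_v ('D_u f) a| <= e * t ^+ 2.
Proof.
move=> /near_norm_shift[d1 d10 fd] ud e0.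
(* For 0 <= s, r <= t the norm of [s *: u + r *: v] is at most [t * K]. Two expansions of ['D_u f]
   are compared, each with error at most [e / (2 * K)] times [t * K], which together make
   [e * t]. *)
pose K := `|u| + `|v| + 1.
have K0 : 0 < K by rewrite ltr_wpDl// addr_ge0.
have e'0 : 0 < e / (2 * K) by rewrite divr_gt0// mulr_gt0.
have [d2 d20 ub] := near0_norm (diff_bound ud e'0).
near=> t.
have t0 : 0 < t by near: t; exact: nbhs_right_gt.
have tK (s r : R) : 0 <= s <= t -> 0 <= r <= t -> `|s *: u + r *: v| <= t * K.
  move=> /andP[s0 st] /andP[r0 rt].
  rewrite (le_trans (ler_normD _ _))// !normrZ (ger0_norm s0) (ger0_norm r0).
  rewrite /K !mulrDr mulr1 -[leLHS]addr0 lerD ?(ltW t0)//.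
  by rewrite lerD// ler_wpM2r.
have td : t * K < Num.min d1 d2.
  rewrite -ltr_pdivlMr//; near: t; apply: nbhs_right_lt.
  by rewrite divr_gt0// lt_min d10.
have [td1 td2] : t * K < d1 /\ t * K < d2 by apply/andP; rewrite -lt_min.
have t2 : 0 <= t <= t by rewrite lexx ltW.
have tz : 0 <= (0 : R) <= t by rewrite lexx ltW.
pose phi s := f (s *: u + (t *: v + a)) - f (s *: u + a).
pose dphi s := 'D_u f (s *: u + (t *: v + a)) - 'D_u f (s *: u + a).
have phiD s : 0 <= s <= t -> is_derive s 1 phi (dphi s).
  move=> s2; apply: is_deriveB; apply: is_derive_line; apply: diff_derivable.
    by rewrite addrA; apply: fd; apply: le_lt_trans td1; exact: tK.
  apply: fd; have := tK _ _ s2 tz; rewrite scale0r addr0 => h.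
  exact: le_lt_trans td1.
have [||c c2 phiE] := @MVT _ phi dphi 0 t t0.
  by move=> x; rewrite in_itv/= => /andP[x0 xt]; apply: phiD; rewrite !ltW.
- apply: derivable_within_continuous => x; rewrite in_itv/= => /phiD h; exact: ex_derive.
have {}c2 : 0 <= c <= t by move: c2; rewrite in_itv/= => /andP[? ?]; rewrite !ltW.
have -> : f (t *: u + (t *: v + a)) - f (t *: u + a) - f (t *: v + a) + f a
          = phi t - phi 0.
  by rewrite /phi !scale0r !add0r; ring.
rewrite phiE /dphi subr0 expr2 -mulrA.
set X := 'D_u f _; set Y := 'D_u f (c *: u + a).
have B1 := ub _ (le_lt_trans (tK _ _ c2 t2) td2).
have B2 := ub _ (le_lt_trans (tK _ _ c2 tz) td2).
rewrite scale0r addr0 in B2.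
rewrite -[c *: u + t *: v + a]addrA -/X in B1; rewrite -/Y in B2.
rewrite mulrC -mulrBr mulrCA normrM (gtr0_norm t0) ler_pM2l//.
rewrite deriveE//.
have -> : X - Y - t * 'd ('D_u f) a v = (X - 'D_u f a - 'd ('D_u f) a (c *: u + t *: v))
    - (Y - 'D_u f a - 'd ('D_u f) a (c *: u)).
  rewrite linearD !linearZ/= -![_ *: _]/(_ * _); ring.
rewrite (le_trans (ler_normB _ _))//.
apply: le_trans (lerD B1 B2) _.
have H1 := tK _ _ c2 t2; have := tK _ _ c2 tz; rewrite scale0r addr0 => H2.
rewrite -mulrDr (@le_trans _ _ (e / (2 * K) * (t * K + t * K)))//.
  by rewrite ler_wpM2l ?(ltW e'0)// lerD.
rewrite [leLHS](_ : _ = e * t)//.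
by field; rewrite gt_eqF.
Unshelve. all: by end_near. Qed.

(** The second difference is symmetric in [u] and [v], so [t ^+ 2] times either mixed derivative
    approximates the same quantity; one positive [t] for each tolerance is enough. *)
Lemma derive_sym (V : normedModType R) (f : V -> R) (a u v : V) :
  (\forall x \near a, differentiable f x) ->
  differentiable ('D_u f) a -> differentiable ('D_v f) a ->
  'D_v ('D_u f) a = 'D_u ('D_v f) a.
Proof.
move=> fd ud vd; apply/eqP; rewrite -subr_eq0 -normr_le0.
apply/ler_addgt0Pr => e e0; rewrite add0r.
have e2 : 0 < e / 2 by rewrite divr_gt0.
have H1 := second_difference v fd ud e2.
have H2 := second_difference u fd vd e2.
have [t [[t0 h1] h2]] := filter_ex (filterI (filterI (nbhs_right_gt 0) H1) H2).
move: h2; rewrite [t *: v + (t *: u + a)]addrCA => h2.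
have {H1 H2 h1 h2} := le_trans (ler_normB _ _) (lerD h2 h1).
move: (f _) (f _) (f _) (f a) ('D_u ('D_v f) a) ('D_v ('D_u f) a) => A B C D X Y.
rewrite (_ : _ - _ = t ^+ 2 * (Y - X)); last by ring.
rewrite -mulrDl -splitr normrM (gtr0_norm (exprn_gt0 2 t0)) mulrC ler_pM2r//.
exact: exprn_gt0.
Qed.

Lemma coord_bound n (x : 'rV[R]_n) (M : R) : 0 <= M ->
  (forall i, `|x 0 i| <= M) -> `|x| <= M.
Proof.
move=> M0 xM; rewrite [leLHS]/Num.norm/= mx_normrE.
by apply: bigmax_le => // -[i j] _ /=; rewrite ord1.
Qed.

Lemma coord_norm n (x : 'rV[R]_n) i : `|x 0 i| <= `|x|.
Proof.
rewrite [leRHS]/Num.norm/= mx_normrE.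
exact: (le_bigmax _ (fun k => `|x k.1 k.2|) (0, i)).
Qed.

Lemma is_derive_coord n (V : normedModType R) (f : V -> 'rV[R]_n) (x v : V) (df : 'rV[R]_n) i :
  is_derive x v f df -> is_derive x v (fun t => f t 0 i) (df 0 i).
Proof.
move=> fd; split; first by have /derivable_mxP := @ex_derive _ _ _ _ _ _ _ fd.
by rewrite -(@derive_val _ _ _ _ _ _ _ fd) derive_mx ?mxE//; exact: ex_derive.
Qed.

Lemma is_derive_coordP n (V : normedModType R) (f : V -> 'rV[R]_n) (x v : V) (df : 'rV[R]_n) :
  (forall i, is_derive x v (fun t => f t 0 i) (df 0 i)) -> is_derive x v f df.
Proof.
move=> fd.
have fD : derivable f x v.
  by apply/derivable_mxP => i j; rewrite ord1; apply: ex_derive.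
split => //; rewrite derive_mx//; apply/rowP => i; rewrite !mxE.
exact: derive_val.
Qed.

(** The norm of a row vector is the largest absolute value of a coordinate, so the scalar mean value
    theorem on each coordinate gives the bound without loss in the constant. *)
Lemma mean_value_bound n (f df : R -> 'rV[R]_n) (a b M : R) :
  a <= b -> 0 <= M ->
  (forall s, a <= s <= b -> is_derive s 1 f (df s)) ->
  (forall s, a <= s <= b -> `|df s| <= M) -> `|f b - f a| <= M * (b - a).
Proof.
move=> ab M0 fd dfM; apply: coord_bound => [|i].
  by rewrite mulr_ge0// subr_ge0.
have [||c c2 E] := @MVT_segment _ (fun s => f s 0 i) (fun s => df s 0 i) a b ab.
  move=> x; rewrite in_itv/= => /andP[x0 xt]; apply: is_derive_coord.
  by apply: fd; rewrite !ltW.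
- apply: derivable_within_continuous => x; rewrite in_itv/= => /fd.
  move=> /(is_derive_coord i) h; exact: ex_derive.
rewrite !mxE E normrM (ger0_norm (_ : 0 <= b - a)) ?subr_ge0//.
rewrite ler_wpM2r ?subr_ge0//; apply: le_trans (coord_norm _ _) _.
by apply: dfM; move: c2; rewrite in_itv.
Qed.

End Analysis.

(** * Local solutions of ordinary differential equations *)

Section ODE.
Variable R : realType.

Lemma mean_value_bound_between n (f df : R -> 'rV[R]_n) (a b M : R) :
  0 <= M ->
  (forall s, (a <= s <= b) || (b <= s <= a) -> is_derive s 1 f (df s)) ->
  (forall s, (a <= s <= b) || (b <= s <= a) -> `|df s| <= M) ->
  `|f b - f a| <= M * `|b - a|.
Proof.
move=> M0 fd fM; case: (leP a b) => ab.
  rewrite (ger0_norm (_ : 0 <= b - a)) ?subr_ge0//.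
  by apply: (@mean_value_bound _ _ f df) => // s sab; [apply: fd|apply: fM];
    rewrite sab.
have ab0 : 0 <= a - b by rewrite subr_ge0 ltW.
rewrite distrC [X in _ * X]distrC (ger0_norm ab0).
by apply: (@mean_value_bound _ _ f df) => // [|s sab|s sab];
  [exact: ltW|apply: fd|apply: fM]; rewrite sab orbT.
Qed.

Lemma mean_value_bound_sym n (f df : R -> 'rV[R]_n) (a b M : R) :
  0 <= M ->
  (forall s, `|s - a| <= `|b - a| -> is_derive s 1 f (df s)) ->
  (forall s, `|s - a| <= `|b - a| -> `|df s| <= M) ->
  `|f b - f a| <= M * `|b - a|.
Proof.
move=> M0 fd fM.
have I s : (a <= s <= b) || (b <= s <= a) -> `|s - a| <= `|b - a|.
  case: (ger0P (s - a)) => ?; case: (ger0P (b - a)) => ? /orP[]/andP[? ?]; lra.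
by apply: (@mean_value_bound_between _ f df) => // s /I; [exact: fd|exact: fM].
Qed.

Lemma primitive (f : R -> R) (d : R) : continuous f -> 0 < d ->
  exists P : R -> R, P 0 = 0 /\ forall t : R, `|t| <= d -> is_derive t 1 P (f t).
Proof.
move=> fc d0.
(* Integrating from [- d - 1], with [d + 1] as the right end of the ambient segment, puts all of
   [-d, d] in the open interval where the fundamental theorem gives a two-sided derivative. *)
pose F x := (\int[lebesgue_measure]_(t in `[- d - 1, x]) f t)%R.
have ud : d < d + 1 by rewrite ltrDl.
exists (fun t => F t - F 0); split; first by rewrite subrr.
move=> t; rewrite ler_norml => /andP[dt td].
have [] := @continuous_FTC1_closed R f (- d - 1) t (d + 1).
- exact: le_lt_trans ud.
- apply: continuous_compact_integrable; first exact: segment_compact.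
  exact: continuous_subspaceT.
- by apply: lt_le_trans dt; rewrite ltrBlDr ltrDl.
- exact: fc.
rewrite -/F derive1E => FD FE; rewrite -FE -[X in is_derive _ _ _ X]subr0.
by apply: is_deriveB; split.
Qed.

Lemma primitive_rV n (f : R -> 'rV[R]_n) (d : R) : continuous f -> 0 < d ->
  exists P : R -> 'rV[R]_n,
    P 0 = 0 /\ forall t : R, `|t| <= d -> is_derive t 1 P (f t).
Proof.
move=> fc d0.
have fic i : continuous (fun t => f t 0 i).
  move=> t; apply: (@continuous_comp _ _ _ f (fun x : 'rV[R]_n => x 0 i)).
    exact: fc.
  exact: coord_continuous.
pose P i := projT1 (cid (primitive (fic i) d0)).
have PP i : P i 0 = 0 /\ forall t : R, `|t| <= d -> is_derive t 1 (P i) (f t 0 i).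
  exact: projT2 (cid (primitive (fic i) d0)).
exists (fun t => \row_i P i t); split.
  by apply/rowP => i; rewrite !mxE (PP i).1.
move=> t td; apply: is_derive_coordP => i.
rewrite (_ : (fun t => _) = P i); first exact: (PP i).2.
by apply/funext => s; rewrite mxE.
Qed.

Lemma le_geometric (A B C : R) : 0 <= C ->
  (forall k, A <= B + C / 2 ^+ k) -> A <= B.
Proof.
move=> C0 AB; apply/ler_addgt0Pr => e e0.
have [k kP] : exists k : nat, C / e < 2 ^+ k.
  exists (Num.Def.truncn (C / e)).+1.
  apply: (lt_le_trans (truncnS_gt _)).
  by rewrite -natrX ler_nat ltnW// ltn_expl.
apply: le_trans (AB k) _; rewrite lerD2l ler_pdivrMr ?exprn_gt0// mulrC.
by rewrite -ler_pdivrMr// ltW.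
Qed.

(** Nested intervals: [2 * M / 2 ^+ k] bounds the sum of all increments from step [k] on, so the
    intervals of this radius around [u k] decrease, and the limit is the supremum of their left
    ends. The explicit rate is what the Picard iteration uses. *)
Lemma geometric_limit (u : nat -> R) (M : R) :
  (forall k, `|u k.+1 - u k| <= M / 2 ^+ k) ->
  exists l, forall k, `|u k - l| <= 2 * M / 2 ^+ k.
Proof.
move=> uM.
have M0 : 0 <= M by have := le_trans (normr_ge0 _) (uM 0); rewrite expr0 divr1.
pose c k := 2 * M / 2 ^+ k.
have cS k : c k = c k.+1 + M / 2 ^+ k.
  by rewrite /c exprS; field; rewrite expf_neq0// pnatr_eq0.
have c0 k : 0 <= c k by rewrite /c divr_ge0 ?mulr_ge0 ?exprn_ge0.
have wS : nondecreasing_seq (fun k => u k - c k).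
  apply/nondecreasing_seqP => k; have := uM k; rewrite cS ler_norml => /andP[+ _].
  by move=> h; lra.
have vS : nonincreasing_seq (fun k => u k + c k).
  apply/nonincreasing_seqP => k; have := uM k; rewrite [c k]cS ler_norml.
  by move=> /andP[_ h]; lra.
have wv j k : u j - c j <= u k + c k.
  apply: le_trans (wS j (maxn j k) (leq_maxl _ _)) _.
  apply: le_trans (vS k (maxn j k) (leq_maxr _ _)).
  by rewrite lerD2l (le_trans _ (c0 _))// oppr_le0.
have S0 : range (fun k => u k - c k) !=set0 by exists (u 0%N - c 0%N); exists 0%N.
have SU k : ubound (range (fun k => u k - c k)) (u k + c k).
  by move=> _ [j _ <-].
exists (sup (range (fun k => u k - c k))) => k.
rewrite ler_distlC; apply/andP; split.
  by apply: ub_le_sup; [exists (u 0%N + c 0%N)|exists k].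
exact: ge_sup.
Qed.

Lemma geometric_limit_rV n (u : nat -> 'rV[R]_n) (M : R) :
  (forall k, `|u k.+1 - u k| <= M / 2 ^+ k) ->
  exists l, forall k, `|u k - l| <= 2 * M / 2 ^+ k.
Proof.
move=> uM.
have M0 : 0 <= M by have := le_trans (normr_ge0 _) (uM 0); rewrite expr0 divr1.
have uiM i k : `|u k.+1 0 i - u k 0 i| <= M / 2 ^+ k.
  by apply: le_trans (uM k); have := coord_norm (u k.+1 - u k) i; rewrite !mxE.
pose l i := projT1 (cid (geometric_limit (uiM i))).
have lP i : forall k, `|u k 0 i - l i| <= 2 * M / 2 ^+ k.
  exact: projT2 (cid (geometric_limit (uiM i))).
exists (\row_i l i) => k; apply: coord_bound => [|i].
  by rewrite divr_ge0 ?mulr_ge0 ?exprn_ge0.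
by rewrite !mxE.
Qed.

(** A quadratic remainder can be obtained for the Picard limit by passing to the limit in an
    inequality, which spares a theorem on differentiating limits. With [C = 0] it differentiates
    affine functions. *)
Lemma quadratic_is_derive (V : normedModType R) (f : R -> V) (t C : R) (l : V) :
  (\forall h \near (0 : R), `|f (h + t) - f t - h *: l| <= C * `|h| ^+ 2) ->
  is_derive t 1 f l.
Proof.
move=> H.
have L : h^-1 *: ((f \o shift t) (h *: 1) - f t) @[h --> 0^'] --> l.
  apply/cvgrPdist_le => e e0; near=> h.
  have h0 : h != 0 by near: h; exact: nbhs_dnbhs_neq.
  rewrite distrC /= -[h *: 1]/(h * 1) mulr1.
  have -> : h^-1 *: (f (h + t) - f t) - l = h^-1 *: (f (h + t) - f t - h *: l).
    by rewrite [RHS]scalerBr scalerA mulVf// scale1r.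
  rewrite normrZ normfV ler_pdivrMl ?normr_gt0//.
  apply: (@le_trans _ _ (C * `|h| ^+ 2)); first by near: h; exact: nbhs_dnbhs.
  rewrite expr2 mulrCA ler_wpM2l//.
  (* [C] may be negative or zero, whereas the absolute value plus 1 can be divided by. *)
  apply: (@le_trans _ _ ((`|C| + 1) * `|h|)).
    by rewrite ler_wpM2r// (le_trans (ler_norm _))// lerDl.
  rewrite -ler_pdivlMl// ?ltr_wpDl//; near: h; apply: dnbhs0_le.
  by rewrite mulr_gt0// invr_gt0 ltr_wpDl.
by split; [apply/cvg_ex; exists l|exact/cvg_lim].
Unshelve. all: by end_near. Qed.

End ODE.

(** * Picard iteration for a Lipschitz vector field *)

Section Picard.
Variable R : realType.

Lemma is_derive_continuous (V : normedModType R) (f : R -> V) (t : R) (l : V) :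
  is_derive t 1 f l -> {for t, continuous f}.
Proof.
by move=> fl; apply: differentiable_continuous; apply/derivable1_diffP; exact: ex_derive.
Qed.

(** The projection of the line onto [-d, d]. Precomposition with it makes the Picard iterates
    continuous on all of R, as [primitive_rV] requires, although the primitives are only controlled
    on [-d, d]. *)
Definition clamp (d t : R) := Num.max (- d) (Num.min t d).

Lemma clamp_id d t : `|t| <= d -> clamp d t = t.
Proof.
by rewrite ler_norml /clamp => /andP[dt td]; rewrite (min_idPl td) (max_idPr dt).
Qed.

Lemma clamp_norm d t : 0 <= d -> `|clamp d t| <= d.
Proof.
move=> d0; rewrite ler_norml /clamp le_max lexx/= ge_max ge_min lexx orbT andbT.
by rewrite (le_trans _ d0)// oppr_le0.
Qed.

Lemma clamp_continuous d : continuous (clamp d).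
Proof.
move=> t; apply: (@continuous_max _ _ (cst (- d)) (fun t => Num.min t d)).
  exact: cvg_cst.
apply: (@continuous_min _ _ id (cst d)); first exact: cvg_id.
exact: cvg_cst.
Qed.

Variables (n : nat) (b : 'rV[R]_n -> 'rV[R]_n) (x0 : 'rV[R]_n) (r K M : R).
Hypotheses (r0 : 0 < r) (K0 : 0 <= K) (M0 : 0 <= M).
Hypothesis bM : forall x, `|x - x0| <= r -> `|b x| <= M.
Hypothesis bK : forall x y, `|x - x0| <= r -> `|y - x0| <= r ->
  `|b x - b y| <= K * `|x - y|.

(** The iterates are [x0] plus successive primitives of [b \o X k], and consecutive ones get closer
    by a factor 1/2 at each step. The limit solves the equation by a quadratic remainder: over a
    time [h] the value of [b] along the curve moves by at most [K * M] times [|h|]. *)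
Lemma picard : exists2 d : R, 0 < d & exists x : R -> 'rV[R]_n,
  x 0 = x0 /\ forall t : R, `|t| < d ->
    `|x t - x0| <= r /\ is_derive t 1 x (b (x t)).
Proof.
(* [M * d <= r] keeps the iterates in the ball where the bounds on [b] hold, and [K * d <= 1/2]
   gives the contraction. Adding 1 keeps the denominators positive when [M] or [K] is zero. *)
pose d := Num.min (r / (M + 1)) (2 * (K + 1))^-1.
have M1 : 0 < M + 1 by rewrite ltr_wpDl.
have K1 : 0 < K + 1 by rewrite ltr_wpDl.
have d0 : 0 < d by rewrite lt_min divr_gt0// invr_gt0 mulr_gt0.
have dM : M * d <= r.
  apply: (@le_trans _ _ ((M + 1) * d)); first by rewrite ler_pM2r// lerDl.
  by rewrite mulrC -ler_pdivlMr// ge_min lexx.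
have dK : K * d <= 2^-1.
  apply: (@le_trans _ _ ((K + 1) * d)); first by rewrite ler_pM2r// lerDl.
  by rewrite mulrC -ler_pdivlMr// -invfM ge_min lexx orbT.
pose isP (f P : R -> 'rV[R]_n) :=
  P 0 = 0 /\ forall t : R, `|t| <= d -> is_derive t 1 P (f t).
pose prim f := xget (fun=> 0) [set P | isP f P].
have primP f : continuous f -> isP f (prim f).
  move=> /primitive_rV/(_ d0)[P PP].
  by apply: (@xgetPex _ (fun=> 0) [set P | isP f P]); exists P.
pose X := fix X k := if k is k'.+1 then
  (fun t => x0 + prim (b \o X k') (clamp d t)) else (fun=> x0).
have primB f A t : continuous f -> (forall s, `|s| <= d -> `|f s| <= A) ->
    `|t| <= d -> `|prim f t| <= A * `|t|.
  move=> /primP[P0 PD] fA td.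
  have A0 : 0 <= A by apply: le_trans (fA 0 _); rewrite ?normr0// ltW.
  have := @mean_value_bound_sym _ _ (prim f) f 0 t A A0.
  rewrite P0 !subr0; apply => s; rewrite subr0 => st.
    exact/PD/(le_trans st).
  exact/fA/(le_trans st).
have bc (x : R -> 'rV[R]_n) : continuous x -> (forall t, `|x t - x0| <= r) ->
    continuous (b \o x).
  move=> xc xr t; apply/cvgrPdist_le => e e0.
  have e1 : 0 < e / (K + 1) by rewrite divr_gt0.
  have /cvgrPdist_le/(_ _ e1) := xc t; apply: filterS => s /= xs.
  apply: le_trans (bK (xr _) (xr _)) _.
  apply: (@le_trans _ _ ((K + 1) * `|x t - x s|)).
    by rewrite ler_wpM2r// lerDl.
  by rewrite mulrC -ler_pdivlMr.
have inv k : continuous (X k) /\ forall t, `|X k t - x0| <= r.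
  elim: k => [|k [Xc Xr]].
    by split=> [t|t /=]; [exact: cvg_cst|rewrite subrr normr0 ltW].
  have bXc := bc _ Xc Xr.
  split=> [t|t /=]; last first.
    rewrite [x0 + _]addrC addrK; have cd := clamp_norm t (ltW d0).
    apply: le_trans (primB _ M _ bXc _ cd) _ => [s _|]; first exact: bM.
    by apply: le_trans dM; rewrite ler_wpM2l.
  apply: (@cvgD _ _ _ _ _ (cst x0)); first exact: cvg_cst.
  apply: (@continuous_comp _ _ _ (clamp d) (prim (b \o X k))).
    exact: clamp_continuous.
  apply: is_derive_continuous; apply: (primP _ bXc).2.
  exact/clamp_norm/ltW.
have Xc k := (inv k).1; have Xr k := (inv k).2.
have bXc k : continuous (b \o X k) by exact: bc.
have XX k t : `|X k.+1 t - X k t| <= r / 2 ^+ k.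
  elim: k t => [|k IH] t; first by rewrite expr0 divr1; exact: Xr.
  have cd := clamp_norm t (ltW d0); set s := clamp d t in cd.
  rewrite /= opprD addrACA subrr add0r -/s.
  have [P0 PD] := primP _ (bXc k.+1); have [Q0 QD] := primP _ (bXc k).
  pose f s := (b \o X k.+1) s - (b \o X k) s.
  have := @mean_value_bound_sym _ _ (prim (b \o X k.+1) - prim (b \o X k)) f 0 s
    (K * (r / 2 ^+ k)).
  rewrite !fctE P0 Q0 subrr !subr0 => H.
  apply: (le_trans (H _ _ _)) => [|u|u|].
  - by rewrite mulr_ge0// divr_ge0 ?exprn_ge0// ltW.
  - rewrite subr0 => us; apply: is_deriveB.
      exact/PD/(le_trans us).
    exact/QD/(le_trans us).
  - move=> _; apply: le_trans (bK (Xr _ _) (Xr _ _)) _.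
    by rewrite ler_wpM2l.
  apply: (@le_trans _ _ (K * (r / 2 ^+ k) * d)).
    by rewrite ler_wpM2l// mulr_ge0// divr_ge0 ?exprn_ge0// ltW.
  have -> : K * (r / 2 ^+ k) * d = K * d * (r / 2 ^+ k) by ring.
  have -> : r / 2 ^+ k.+1 = 2^-1 * (r / 2 ^+ k) by rewrite exprS invfM; ring.
  by rewrite ler_wpM2r// divr_ge0 ?exprn_ge0// ltW.
pose x t := projT1 (cid (geometric_limit_rV (fun k => XX k t))).
have xP t : forall k, `|X k t - x t| <= 2 * r / 2 ^+ k.
  exact: projT2 (cid (geometric_limit_rV (fun k => XX k t))).
have r2 : 0 <= 2 * r by rewrite mulr_ge0// ltW.
exists d => //; exists x; split.
  apply/eqP; rewrite -subr_eq0 -normr_le0; apply: (le_geometric r2) => k.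
  rewrite add0r distrC; apply: le_trans (xP 0 k).
  have -> // : X k 0 = x0.
  case: k => //= k; rewrite clamp_id ?normr0 ?ltW//.
  by rewrite (primP _ (bXc k)).1 addr0.
have xr t : `|x t - x0| <= r.
  apply: (le_geometric r2) => k; rewrite [leRHS]addrC.
  rewrite -(subrK (X k t) (x t)) -addrA (le_trans (ler_normD _ _))//.
  by rewrite lerD// distrC.
move=> t td; split; first exact: xr.
pose Y k s := x0 + prim (b \o X k) s.
have XY k s : `|s| <= d -> X k.+1 s = Y k s by move=> sd /=; rewrite clamp_id.
have YD k (s : R) : `|s| <= d -> is_derive s 1 (Y k) (b (X k s)).
  move=> sd; rewrite -[X in is_derive _ _ _ X]add0r.
  by apply: is_deriveD; exact: (primP _ (bXc k)).2.
have XL k s : `|s| <= d -> `|X k s - X k t| <= M * `|s - t|.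
  move=> sd; case: k => [|k]; first by rewrite subrr normr0 mulr_ge0.
  rewrite !XY ?(ltW td)//.
  have I u : (t <= u <= s) || (s <= u <= t) -> `|u| <= d.
    move: td sd; rewrite ltr_norml !ler_norml => /andP[? ?] /andP[? ?].
    by move=> /orP[]/andP[? ?]; apply/andP; split; lra.
  apply: (@mean_value_bound_between _ _ _ (b \o X k)) => // u /I.
    exact: YD.
  by move=> _; exact: bM.
apply: (@quadratic_is_derive _ _ _ _ (K * M)).
have : \forall h \near (0 : R), `|h| < d - `|t|.
  apply/nbhs_normP; exists (d - `|t|) => /=; first by rewrite subr_gt0.
  by move=> h; rewrite /ball_/= sub0r normrN.
apply: filterS => h hd.
have I u : `|u| <= `|h| -> `|u + t| <= d.
  move=> uh; rewrite (le_trans (ler_normD _ _))// -lerBrDr.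
  by rewrite (le_trans uh)// ltW.
have I' u : `|u - t| <= `|h| -> `|u| <= d by move=> /I; rewrite subrK.
(* [c / 2 ^+ k] collects the cost of replacing the limit by iterates: once inside [b], and once at
   each of the two times [h + t] and [t]. *)
pose c := K * (2 * r) * `|h| + 2 * r.
have c0 : 0 <= c by rewrite addr_ge0 ?mulr_ge0// ltW.
apply: (le_geometric c0) => k.
(* Subtracting the expected linear part leaves the derivative [b (X k s) - b (x t)], small by the
   Lipschitz bound because [X k] moves with speed at most [M]. *)
pose Z s := Y k s - (s - t) *: b (x t).
have ZD (s : R) : `|s| <= d -> is_derive s 1 Z (b (X k s) - b (x t)).
  move=> sd; apply: is_deriveB; first exact: YD.
  apply: (@quadratic_is_derive _ _ _ _ 0); apply: filterE => u.
  rewrite -!scalerBl (_ : _ - u = 0) ?scale0r ?normr0 ?mul0r//; ring.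
have : `|Z (h + t) - Z t| <= K * (M * `|h| + 2 * r / 2 ^+ k) * `|h|.
  have := @mean_value_bound_sym _ _ Z (fun s => b (X k s) - b (x t)) t (h + t)
    (K * (M * `|h| + 2 * r / 2 ^+ k)).
  rewrite addrK; apply => [|s /I'|s sh].
  - by rewrite mulr_ge0// addr_ge0 ?mulr_ge0 ?invr_ge0 ?exprn_ge0// ltW.
  - exact: ZD.
  apply: le_trans (bK (Xr _ _) (xr _)) _; rewrite ler_wpM2l//.
  rewrite -(subrK (X k t) (X k s)) -addrA (le_trans (ler_normD _ _))// lerD//.
  by apply: le_trans (XL _ _ (I' _ sh)) _; rewrite ler_wpM2l.
rewrite /Z subrr scale0r subr0 addrK -!XY ?I ?(ltW td)// => ZB.
rewrite (_ : _ - _ - _ = (X k.+1 (h + t) - h *: b (x t) - X k.+1 t)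
   + (x (h + t) - X k.+1 (h + t)) + (X k.+1 t - x t)); last first.
  by apply/rowP => i; rewrite !mxE; ring.
apply: le_trans (ler_normD _ _) _; apply: (le_trans (lerD (ler_normD _ _) (xP t k.+1))).
rewrite [`|x _ - _|]distrC.
apply: (le_trans (lerD (lerD ZB (xP (h + t) k.+1)) (lexx _))).
rewrite /c exprS le_eqVlt; apply/orP; left; apply/eqP; field.
by rewrite expf_neq0.
Qed.
End Picard.

(** * Functions of class C^k *)

Section Smoothness.
Variable R : realType.
Implicit Types U V W : normedModType R.

Lemma differentiable_near0 V W (h : V -> W) (x : V) :
  (\forall y \near x, h y = 0) -> differentiable h x.
Proof.
move=> h0.
have E : h \o shift x = cst (h x) + (0 : V -> W) +o_ (nbhs (0 : V)) id.
  apply/eqaddoP => e e0; rewrite near_simpl.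
  have [d d0 dP] := near_norm_shift h0.
  apply/nbhs_normP; exists d => //= y; rewrite /ball_ /= sub0r normrN => yd.
  have hx : h x = 0 by have := dP 0; rewrite normr0 add0r; apply.
  rewrite -![(_ + _ : _ -> _) _]/(_ + _) -![(- _ : _ -> _) _]/(- _) /cst /=.
  by rewrite dP// hx addr0 subrr normr0 mulr_ge0// ltW.
have dE : 'd h x = (0 : V -> W) :> (V -> W).
  by apply/diff_unique => //; have [] := dcst (0 : W) x.
by apply/diff_locallyP; rewrite dE; split => //; have [] := dcst (0 : W) x.
Qed.

(** [g] is [f] plus a function that vanishes near [x]. Charts cancel against their inverses only
    near a point, and this is how differentiability passes to the simplified expression. *)
Lemma differentiable_near_eq V W (f g : V -> W) (x : V) :
  (\forall y \near x, f y = g y) -> differentiable f x -> differentiable g x.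
Proof.
move=> fg df; have -> : g = f + (g - f) by apply/funext => y; rewrite !fctE addrC subrK.
apply: differentiableD => //; apply: differentiable_near0.
by move: fg; apply: filterS => y E; rewrite -[LHS]/(g y - f y) E subrr.
Qed.

Lemma diff_chain U V W (f : U -> V) (g : V -> W) x z v :
  differentiable f x -> f x = z -> differentiable g z ->
  'd g z ('d f x v) = 'd (g \o f) x v.
Proof.
by move=> df <- dg; exact: (esym (congr1 (@^~ v) (diff_comp df dg))).
Qed.

Lemma differentiable_chain U V W (f : U -> V) (g : V -> W) x z :
  differentiable f x -> f x = z -> differentiable g z ->
  differentiable (g \o f) x.
Proof. by move=> df <- dg; exact: differentiable_comp. Qed.

Lemma near_eq_diff V W (f g : V -> W) x v :
  differentiable f x -> (\forall y \near x, f y = g y) -> 'd f x v = 'd g x v.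
Proof.
move=> df fg; have dg := differentiable_near_eq fg df.
apply: (etrans (esym (deriveE v df))); apply: (etrans _ (deriveE v dg)).
exact: near_eq_derive.
Qed.

Lemma Ck_onS U V k (A : set U) (f : U -> V) : Ck_on k.+1 A f -> Ck_on k A f.
Proof.
elim: k f => [|k IH] f [df Df] /=.
  by move=> x /df; exact: differentiable_continuous.
by split => // v; apply: IH; exact: Df.
Qed.

Lemma Ck_on_subset U V k (A B : set U) (f : U -> V) :
  A `<=` B -> Ck_on k B f -> Ck_on k A f.
Proof.
move=> AB; elim: k f => [|k IH] f /=; first by move=> h x /AB; exact: h.
by move=> [df Df]; split => [x /AB/df//|v]; exact/IH/Df.
Qed.

(** Openness of [A] turns equality on [A] into equality near each of its points, so the directional
    derivatives agree on [A] as well and the induction continues. *)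
Lemma Ck_on_ext U V k (A : set U) (f g : U -> V) : open A ->
  (forall x, A x -> f x = g x) -> Ck_on k A f -> Ck_on k A g.
Proof.
move=> oA; elim: k f g => [|k IH] f g fg /= Cf.
  move=> x Ax; have := Cf x Ax.
  rewrite /prop_for /continuous_at (fg _ Ax); apply: cvg_trans.
  apply: near_eq_cvg; have := open_nbhs_nbhs (conj oA Ax).
  by apply: filterS => y /fg.
have near_fg x : A x -> \forall y \near x, f y = g y.
  by move=> Ax; have := open_nbhs_nbhs (conj oA Ax); apply: filterS => y /fg.
have [df Df] := Cf; split=> [x Ax|v].
  exact: differentiable_near_eq (near_fg x Ax) (df x Ax).
apply: IH (Df v) => x Ax.
exact: (near_eq_derive _ (near_fg x Ax)).
Qed.

Lemma derivative_linear U V (f g h : U -> V)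
    (x w : U) (k : R) :
  differentiable g x -> differentiable h x ->
  (\forall y \near x, f y = k *: g y + h y) ->
  'D_w f x = k *: 'D_w g x + 'D_w h x.
Proof.
move=> dg dh /(near_eq_derive w) ->.
apply: derive_val; apply: is_deriveD; last by split => //; exact: diff_derivable.
by apply: is_deriveZ; split => //; exact: diff_derivable.
Qed.

Lemma Ck_on_cst U V k (A : set U) (c : V) : Ck_on k A (cst c : U -> V).
Proof.
elim: k c => [|k IH] c /=; first by move=> x _; exact: cvg_cst.
split=> [x _|v]; first exact: differentiable_cst.
have -> : 'D_v (cst c : U -> V) = cst 0 by apply/funext => x; rewrite derive_cst.
exact: IH.
Qed.

Lemma Ck_onD U V k (A : set U) (f g : U -> V) : open A ->
  Ck_on k A f -> Ck_on k A g -> Ck_on k A (f + g).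
Proof.
move=> oA; elim: k f g => [|k IH] f g /= Cf Cg.
  by move=> x Ax; apply: cvgD; [exact: Cf|exact: Cg].
have [[df Df] [dg Dg]] := (Cf, Cg); split=> [x Ax|v].
  by apply: differentiableD; [exact: df|exact: dg].
apply: (@Ck_on_ext _ _ _ _ ('D_v f + 'D_v g)) => //; last exact: IH.
by move=> x Ax; rewrite deriveD//; apply: diff_derivable; [exact: df|exact: dg].
Qed.

Lemma Ck_on_sum U V k (A : set U) n (f : 'I_n -> U -> V) : open A ->
  (forall i, Ck_on k A (f i)) -> Ck_on k A (\sum_(i < n) f i).
Proof.
move=> oA Cf; elim/big_ind: _ => [|g h|i _]; last exact: Cf.
  exact: (Ck_on_cst _ _ (0 : V)).
exact: Ck_onD.
Qed.

Lemma derive_scale U V (phi : U -> R) (f : U -> V) x v :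
  differentiable phi x -> differentiable f x ->
  differentiable (fun x => phi x *: f x) x /\
  'D_v (fun x => phi x *: f x) x = 'D_v phi x *: f x + phi x *: 'D_v f x.
Proof.
move=> dp df.
have dpf := differentiable_pair dp df.
(* Packing scalar multiplication as a continuous bilinear map makes the Leibniz rule an instance of
   the differential of a bilinear map composed with a pair. *)
have scB : bilinear_for (GRing.Scale.Law.clone _ _ *:%R _)
    (GRing.Scale.Law.clone _ _ *:%R _) (@GRing.scale R V).
  split=> [w|r] c y z /=; first by rewrite scalerDl scalerA.
  by rewrite scalerDr !scalerA mulrC.
pose scM := bilinear_isBilinear.Build R R V V _ _ (@GRing.scale R V) scB.
pose sc : {bilinear R -> V -> V} := HB.pack (@GRing.scale R V) scM.
have scc : continuous (fun p : R * V => sc p.1 p.2) by move=> p; exact: scale_continuous.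
have dsc := differentiable_bilin (phi x, f x) scc.
have D : differentiable (fun x => phi x *: f x) x.
  exact: (differentiable_comp (g := fun p : R * V => sc p.1 p.2) dpf dsc).
split => //; rewrite (deriveE v D) (deriveE v dp) (deriveE v df).
have C := congr1 (@^~ v) (diff_comp (g := fun p : R * V => sc p.1 p.2) dpf dsc).
have B := congr1 (@^~ ('d phi x v, 'd f x v)) (diff_bilin (phi x, f x) scc).
have P := congr1 (@^~ v) (diff_pair dp df).
rewrite /= in C B P; apply: (etrans C); rewrite P; apply: (etrans B).
exact: addrC.
Qed.

Lemma Ck_onZ U V k (A : set U) (phi : U -> R) (f : U -> V) : open A ->
  Ck_on k A phi -> Ck_on k A f -> Ck_on k A (fun x => phi x *: f x).
Proof.
move=> oA; elim: k phi f => [|k IH] phi f Cp Cf.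
  by move=> x Ax; apply: cvgZ; [exact: Cp|exact: Cf].
have [[dp Dp] [df Df]] := (Cp, Cf); split=> [x Ax|v].
  by have [] := derive_scale 0 (dp x Ax) (df x Ax).
apply: (@Ck_on_ext _ _ _ _
  ((fun x => 'D_v phi x *: f x) + (fun x => phi x *: 'D_v f x))) => //.
  by move=> x Ax; have [_ ->] := derive_scale v (dp x Ax) (df x Ax).
by apply: Ck_onD => //; apply: IH; [exact: Dp|exact: Ck_onS|exact: Ck_onS|exact: Df].
Qed.

Lemma Ck_on_coord U n k (A : set U) (f : U -> 'rV[R]_n) i : open A ->
  Ck_on k A f -> Ck_on k A (fun x => f x 0 i).
Proof.
move=> oA; elim: k f => [|k IH] f Cf.
  move=> x Ax; apply: (@continuous_comp _ _ _ f (fun x : 'rV[R]_n => x 0 i)).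
    exact: Cf.
  exact: coord_continuous.
have [df Df] := Cf; split=> [x Ax|v].
  apply: (@differentiable_comp _ _ _ _ f (fun x : 'rV[R]_n => x 0 i)).
    exact: df.
  exact: differentiable_coord.
apply: (@Ck_on_ext _ _ _ _ (fun x => 'D_v f x 0 i)) => //; last exact/IH/Df.
move=> x Ax; apply/esym; apply: derive_val; apply: is_derive_coord.
by split => //; apply: diff_derivable; exact: df.
Qed.

Lemma diff_delta n V (f : 'rV[R]_n -> V) x v : differentiable f x ->
  'd f x v = \sum_j v 0 j *: 'D_(delta_mx 0 j) f x.
Proof.
move=> df; rewrite [v in LHS]row_sum_delta linear_sum/=.
by apply: eq_bigr => j _; rewrite linearZ/= -deriveE.
Qed.

Lemma derive_comp_curve U V W (f : U -> V) (g : V -> W) x v :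
  differentiable f x -> differentiable g (f x) ->
  'D_v (g \o f) x = 'd g (f x) ('D_v f x).
Proof.
move=> df dg; have dgf := differentiable_comp df dg.
rewrite (deriveE v dgf) (deriveE v df).
exact: (congr1 (@^~ v) (diff_comp df dg)).
Qed.

(** The chain rule in partial derivatives is a sum of products of coordinates of ['D_v x] with
    functions ['D_(delta_mx 0 j) f \o x]. All factors are of class one lower, so the induction
    closes under products and sums. *)
Lemma Ck_on_comp U V n k (A : set U) (B : set 'rV[R]_n) (x : U -> 'rV[R]_n)
    (f : 'rV[R]_n -> V) : open A ->
  (forall t, A t -> B (x t)) -> Ck_on k A x -> Ck_on k B f ->
  Ck_on k A (f \o x).
Proof.
move=> oA AB; elim: k f => [|k IH] f Cx Cf.
  by move=> t At; apply: continuous_comp; [exact: Cx|exact/Cf/AB].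
have [[dx Dx] [df Df]] := (Cx, Cf); split=> [t At|v].
  by apply: differentiable_comp; [exact: dx|exact/df/AB].
apply: (@Ck_on_ext _ _ _ _ (\sum_(j < n)
  (fun t => 'D_v x t 0 j *: ('D_(delta_mx 0 j) f \o x) t))) => //.
  move=> t At; rewrite derive_comp_curve//; [|exact: dx|exact/df/AB].
  rewrite diff_delta; last exact/df/AB.
  by rewrite fct_sumE.
apply: Ck_on_sum => // j; apply: Ck_onZ => //.
  exact/Ck_on_coord/Dx.
by apply: IH; [exact: Ck_onS|exact: Df].
Qed.

(** Bootstrapping: the derivative of [x] is [b \o x], which is as regular as [x], so each order of
    differentiability gives the next. *)
Lemma Ck_on_integral_curve n k (A : set R) (B : set 'rV[R]_n)
    (b : 'rV[R]_n -> 'rV[R]_n) (x : R -> 'rV[R]_n) : open A ->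
  (forall t, A t -> B (x t)) -> smooth_on B b ->
  (forall t : R, A t -> is_derive t 1 x (b (x t))) -> Ck_on k A x.
Proof.
move=> oA AB Cb xD.
have dx t : A t -> differentiable x t.
  by move=> /xD h; apply/derivable1_diffP; exact: ex_derive.
elim: k => [|k IH]; first by move=> t /dx; exact: differentiable_continuous.
split => // v; apply: (@Ck_on_ext _ _ _ _ (fun t => v *: (b \o x) t)) => //.
  move=> t At /=; rewrite -(@derive_val _ _ _ _ _ _ _ (xD _ At)).
  rewrite (deriveE _ (dx _ At)) (deriveE _ (dx _ At)).
  by rewrite -linearZ/= -[v *: 1]/(v * 1) mulr1.
apply: (Ck_onZ (phi := cst v)) => //; first exact: (Ck_on_cst k A v).
by apply: Ck_on_comp IH (Cb k).
Qed.

(** For an affine [j] with linear part [L], differentiating [f \o j] along [v] is differentiating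
    [f] along [L v]. It serves to restrict the group multiplication, a function on a product, to
    slices where one factor is fixed. *)
Lemma Ck_on_affine U V W k (A : set V) (j L : U -> V) (f : V -> W) :
  (forall x v (h : R), j (h *: v + x) = h *: L v + j x) ->
  (forall x, differentiable j x) ->
  Ck_on k A f -> Ck_on k (j @^-1` A) (f \o j).
Proof.
move=> jL dj; elim: k f => [|k IH] f Cf.
  move=> x /= Ax; apply: continuous_comp; first exact: differentiable_continuous.
  exact: Cf.
have [df Df] := Cf; split=> [x /= Ax|v].
  exact: (differentiable_comp (dj x) (df _ Ax)).
have -> : 'D_v (f \o j) = 'D_(L v) f \o j; last exact: (IH _ (Df (L v))).
apply/funext => x; rewrite /derive /=.
have -> // : (fun h : R => h^-1 *: (((f \o j) \o shift x) (h *: v) - f (j x)))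
  = (fun h : R => h^-1 *: ((f \o shift (j x)) (h *: L v) - f (j x))).
by apply/funext => h /=; rewrite jL.
Qed.

Lemma derive_sym_rV U n (f : U -> 'rV[R]_n) (a u v : U) :
  (\forall x \near a, differentiable f x) ->
  differentiable ('D_u f) a -> differentiable ('D_v f) a ->
  'D_v ('D_u f) a = 'D_u ('D_v f) a.
Proof.
move=> fd ud vd.
have dc (g : U -> 'rV[R]_n) x i : differentiable g x ->
    differentiable (fun y => g y 0 i) x.
  by move=> dg; exact: (differentiable_comp dg (differentiable_coord _ _ _)).
have Dc (w : U) i : \forall x \near a, 'D_w f x 0 i = 'D_w (fun y => f y 0 i) x.
  apply: filterS fd => x dx; apply/esym/derive_val/is_derive_coord.
  by split => //; exact: diff_derivable.
have DDc (w z : U) i : differentiable ('D_w f) a ->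
    'D_z ('D_w f) a 0 i = 'D_z ('D_w (fun y => f y 0 i)) a.
  move=> wd; rewrite -(near_eq_derive z (Dc w i)); apply/esym/derive_val.
  by apply: is_derive_coord; split => //; exact: diff_derivable.
apply/rowP => i; apply: (etrans (DDc u v i ud)).
apply: (etrans _ (esym (DDc v u i vd))); apply: derive_sym.
- by apply: filterS fd => x; exact: dc.
- exact: differentiable_near_eq (Dc u i) (dc _ _ _ ud).
- exact: differentiable_near_eq (Dc v i) (dc _ _ _ vd).
Qed.

End Smoothness.

(** * Tangent maps *)

Lemma tangent_chart_inj (R : realType) (n : nat) (M : smoothManifoldType R n)
    (p : M) (c : chart R n M) (u v : tangent p) :
  charts_at p c -> tcoord u c = tcoord v c -> u = v.
Proof. by move=> cp uv; rewrite -(tcoordK cp u) -(tcoordK cp v) uv. Qed.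

Section TangentMaps.
Variables (R : realType) (n m : nat).
Variables (M : smoothManifoldType R n) (N : smoothManifoldType R m).

(* The target point is kept apart, as in [tangent_map]. *)
Definition smooth_at (f : M -> N) (p : M) (q : N) : Prop :=
  [/\ f p = q, {for p, continuous f} &
      forall c c', charts_at p c -> charts_at q c' ->
        differentiable (c' \o f \o cinv c) (c p)].

Lemma chart_inv_near (c : chart R n M) (p : M) (P : M -> Prop) :
  cdom c p -> (\forall q \near p, P q) -> \forall x \near c p, P (cinv c x).
Proof.
move=> cp Pp; apply: (cinv_continuous (imageP c cp)); rewrite cmapK//.
Qed.

Lemma chart_dom_near (c : chart R n M) (p : M) :
  cdom c p -> \forall q \near p, cdom c q.
Proof. by move=> cp; apply: open_nbhs_nbhs; split => //; exact: cdom_open. Qed.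

Lemma near_continuous (T U : topologicalType) (f : T -> U) (p : T) (q : U)
    (P : U -> Prop) :
  {for p, continuous f} -> f p = q -> (\forall y \near q, P y) ->
  \forall x \near p, P (f x).
Proof. by move=> fc <- Pq; exact: fc Pq. Qed.

End TangentMaps.

(** [tangent_map] is computed in the chosen charts; for a smooth map the chain rule shows that any
    other charts around the two points give the same vector. The transition maps cancel only near
    [p], so the last comparison is between germs. *)
Lemma tcoord_tangent_map (R : realType) (n m : nat)
    (M : smoothManifoldType R n) (N : smoothManifoldType R m)
    (f : M -> N) p q (u : tangent p) c c' :
  smooth_at f p q -> charts_at p c -> charts_at q c' ->
  tcoord (tangent_map f q u) c' = 'd (c' \o f \o cinv c) (c p) (tcoord u c).
Proof.
move=> [fp fc fd] cp c'q.
have kp := charts_at_chart_at p; have kq := charts_at_chart_at q.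
rewrite /tangent_map /= /tvec_coord asboolT//.
rewrite (tcoord_change u cp kp).
have [_ cdp] := cp; have [_ kdp] := kp; have [_ cdq] := c'q; have [_ kdq] := kq.
set k := chart_at p; set k' := chart_at q.
have d1 : differentiable (k \o cinv c) (c p) := transition_differentiable cp kp.
have d2 := fd _ _ kp kq.
have d3 := transition_differentiable kq c'q.
have E1 : (k \o cinv c) (c p) = k p by rewrite /= cmapK.
have E12 : ((k' \o f \o cinv k) \o (k \o cinv c)) (c p) = k' q.
  by rewrite /= cmapK// cmapK// fp.
have d12 := differentiable_chain d1 E1 d2.
have d123 := differentiable_chain d12 E12 d3.
transitivity ('d (c' \o cinv k') (k' q)
    ('d ((k' \o f \o cinv k) \o (k \o cinv c)) (c p) (tcoord u c))).
  apply: (congr1 ('d (c' \o cinv k') (k' q))).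
  exact: (diff_chain _ d1 E1 d2).
apply: (etrans (diff_chain _ d12 E12 d3)); apply: (near_eq_diff _ d123).
have F1 : \forall q0 \near p, cdom k q0 by exact: chart_dom_near.
have F2 : \forall q0 \near p, cdom k' (f q0).
  exact: (near_continuous fc fp (chart_dom_near kdq)).
have F : \forall q0 \near p, cdom k q0 /\ cdom k' (f q0) by exact: filterI.
apply: filterS (chart_inv_near cdp F) => x [x1 x2].
by rewrite /= (cmapK x1) (cmapK x2).
Qed.

Section TangentMapTheory.
Variables (R : realType) (n m l : nat) (M : smoothManifoldType R n)
  (N : smoothManifoldType R m) (L : smoothManifoldType R l).

Lemma smooth_at_comp (f : M -> N) (g : N -> L) p q r :
  smooth_at f p q -> smooth_at g q r -> smooth_at (g \o f) p r.
Proof.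
move=> [fp fc fd] [gq gc gd]; split; first by rewrite /= fp.
  by apply: continuous_comp => //; rewrite fp.
move=> c c' cp c'r.
have kq := charts_at_chart_at q; have [_ kdq] := kq; have [_ cdp] := cp.
set k := chart_at q.
have d1 := fd _ _ cp kq; have d2 := gd _ _ kq c'r.
have E1 : (k \o f \o cinv c) (c p) = k q by rewrite /= cmapK// fp.
have d12 := differentiable_chain d1 E1 d2.
apply: differentiable_near_eq d12.
have F2 : \forall q0 \near p, cdom k (f q0).
  exact: (near_continuous fc fp (chart_dom_near kdq)).
by apply: filterS (chart_inv_near cdp F2) => x x1; rewrite /= (cmapK x1).
Qed.

Lemma tangent_map_comp (f : M -> N) (g : N -> L) p q r (u : tangent p) :
  smooth_at f p q -> smooth_at g q r ->
  tangent_map g r (tangent_map f q u) = tangent_map (g \o f) r u.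
Proof.
move=> sf sg; have sgf := smooth_at_comp sf sg.
have cp := charts_at_chart_at p; have kq := charts_at_chart_at q.
have cr := charts_at_chart_at r.
apply: (tangent_chart_inj cr).
apply: (etrans (tcoord_tangent_map _ sg kq cr)).
apply: (etrans (congr1 _ (tcoord_tangent_map _ sf cp kq))).
apply: (etrans _ (esym (tcoord_tangent_map _ sgf cp cr))).
have [fp fc fd] := sf; have [gq gc gd] := sg.
have [_ kdq] := kq; have [_ cdp] := cp.
have d1 := fd _ _ cp kq; have d2 := gd _ _ kq cr.
set k := chart_at q in d1 d2 kq kdq *; set c := chart_at p in cp cdp d1 *.
have E1 : (k \o f \o cinv c) (c p) = k q by rewrite /= cmapK// fp.
apply: (etrans (diff_chain _ d1 E1 d2)); apply: near_eq_diff.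
  exact: differentiable_chain E1 d2.
have F2 : \forall q0 \near p, cdom k (f q0).
  exact: (near_continuous fc fp (chart_dom_near kdq)).
by apply: filterS (chart_inv_near cdp F2) => x x1; rewrite /= (cmapK x1).
Qed.

Lemma tangent_map_linear (f : M -> N) p q (k : R) (u v : tangent p) :
  tangent_map f q (k *: u + v) = k *: tangent_map f q u + tangent_map f q v.
Proof.
have cq := charts_at_chart_at q; apply: (tangent_chart_inj cq).
rewrite /tangent_map; set D := 'd _ _; set c := chart_at q.
rewrite -[tcoord (k *: u + v) _]/(k *: tcoord u _ + tcoord v _).
rewrite -[RHS]/(k *: tcoord (tvec q c (D (tcoord u (chart_at p)))) c
  + tcoord (tvec q c (D (tcoord v (chart_at p)))) c).
by rewrite !(tvecK cq) linearP.
Qed.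

End TangentMapTheory.

Lemma smooth_at_id (R : realType) (n : nat) (M : smoothManifoldType R n) (p q : M) :
  p = q -> smooth_at idfun p q.
Proof.
move=> <-; split => //.
by move=> c c' cp c'p; exact: transition_differentiable.
Qed.

Lemma tangent_map_id (R : realType) (n : nat) (M : smoothManifoldType R n) (p : M)
  (u : tangent p) : tangent_map idfun p u = u.
Proof.
have cp := charts_at_chart_at p; apply: (tangent_chart_inj cp).
by rewrite (tcoord_tangent_map _ (smooth_at_id erefl) cp cp) [RHS](tcoord_change u cp cp).
Qed.

(** * Left-invariant fields *)

Section LeftFields.
Variables (R : realType) (n : nat) (G : lieGroupType R n).
Implicit Types (g h p q : G) (c : chart R n G) (u v : lie_algebra G).

Local Notation c1 := (chart_at (1%g : G)).

Lemma mul_smooth_at_charts c c' c'' g h : charts_at g c -> charts_at h c' ->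
  charts_at (g * h)%g c'' ->
  differentiable (fun z : 'rV[R]_n * 'rV[R]_n =>
    c'' (cinv c z.1 * cinv c' z.2)%g) (c g, c' h).
Proof.
move=> [ac cg] [ac' c'h] [ac'' c''gh].
have [+ _] := lie_mul_smooth _ _ _ ac ac' ac'' 1%N; apply.
by split; [exists g|exists h|rewrite /= !cmapK].
Qed.

Lemma mul_continuous (T : topologicalType) (f f' : T -> G) t :
  {for t, continuous f} -> {for t, continuous f'} ->
  {for t, continuous (fun t => (f t * f' t)%g)}.
Proof.
move=> fc fc'.
apply: (@continuous_comp _ _ _ (fun t => (f t, f' t))
  (fun z : G * G => (z.1 * z.2)%g)); last exact: lie_mul_continuous.
exact: cvg_pair.
Qed.

Lemma ltrans_continuous g p : {for p, continuous (ltrans g)}.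
Proof.
apply: (@mul_continuous _ (fun=> g) id); first exact: cvg_cst.
exact: cvg_id.
Qed.

Lemma ltrans_smooth g p q : (g * p)%g = q -> smooth_at (ltrans g) p q.
Proof.
move=> <-; split => //; first exact: ltrans_continuous.
move=> c c' cp c'q; have kg := charts_at_chart_at g.
have [_ kdg] := kg; set k := chart_at g in kg kdg *.
have d1 : differentiable (fun x : 'rV[R]_n => (k g, x)) (c p).
  apply: (differentiable_pair (f := cst (k g)) (g := id)).
    exact: differentiable_cst.
  exact: ex_diff.
have := differentiable_chain d1 erefl (mul_smooth_at_charts kg cp c'q).
by apply: differentiable_near_eq; apply: filterE => x; rewrite /= cmapK.
Qed.

Lemma ltrans_comp g h : ltrans g \o ltrans h = ltrans (g * h)%g.
Proof. by apply/funext => x; exact: mulgA. Qed.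

Lemma ltrans1 : ltrans (1%g : G) = idfun.
Proof. by apply/funext => x; exact: mul1g. Qed.

Lemma ltrans_tangent_map_comp g h p q r (u : tangent p) :
  (h * p)%g = q -> (g * q)%g = r ->
  tangent_map (ltrans g) r (tangent_map (ltrans h) q u)
  = tangent_map (ltrans (g * h)%g) r u.
Proof.
move=> hp gq.
rewrite (tangent_map_comp _ (ltrans_smooth hp) (ltrans_smooth gq)).
by rewrite ltrans_comp.
Qed.

Lemma left_field_ltrans g p q u : (g * p)%g = q ->
  tangent_map (ltrans g) q (left_field u p) = left_field u q.
Proof.
by move=> gp; rewrite /left_field (ltrans_tangent_map_comp _ (mulg1 p) gp) gp.
Qed.

Lemma left_field1 u : left_field u 1%g = u.
Proof.
rewrite /left_field -[RHS]tangent_map_id.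
by rewrite ltrans1.
Qed.

Lemma left_field_inv p u :
  tangent_map (ltrans p^-1%g) 1%g (left_field u p) = u.
Proof. by rewrite (left_field_ltrans _ (mulVg p)) left_field1. Qed.

Lemma left_field_surj p (v : tangent p) :
  left_field (tangent_map (ltrans p^-1%g) 1%g v) p = v.
Proof.
rewrite /left_field (ltrans_tangent_map_comp _ (mulVg p) (mulg1 p)) mulgV.
rewrite -[RHS]tangent_map_id.
by rewrite ltrans1.
Qed.

Lemma left_field_linear p k u v :
  left_field (k *: u + v) p = k *: left_field u p + left_field v p.
Proof. exact: tangent_map_linear. Qed.

Definition frame c u (x : 'rV[R]_n) : 'rV[R]_n := tcoord (left_field u (cinv c x)) c.

Lemma frameE c p u : cdom c p -> frame c u (c p) = tcoord (left_field u p) c.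
Proof. by move=> cp; rewrite /frame cmapK. Qed.

Lemma frame_linear c x k u v :
  frame c (k *: u + v) x = k *: frame c u x + frame c v x.
Proof. by rewrite /frame left_field_linear. Qed.

Lemma frame_diff c p u : charts_at p c ->
  frame c u (c p) = 'd (c \o ltrans p \o cinv c1) (c1 1%g) (tcoord u c1).
Proof.
move=> cp; rewrite frameE; last by case: cp.
exact: tcoord_tangent_map (ltrans_smooth (mulg1 p)) (charts_at_chart_at _) cp.
Qed.

(** A left-invariant field is the derivative of the multiplication in its second factor at the
    identity, so order [k] of the field comes from order [k.+1] of the multiplication. *)
Lemma frame_smooth c u : atlas G c -> smooth_on (c @` cdom c) (frame c u).
Proof.
move=> ac k; have k1 := charts_at_chart_at (1%g : G).
pose f (z : 'rV[R]_n * 'rV[R]_n) := c (cinv c z.1 * cinv c1 z.2)%g.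
pose j (x : 'rV[R]_n) := (x, c1 (1%g : G)).
have [ak1 dk1] := k1.
have [_ /(_ (0, tcoord u c1)) Df] := lie_mul_smooth _ _ _ ac ak1 ac k.+1.
have jl (x w : 'rV[R]_n) (h : R) : j (h *: w + x) = h *: (w, 0 : 'rV[R]_n) + j x.
  by rewrite -[RHS]/(_, _) /= scaler0 add0r.
have dj x : differentiable j x.
  apply: (differentiable_pair (f := id) (g := cst (c1 (1%g : G)))).
    exact: ex_diff.
  exact: differentiable_cst.
have Cj := Ck_on_affine jl dj Df.
apply: (@Ck_on_ext _ _ _ _ _ ('D_(0, tcoord u c1) f \o j)).
- exact: cimg_open.
- move=> _ [p cp <-]; rewrite (frame_diff _ (conj ac cp)).
  have [_ _ sp] := ltrans_smooth (mulg1 p).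
  have d1 := sp _ _ k1 (conj ac cp).
  apply: (etrans _ (deriveE _ d1)); rewrite /= /derive.
  have -> // : (fun h : R => h^-1 *: ((f \o shift (j (c p))) (h *: (0, tcoord u c1))
      - f (j (c p))))
    = (fun h : R => h^-1 *: (((c \o ltrans p \o cinv c1) \o shift (c1 1%g))
         (h *: tcoord u c1) - (c \o ltrans p \o cinv c1) (c1 1%g))).
  by apply/funext => h; rewrite /f /= scaler0 add0r /ltrans !cmapK.
- apply: Ck_on_subset Cj => _ [p cp <-] /=; split.
  + by exists p.
  + by exists 1%g.
  + by rewrite !cmapK// mulg1.
Qed.

Lemma frame_differentiable c u p : charts_at p c ->
  differentiable (frame c u) (c p).
Proof. by move=> [ac cp]; have [+ _] := frame_smooth u ac 1%N; apply; exists p. Qed.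

Lemma lie_bracket_frame u v :
  tcoord (lie_bracket u v) c1 = 'D_(tcoord u c1) (frame c1 v) (c1 1%g)
    - 'D_(tcoord v c1) (frame c1 u) (c1 1%g).
Proof.
rewrite /lie_bracket /vf_bracket (tvecK (charts_at_chart_at _)).
by rewrite !left_field1.
Qed.

Lemma lie_bracketC u v : lie_bracket v u = - lie_bracket u v.
Proof.
apply: (tangent_chart_inj (charts_at_chart_at _)).
apply: (etrans (lie_bracket_frame v u)).
apply: (etrans _ (esym (congr1 -%R (lie_bracket_frame u v)))).
exact/esym/opprB.
Qed.

Lemma lie_bracket_self u : lie_bracket u u = 0.
Proof.
apply: (tangent_chart_inj (charts_at_chart_at _)).
exact: (etrans (lie_bracket_frame u u) (subrr _)).
Qed.

Lemma lie_bracketDr k u v w :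
  lie_bracket w (k *: u + v) = k *: lie_bracket w u + lie_bracket w v.
Proof.
have k1 := charts_at_chart_at (1%g : G); have [_ dk1] := k1.
apply: (tangent_chart_inj k1).
have du z := frame_differentiable z k1.
have E1 : 'D_(tcoord w c1) (frame c1 (k *: u + v)) (c1 1%g)
    = k *: 'D_(tcoord w c1) (frame c1 u) (c1 1%g)
      + 'D_(tcoord w c1) (frame c1 v) (c1 1%g).
  apply: (derivative_linear _ (du u) (du v)).
  by apply: filterE => x; exact: frame_linear.
have E2 : 'D_(tcoord (k *: u + v) c1) (frame c1 w) (c1 1%g)
    = k *: 'D_(tcoord u c1) (frame c1 w) (c1 1%g)
      + 'D_(tcoord v c1) (frame c1 w) (c1 1%g).
  rewrite (deriveE _ (du w)) (deriveE _ (du w)) (deriveE _ (du w)).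
  exact: linearP.
apply: (etrans (lie_bracket_frame _ _)).
apply: (etrans (congr2 (fun s t => s - t) E1 E2)).
apply: (etrans _ (esym (congr2 (fun s t => k *: s + t)
  (lie_bracket_frame w u) (lie_bracket_frame w v)))).
have arith (x1 x2 y1 y2 : 'rV[R]_n) :
    (k *: x1 + x2) - (k *: y1 + y2) = k *: (x1 - y1) + (x2 - y2).
  by rewrite scalerBr opprD addrACA.
exact: arith.
Qed.

Lemma lie_bracketDl k u v w :
  lie_bracket (k *: u + v) w = k *: lie_bracket u w + lie_bracket v w.
Proof.
apply: (etrans (lie_bracketC w _)).
apply: (etrans (congr1 -%R (lie_bracketDr k u v w))).
apply: (etrans (opprD _ _)); apply: (congr2 +%R _ (esym (lie_bracketC w v))).
apply: (etrans (esym (scalerN _ _))).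
exact: (congr1 ( *:%R k) (esym (lie_bracketC w u))).
Qed.

(** [lie_bracket] only knows the bracket of fields at the identity. Left translation by [p], called
    [h] in charts, relates left-invariant fields to themselves; differentiating this relation at the
    identity gives the image under the differential of [h] plus a second derivative of [h]. The
    second derivatives are symmetric and cancel in the commutator. *)
Lemma frame_bracket c p u v : charts_at p c ->
  'D_(frame c u (c p)) (frame c v) (c p) - 'D_(frame c v (c p)) (frame c u) (c p)
  = frame c (lie_bracket u v) (c p).
Proof.
move=> cp; have k1 := charts_at_chart_at (1%g : G); have [ak1 dk1] := k1.
have [ac cdp] := cp.
pose h := c \o ltrans p \o cinv c1; set e := c1 (1%g : G).
have near_dom : \forall q \near (1%g : G), cdom c1 q /\ cdom c (p * q)%g.
  apply: filterI; first exact: chart_dom_near.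
  apply: (near_continuous (ltrans_continuous (g := p) (p := 1%g)) (mulg1 p)).
  exact: chart_dom_near.
have near_h : \forall w \near e, exists2 q, w = c1 q & cdom c1 q /\ cdom c (p * q)%g.
  have N1 := chart_inv_near dk1 near_dom.
  have N2 := chart_img_nbhs k1.
  apply: filterS (filterI N1 N2) => w [[w1 w2] [q cq qw]]; exists q => //.
  by move: w1 w2; rewrite -qw cmapK.
have hC : Ck_on 2 [set w | exists2 q, w = c1 q & cdom c1 q /\ cdom c (p * q)%g] h.
  pose f (z : 'rV[R]_n * 'rV[R]_n) := c (cinv c z.1 * cinv c1 z.2)%g.
  pose j (w : 'rV[R]_n) := (c p, w).
  have jl (x w : 'rV[R]_n) (k : R) : j (k *: w + x) = k *: (0 : 'rV[R]_n, w) + j x.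
    by rewrite -[RHS]/(_, _) /= scaler0 add0r.
  have dj x : differentiable j x.
    apply: (differentiable_pair (f := cst (c p)) (g := id)).
      exact: differentiable_cst.
    exact: ex_diff.
  have hE : h = f \o j by apply/funext => w; rewrite /h /f /= cmapK.
  rewrite hE; apply: Ck_on_subset (Ck_on_affine jl dj (lie_mul_smooth _ _ _ ac ak1 ac 2%N)).
  move=> _ [q -> [q1 q2]]; split => /=; first by exists p.
    by exists q.
  by rewrite !cmapK.
have he : h e = c p by rewrite /h /= cmapK// /ltrans mulg1.
have [hd hD] := hC.
have e_in : exists2 q, e = c1 q & cdom c1 q /\ cdom c (p * q)%g.
  by exists 1%g; rewrite ?mulg1.
have de := hd _ e_in.
have dDe w : differentiable ('D_w h) e by have [+ _] := hD w; apply.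
have near_hd : \forall w \near e, differentiable h w.
  by apply: filterS near_h => w; exact: hd.
have fr w : frame c w (c p) = 'D_(tcoord w c1) h e.
  by rewrite (deriveE _ de); exact: frame_diff.
(* The relation says that [frame c w] at [h y] is the differential of [h] at [y] applied to
   [frame c1 w y]; it is spelled out in partial derivatives so that it can be differentiated in
   [y]. *)
have rel w : \forall y \near e, frame c w (h y)
    = \sum_j frame c1 w y 0 j *: 'D_(delta_mx 0 j) h y.
  apply: filterS near_h => _ [q -> [c1q cpq]].
  have c1q' : charts_at q c1 by []. have cpq' : charts_at (p * q)%g c by [].
  rewrite -diff_delta; last by apply: hd; exists q.
  have hq : h (c1 q) = c (p * q)%g by rewrite /h /= cmapK.
  rewrite hq (frameE _ cpq) (frameE _ c1q).
  rewrite -(left_field_ltrans w (erefl (p * q)%g)).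
  exact: (tcoord_tangent_map _ (ltrans_smooth (erefl (p * q)%g)) c1q' cpq').
have key w z : 'D_(frame c z (c p)) (frame c w) (c p)
   = 'd h e ('D_(tcoord z c1) (frame c1 w) e)
     + 'D_(tcoord w c1) ('D_(tcoord z c1) h) e.
  have dw := frame_differentiable w k1.
  have dcw : differentiable (frame c w) (h e) by rewrite he; exact: frame_differentiable.
  transitivity ('D_(tcoord z c1) (frame c w \o h) e).
    apply: (etrans (deriveE _ (frame_differentiable w cp))).
    apply: (etrans _ (esym (derive_comp_curve _ de dcw))).
    exact: (congr2 (fun a b => 'd (frame c w) a b) (esym he) (fr z)).
  apply: (etrans (near_eq_derive (tcoord z c1) (rel w))).
  pose F j := fun y => frame c1 w y 0 j *: 'D_(delta_mx 0 j) h y.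
  have dc j : differentiable (fun y => frame c1 w y 0 j) e.
    exact: (differentiable_comp dw (differentiable_coord _ _ _)).
  have dF j := derive_scale (tcoord z c1) (dc j) (dDe (delta_mx 0 j)).
  rewrite (_ : (fun y => _) = \sum_j F j); last first.
    by apply/funext => y; rewrite fct_sumE.
  rewrite derive_sum => [|j]; last exact/diff_derivable/(dF j).1.
  transitivity (\sum_j ('D_(tcoord z c1) (frame c1 w) e 0 j *: 'D_(delta_mx 0 j) h e
     + (tcoord w c1) 0 j *: 'D_(delta_mx 0 j) ('D_(tcoord z c1) h) e)).
    apply: eq_bigr => j _; apply: (etrans (dF j).2).
    have E1 : 'D_(tcoord z c1) (fun y => frame c1 w y 0 j) e
        = 'D_(tcoord z c1) (frame c1 w) e 0 j.
      by apply: derive_val; apply: is_derive_coord; split => //; exact: diff_derivable.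
    have E2 : frame c1 w e 0 j = tcoord w c1 0 j by rewrite frameE// left_field1.
    have E3 := derive_sym_rV near_hd (dDe (delta_mx 0 j)) (dDe (tcoord z c1)).
    exact: (congr2 +%R (congr1 (fun r => r *: _) E1) (congr2 *:%R E2 E3)).
  apply: (etrans (big_split _ _ _ _ _)).
  exact: (congr2 +%R (esym (diff_delta _ de))
    (etrans (esym (diff_delta _ (dDe _))) (esym (deriveE _ (dDe _))))).
have S := derive_sym_rV near_hd (dDe (tcoord u c1)) (dDe (tcoord v c1)).
rewrite (key v u) (key u v) S opprD addrACA subrr addr0.
apply: (etrans _ (esym (etrans (fr _) (deriveE _ de)))).
by rewrite lie_bracket_frame linearB.
Qed.

End LeftFields.

(** * Velocities and integral curves *)

Section Lipschitz.
Variables (R : realType) (n : nat).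

(** Near [x0] the norms of the partial derivatives exceed those at [x0] by at most 1. Balls are
    convex, so the mean value bound applies along the segment from [y] to [x], with the sum of these
    bounds as Lipschitz constant. *)
Lemma C1_locally_lipschitz (A : set 'rV[R]_n) (b : 'rV[R]_n -> 'rV[R]_n) x0 :
  open A -> A x0 -> Ck_on 1 A b ->
  exists r K M : R, [/\ 0 < r, 0 <= K, 0 <= M,
    forall x, `|x - x0| <= r -> A x /\ `|b x| <= M &
    forall x y, `|x - x0| <= r -> `|y - x0| <= r -> `|b x - b y| <= K * `|x - y| ].
Proof.
move=> oA Ax0 [db Db].
have N1 : \forall x \near x0, A x by exact: open_nbhs_nbhs.
have bnd (f : 'rV[R]_n -> 'rV[R]_n) : {for x0, continuous f} ->
    \forall x \near x0, `|f x| <= `|f x0| + 1.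
  move=> fc; have /cvgrPdist_lt/(_ 1 ltr01) := fc; apply: filterS => x fx.
  rewrite -[f x](subrK (f x0)) addrC (le_trans (ler_normD _ _))//.
  by rewrite lerD2l distrC ltW.
have N2 := bnd b (differentiable_continuous (db _ Ax0)).
have N3 : \forall x \near x0, forall j,
    `|'D_(delta_mx 0 j) b x| <= `|'D_(delta_mx 0 j) b x0| + 1.
  pose f j := [set x | `|'D_(delta_mx 0 j) b x| <= `|'D_(delta_mx 0 j) b x0| + 1].
  by apply: (@filter_forall _ _ f (nbhs x0) (nbhs_filter x0)) => j; exact/bnd/Db.
have [d d0 dP] := near_norm_shift (filterI N1 (filterI N2 N3)).
have {}dP x : `|x - x0| <= d / 2 -> [/\ A x, `|b x| <= `|b x0| + 1 &
    forall j, `|'D_(delta_mx 0 j) b x| <= `|'D_(delta_mx 0 j) b x0| + 1].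
  move=> xd; have := dP (x - x0); rewrite subrK; case=> [|? [? ?]]; last by [].
  by apply: le_lt_trans xd _; rewrite ltr_pdivrMr// mulr2n mulrDr mulr1 ltrDl.
exists (d / 2), (\sum_j (`|'D_(delta_mx 0 j) b x0| + 1)), (`|b x0| + 1); split.
- by rewrite divr_gt0.
- by apply: sumr_ge0 => j _; rewrite addr_ge0.
- by rewrite addr_ge0.
- by move=> x /dP[].
move=> x y xd yd.
pose seg (s : R) := s *: (x - y) + y.
have segd s : 0 <= s <= 1 -> `|seg s - x0| <= d / 2.
  move=> /andP[s0 s1].
  have -> : seg s - x0 = s *: (x - x0) + (1 - s) *: (y - x0).
    by apply/rowP => i; rewrite !mxE; ring.
  rewrite (le_trans (ler_normD _ _))// !normrZ (ger0_norm s0).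
  rewrite (ger0_norm (_ : 0 <= 1 - s)) ?subr_ge0//.
  have -> : d / 2 = s * (d / 2) + (1 - s) * (d / 2) by ring.
  by rewrite lerD// ler_wpM2l// subr_ge0.
have := @mean_value_bound R n (fun s => b (seg s)) (fun s => 'D_(x - y) b (seg s))
  0 1 ((\sum_j (`|'D_(delta_mx 0 j) b x0| + 1)) * `|x - y|) ler01.
rewrite /seg scale0r add0r scale1r subrK subr0 mulr1; apply.
- by rewrite mulr_ge0// sumr_ge0// => j _; rewrite addr_ge0.
- move=> s /segd/dP[As _ _]; apply: is_derive_line; apply: diff_derivable.
  exact: db.
move=> s /segd/dP[As _ Ds].
have -> : 'D_(x - y) b (s *: (x - y) + y)
    = \sum_j (x - y) 0 j *: 'D_(delta_mx 0 j) b (s *: (x - y) + y).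
  by apply: (etrans (deriveE _ (db _ As))); exact/diff_delta/db.
apply: (le_trans (ler_norm_sum _ _ _)); rewrite mulr_suml.
apply: ler_sum => j _; rewrite normrZ mulrC; apply: ler_pM => //.
exact: coord_norm.
Qed.

Lemma is_derive_affine (V : normedModType R) (f : R -> V) (k s t : R) (l : V) :
  is_derive (k * t + s) 1 f l -> is_derive t 1 (fun t => f (k * t + s)) (k *: l).
Proof.
move=> fl.
have df : differentiable f (t *: k + s).
  by rewrite -[t *: k]/(t * k) mulrC; apply/derivable1_diffP; exact: ex_derive.
have H := is_derive_line (diff_derivable df : derivable f _ k).
have E : (fun t => f (k * t + s)) = (fun t => f (t *: k + s)).
  by apply/funext => x; rewrite -[x *: k]/(x * k) mulrC.
rewrite E; have -> // : k *: l = 'D_k f (t *: k + s).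
have El : l = 'D_1 f (t *: k + s).
  by rewrite -[t *: k]/(t * k) mulrC; exact/esym/derive_val.
rewrite El; apply/esym/(etrans (deriveE _ df)).
apply: (etrans _ (congr1 ( *:%R k) (esym (deriveE _ df)))).
by rewrite -linearZ/= -[k *: 1]/(k * 1) mulr1.
Qed.

End Lipschitz.

Section Velocities.
Variables (R : realType) (n : nat).

(** A relation with a separate base point [p]: a velocity can be given by a vector at [p] when
    [gam t = p] is provable but not by conversion, which the type of [velocity] does not allow. *)
Definition velocity_at (M : smoothManifoldType R n) (gam : R -> M) (t : R) (p : M)
    (w : tangent p) : Prop :=
  [/\ gam t = p, {for t, continuous gam} &
      forall c, charts_at p c -> is_derive t 1 (c \o gam) (tcoord w c)].

Variable M : smoothManifoldType R n.

(** Checking one chart is enough, since the chain rule for transition maps matches the change rule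
    of tangent vectors. *)
Lemma velocity_at_chart (gam : R -> M) t p (w : tangent p) c :
  gam t = p -> {for t, continuous gam} -> charts_at p c ->
  is_derive t 1 (c \o gam) (tcoord w c) -> velocity_at gam t w.
Proof.
move=> gt gc cp cd; split => // c' c'p.
have d1 : differentiable (c \o gam) t by apply/derivable1_diffP; exact: ex_derive.
have E1 : (c \o gam) t = c p by rewrite /= gt.
have d2 := transition_differentiable cp c'p.
have d12 := differentiable_chain d1 E1 d2.
have N : \forall s \near t, ((c' \o cinv c) \o (c \o gam)) s = (c' \o gam) s.
  have [_ cdp] := cp.
  have := near_continuous gc gt (chart_dom_near cdp).
  by apply: filterS => s sc; rewrite /= cmapK.
apply: (near_eq_is_derive N); split; first exact: diff_derivable.
apply: (etrans (deriveE _ d12)); apply: (etrans (esym (diff_chain _ d1 E1 d2))).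
apply: (etrans _ (esym (tcoord_change w cp c'p))).
apply: (congr1 ('d (c' \o cinv c) (c p))).
by apply: (etrans (esym (deriveE _ d1))); exact: derive_val.
Qed.

Lemma velocity_at_near (gam del : R -> M) t p (w : tangent p) :
  (\forall s \near t, gam s = del s) -> velocity_at gam t w -> velocity_at del t w.
Proof.
move=> gd [gt gc gD]; have Et := nbhs_singleton gd; split.
- by rewrite -Et.
- rewrite /prop_for /continuous_at -Et; apply: cvg_trans gc.
  by apply: near_eq_cvg; apply: filterS gd => s ->.
move=> c /gD; apply: near_eq_is_derive.
by apply: filterS gd => s /= ->.
Qed.

Lemma velocity_at_comp (gam : R -> M) t p q (w : tangent p) (f : M -> M) :
  smooth_at f p q -> velocity_at gam t w ->
  velocity_at (f \o gam) t (tangent_map f q w).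
Proof.
move=> sf [gt gc gD]; have [fp fc fd] := sf.
have cp := charts_at_chart_at p; have c'q := charts_at_chart_at q.
apply: (velocity_at_chart _ _ c'q).
- by rewrite /= gt.
- by apply: continuous_comp => //; rewrite gt.
set c := chart_at p in cp *; set c' := chart_at q in c'q *.
have cD := gD _ cp.
have d1 : differentiable (c \o gam) t by apply/derivable1_diffP; exact: ex_derive.
have E1 : (c \o gam) t = c p by rewrite /= gt.
have d2 := fd _ _ cp c'q.
have d12 := differentiable_chain d1 E1 d2.
have N : \forall s \near t, ((c' \o f \o cinv c) \o (c \o gam)) s = (c' \o (f \o gam)) s.
  have [_ cdp] := cp.
  have := near_continuous gc gt (chart_dom_near cdp).
  by apply: filterS => s sc; rewrite /= cmapK.
apply: (near_eq_is_derive N); split; first exact: diff_derivable.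
apply: (etrans (deriveE _ d12)); apply: (etrans (esym (diff_chain _ d1 E1 d2))).
apply: (etrans _ (esym (tcoord_tangent_map w sf cp c'q))).
apply: (congr1 ('d (c' \o f \o cinv c) (c p))).
by apply: (etrans (esym (deriveE _ d1))); exact: derive_val.
Qed.

Lemma velocity_at_affine (gam : R -> M) (k s t : R) p (w : tangent p) :
  velocity_at gam (k * t + s) w ->
  velocity_at (fun t => gam (k * t + s)) t (k *: w).
Proof.
move=> [gt gc gD]; split => //.
  apply: (@continuous_comp _ _ _ (fun t => k * t + s) gam) => //.
  apply: (@cvgD _ _ _ _ _ (fun t => k * t) (cst s)); last exact: cvg_cst.
  by apply: cvgMr; exact: cvg_id.
move=> c /gD; exact: is_derive_affine.
Qed.

Lemma velocity_at_velocity (gam : R -> M) t p (w : tangent p) :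
  velocity_at gam t w -> forall c, charts_at p c ->
  tcoord (velocity gam t) c = tcoord w c.
Proof.
move=> [gt gc gD]; move: w gD; rewrite -gt => w gD c cp.
have k := charts_at_chart_at (gam t).
rewrite /velocity [RHS](tcoord_change w k cp) /= /tvec_coord asboolT//.
apply: congr1; rewrite derive1E; exact: (@derive_val _ _ _ _ _ _ _ (gD _ k)).
Qed.

End Velocities.

(** * Integral curves of left-invariant fields and their uniqueness *)

Section IntegralCurves.
Variables (R : realType) (n : nat) (G : lieGroupType R n).
Implicit Types (g h p q : G) (c : chart R n G) (u v : lie_algebra G).

Local Notation c1 := (chart_at (1%g : G)).

Definition integral_at u (gam : R -> G) t := velocity_at gam t (left_field u (gam t)).

Lemma integral_at_ltrans u gam t g : integral_at u gam t ->
  integral_at u (fun t => (g * gam t)%g) t.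
Proof.
move=> H; rewrite /integral_at -(left_field_ltrans u (erefl (g * gam t)%g)).
exact: (velocity_at_comp (ltrans_smooth (erefl (g * gam t)%g)) H).
Qed.

Lemma integral_at_near u gam del t : (\forall s \near t, gam s = del s) ->
  integral_at u gam t -> integral_at u del t.
Proof.
move=> gd H; rewrite /integral_at -(nbhs_singleton gd).
exact: velocity_at_near gd H.
Qed.

Lemma left_fieldZ p k u : left_field (k *: u) p = k *: left_field u p.
Proof.
have L0 : left_field 0 p = 0 :> tangent p.
  have := left_field_linear p 1 (0 : lie_algebra G) 0.
  by rewrite !scale1r addr0 => /eqP; rewrite -subr_eq subrr eq_sym => /eqP.
by have := left_field_linear p k u 0; rewrite addr0 L0 addr0.
Qed.

Lemma integral_at_affine u (gam : R -> G) (k s t : R) :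
  integral_at u gam (k * t + s) ->
  integral_at (k *: u) (fun t => gam (k * t + s)) t.
Proof. by move=> H; rewrite /integral_at left_fieldZ; exact: velocity_at_affine. Qed.

Lemma inv_continuous (T : topologicalType) (f : T -> G) t :
  {for t, continuous f} -> {for t, continuous (fun t => ((f t)^-1)%g)}.
Proof.
move=> fc; apply: (@continuous_comp _ _ _ f (fun g : G => (g^-1)%g)) => //.
exact: lie_inv_continuous.
Qed.

Lemma div_differentiable c c' c'' p q :
  charts_at p c -> charts_at q c' -> charts_at (p * q^-1)%g c'' ->
  differentiable (fun z : 'rV[R]_n * 'rV[R]_n =>
    c'' (cinv c z.1 * (cinv c' z.2)^-1)%g) (c p, c' q).
Proof.
move=> cp c'q c''pq; have ki := charts_at_chart_at (q^-1)%g.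
set k := chart_at (q^-1)%g in ki.
have [ac' c'dq] := c'q; have [ak kdq] := ki.
have [iD _] := lie_inv_smooth _ _ ac' ak 1%N.
have {iD} iD : differentiable (fun x => k (cinv c' x)^-1%g) (c' q).
  by apply: iD; split; [exists q|rewrite /= cmapK].
pose F (z : 'rV[R]_n * 'rV[R]_n) := (z.1, k (cinv c' z.2)^-1%g).
have d1 : differentiable F (c p, c' q).
  have f1 : differentiable (@fst 'rV[R]_n 'rV[R]_n) (c p, c' q).
    by apply: (@linear_differentiable _ _ _ (@fst 'rV[R]_n 'rV[R]_n)) => x; exact: cvg_fst.
  have f2 : differentiable (@snd 'rV[R]_n 'rV[R]_n) (c p, c' q).
    by apply: (@linear_differentiable _ _ _ (@snd 'rV[R]_n 'rV[R]_n)) => x; exact: cvg_snd.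
  exact: (differentiable_pair f1 (differentiable_chain f2 erefl iD)).
have E1 : F (c p, c' q) = (c p, k (q^-1)%g) by rewrite /F /= cmapK.
have := differentiable_chain d1 E1 (mul_smooth_at_charts cp ki c''pq).
apply: differentiable_near_eq.
have N : \forall x \near c' q, cdom k ((cinv c' x)^-1)%g.
  apply: (chart_inv_near (P := fun g => cdom k (g^-1)%g) c'dq).
  exact: (near_continuous (lie_inv_continuous q) erefl (chart_dom_near kdq)).
have sc : {for (c p, c' q), continuous (@snd 'rV[R]_n 'rV[R]_n)} by exact: cvg_snd.
have := near_continuous sc erefl N.
by apply: filterS => z z2; rewrite /F /= cmapK.
Qed.

(* The derivative of [al * be^-1] only depends on the velocities, hence may be
   computed along [p w] and [q w] for [w] near 1, where the quotient is constant. *)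
Lemma integral_div_derive u (al be : R -> G) t c :
  integral_at u al t -> integral_at u be t ->
  charts_at (al t * (be t)^-1)%g c ->
  is_derive t 1 (fun s => c (al s * (be s)^-1)%g) 0.
Proof.
move=> [_ alc alD] [_ bec beD] cr; set p := al t in alD cr; set q := be t in beD cr.
have kp := charts_at_chart_at p; have kq := charts_at_chart_at q.
have k1 := charts_at_chart_at (1%g : G).
set ca := chart_at p in kp; set cb := chart_at q in kq.
have [_ cdp] := kp; have [_ cdq] := kq; have [_ cd1] := k1.
have dD := div_differentiable kp kq cr.
pose D (z : 'rV[R]_n * 'rV[R]_n) := c (cinv ca z.1 * (cinv cb z.2)^-1)%g.
have {alD} alD := alD _ kp; have {beD} beD := beD _ kq.
have da : differentiable (ca \o al) t by apply/derivable1_diffP; exact: ex_derive.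
have db : differentiable (cb \o be) t by apply/derivable1_diffP; exact: ex_derive.
pose z s := ((ca \o al) s, (cb \o be) s).
have dz : differentiable z t by exact: differentiable_pair.
have dDz := differentiable_chain dz (erefl : z t = (ca p, cb q)) dD.
have N : \forall s \near t, (D \o z) s = c (al s * (be s)^-1)%g.
  have N1 := near_continuous alc erefl (chart_dom_near cdp).
  have N2 := near_continuous bec erefl (chart_dom_near cdq).
  by apply: filterS (filterI N1 N2) => s [s1 s2]; rewrite /D /= !cmapK.
apply: (near_eq_is_derive N); split; first exact: diff_derivable.
apply: (etrans (deriveE _ dDz)).
apply: (etrans (esym (diff_chain _ dz (erefl : z t = (ca p, cb q)) dD))).
have [_ _ /(_ _ _ k1 kp) dp] := ltrans_smooth (mulg1 p).
have [_ _ /(_ _ _ k1 kq) dq] := ltrans_smooth (mulg1 q).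
pose z' w := ((ca \o ltrans p \o cinv c1) w, (cb \o ltrans q \o cinv c1) w).
have dz' : differentiable z' (c1 1%g) by exact: differentiable_pair.
have Ez' : z' (c1 1%g) = (ca p, cb q).
  by rewrite /z' /= !cmapK// /ltrans !mulg1.
have dDz' := differentiable_chain dz' Ez' dD.
transitivity ('d D (ca p, cb q) ('d z' (c1 1%g) (tcoord u c1))).
  apply: (congr1 ('d D (ca p, cb q))).
  apply: (etrans (congr1 (@^~ 1) (diff_pair da db))).
  apply: (etrans _ (esym (congr1 (@^~ (tcoord u c1)) (diff_pair dp dq)))).
  apply: (congr2 pair).
    apply: (etrans (esym (deriveE _ da))).
    apply: (etrans (@derive_val _ _ _ _ _ _ _ alD)).
    exact: (tcoord_tangent_map _ (ltrans_smooth (mulg1 p)) k1 kp).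
  apply: (etrans (esym (deriveE _ db))).
  apply: (etrans (@derive_val _ _ _ _ _ _ _ beD)).
  exact: (tcoord_tangent_map _ (ltrans_smooth (mulg1 q)) k1 kq).
apply: (etrans (diff_chain _ dz' Ez' dD)).
have N' : \forall w \near c1 1%g, (D \o z') w = cst (c (p * q^-1)%g) w.
  have M1 := near_continuous (ltrans_continuous (g := p) (p := 1%g)) (mulg1 p)
    (chart_dom_near cdp).
  have M2 := near_continuous (ltrans_continuous (g := q) (p := 1%g)) (mulg1 q)
    (chart_dom_near cdq).
  have M3 : \forall h \near (1%g : G), cdom ca (ltrans p h) /\ cdom cb (ltrans q h).
    exact: filterI.
  apply: filterS (chart_inv_near cd1 M3) => w [w1 w2].
  by rewrite /D /= !cmapK// /ltrans mulgKA.
apply: (etrans (near_eq_diff _ dDz' N')).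
by rewrite diff_cst.
Qed.

(** In a chart around the quotient at [t] the derivative is zero, so the mean value bound holds with
    constant 0. The interval is small enough for the quotient to stay in the chart domain. *)
Lemma integral_div_locally_constant u (al be : R -> G) t :
  (\forall s \near t, integral_at u al s /\ integral_at u be s) ->
  \forall s \near t, (al s * (be s)^-1 = al t * (be t)^-1)%g.
Proof.
move=> H; set r := (al t * (be t)^-1)%g.
have cr := charts_at_chart_at r; set c := chart_at r in cr.
have [[_ alc _] [_ bec _]] := nbhs_singleton H.
have rc := mul_continuous alc (inv_continuous bec).
have [ac cdr] := cr.
have N := near_continuous rc erefl (chart_dom_near cdr).
have [d d0 dP] := near_norm_shift (filterI H N).
apply/nbhs_normP; exists d => //= s; rewrite /ball_ /= => std.
have {}dP x : `|x - t| <= `|s - t| -> [/\ integral_at u al x, integral_at u be x &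
    cdom c (al x * (be x)^-1)%g].
  move=> xs; have := dP (x - t); rewrite subrK; case=> [|[]//].
  by apply: le_lt_trans xs _; rewrite distrC.
have := @mean_value_bound_sym R n (fun s => c (al s * (be s)^-1)%g) (fun=> 0) t s 0.
rewrite mul0r normr0 => B.
have {}B : c (al s * (be s)^-1)%g = c r.
  apply/eqP; rewrite -subr_eq0 -normr_le0; apply: B => // x /dP[ia ib cx].
  exact: integral_div_derive ia ib (conj ac cx).
have [_ _ cs] := dP s (lexx _).
by rewrite -(cmapK cs) B cmapK.
Qed.

(** The set where the curves agree is open in [A] because the quotient is locally constant. It is
    closed in [A] because near a limit point the quotient is constant and takes the value 1
    somewhere. Connectedness concludes. *)
Lemma integral_unique u (al be : R -> G) (A : set R) t0 :
  open A -> connected A -> A t0 -> al t0 = be t0 ->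
  (forall t, A t -> integral_at u al t) -> (forall t, A t -> integral_at u be t) ->
  forall t, A t -> al t = be t.
Proof.
move=> oA cA At0 e0 alI beI.
have nearA t : A t -> \forall s \near t, integral_at u al s /\ integral_at u be s.
  move=> At; have := open_nbhs_nbhs (conj oA At).
  by apply: filterS => s As; split; [exact: alI|exact: beI].
have lc t : A t -> \forall s \near t, (al s * (be s)^-1 = al t * (be t)^-1)%g.
  by move=> /nearA; exact: integral_div_locally_constant.
pose B := [set t | A t /\ al t = be t].
have eqB t : al t = be t <-> (al t * (be t)^-1 = 1)%g.
  split=> [->|]; first exact: mulgV.
  exact: divg1_eq.
have BA : B = A.
  apply: cA; first by exists t0.
  - exists B; last by apply/seteqP; split => [t []|t [_ []]].
    rewrite openE => t [At /eqB tB].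
    apply: filterS (filterI (open_nbhs_nbhs (conj oA At)) (lc t At)) => s [As].
    by rewrite tB => /eqB.
  - exists (closure B); first exact: closed_closure.
    apply/seteqP; split => [t tB|t [At tB]].
      by split; [case: tB|exact: subset_closure].
    split => //; apply/eqB.
    have [s [[As /eqB sB] st]] := tB _ (lc t At).
    by rewrite -st.
by move=> t; rewrite -BA => -[].
Qed.

End IntegralCurves.

(** * The exponential map *)

Section Exponential.
Variables (R : realType) (n : nat) (G : lieGroupType R n).
Implicit Types (g h p q : G) (c : chart R n G) (u v : lie_algebra G).

Local Notation c1 := (chart_at (1%g : G)).

Lemma integral_local u : exists2 d : R, 0 < d & exists gam : R -> G,
  gam 0 = 1%g /\ forall t : R, `|t| < d -> integral_at u gam t.
Proof.
have [ak1 dk1] := charts_at_chart_at (1%g : G).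
have [r [K [M [r0 K0 M0 rM rK]]]] := C1_locally_lipschitz (@cimg_open _ _ _ c1)
  (imageP _ dk1) (frame_smooth u ak1 1%N).
have rM' x : `|x - c1 1%g| <= r -> `|frame c1 u x| <= M by move=> /rM[].
have [d d0 [x [x0 xP]]] := picard r0 K0 M0 rM' rK.
exists d => //; exists (cinv c1 \o x); split; first by rewrite /= x0 cmapK.
move=> t td; have [xr xD] := xP t td; have [[q cq qx] _] := rM _ xr.
have gq : (cinv c1 \o x) t = q by rewrite /= -qx cmapK.
have xc := is_derive_continuous xD.
rewrite /integral_at; apply: (@velocity_at_chart _ _ _ _ _ _ _ c1) => //.
- apply: continuous_comp => //; apply: cinv_continuous.
  by exists q => //; rewrite qx.
- by rewrite gq; split.
have N : \forall s \near t, x s = (c1 \o (cinv c1 \o x)) s.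
  have N : \forall s \near t, `|s| < d.
    apply/nbhs_normP; exists (d - `|t|) => /=; first by rewrite subr_gt0.
    move=> s; rewrite /ball_ /= distrC => st.
    rewrite -(subrK t s) (le_lt_trans (ler_normD _ _))//.
    by rewrite -ltrBrDr.
  apply: filterS N => s /xP[sr _]; have [[q' cq' qs] _] := rM _ sr.
  by rewrite /= -qs cmapK.
by apply: near_eq_is_derive N _; move: xD; rewrite /frame.
Qed.

Lemma ball0_connected (d : R) : connected [set t : R | `|t| < d].
Proof.
have -> : [set t : R | `|t| < d] = `]- d, d[%classic.
  by apply/seteqP; split=> t /=; rewrite in_itv/= ltr_norml.
exact/connected_intervalP/interval_is_interval.
Qed.

Lemma ball0_open (d : R) : open [set t : R | `|t| < d].
Proof.
have -> : [set t : R | `|t| < d] = `]- d, d[%classic.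
  by apply/seteqP; split=> t /=; rewrite in_itv/= ltr_norml.
exact: itv_open.
Qed.

(** For fixed [s] both sides are integral curves in [t] with the same value at 0, one by a shift of
    time and the other by left invariance. Halving the radius keeps [s + t] where [gam] is known to
    be integral. *)
Lemma integral_local_morphism u : exists2 d : R, 0 < d & exists gam : R -> G,
  [/\ gam 0 = 1%g, forall t : R, `|t| < d -> integral_at u gam t &
   forall s t : R, `|s| < d -> `|t| < d -> gam (s + t) = (gam s * gam t)%g].
Proof.
have [d d0 [gam [gam0 gamI]]] := integral_local u.
have d2 : 0 < d / 2 by rewrite divr_gt0.
exists (d / 2) => //; exists gam; split => //.
  move=> t td; apply: gamI; apply: lt_trans td _.
  by rewrite ltr_pdivrMr// mulr2n mulrDr mulr1 ltrDl.
move=> s t sd td; pose A := [set t : R | `|t| < d / 2].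
have A0 : A 0 by rewrite /A /= normr0.
apply: (@integral_unique _ _ _ u (fun t => gam (s + t)) (fun t => (gam s * gam t)%g) A 0);
  rewrite ?addr0 ?gam0 ?mulg1//.
- exact: ball0_open.
- exact: ball0_connected.
- move=> x xd.
  have sx : `|1 * x + s| < d.
    rewrite mul1r (le_lt_trans (ler_normD _ _))// [ltRHS](splitr d).
    by rewrite ltrD.
  have := integral_at_affine (gamI _ sx); rewrite scale1r.
  by apply: integral_at_near; apply: filterE => y; rewrite mul1r addrC.
- move=> x xd; apply: integral_at_ltrans; apply: gamI; apply: lt_trans xd _.
  by rewrite ltr_pdivrMr// mulr2n mulrDr mulr1 ltrDl.
Qed.

(** The power [gam (t / k) ^+ k] does not depend on [k] once [t / k] is small: two exponents are
    compared through their product. A common exponent for [s], [t] and [s + t] then gives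
    additivity, because values of [gam] at small times commute. *)
Lemma integral_global u : exists gam : R -> G,
  [/\ gam 0 = 1%g, forall t, integral_at u gam t &
   forall s t : R, gam (s + t) = (gam s * gam t)%g].
Proof.
have [d d0 [gam [gam0 gamI gamM]]] := integral_local_morphism u.
have gamX (k : nat) (s : R) : `|k%:R * s| < d -> gam (k%:R * s) = (gam s ^+ k)%g.
  elim: k => [|k IH] ks; first by rewrite mul0r gam0.
  have sd : `|s| < d.
    apply: le_lt_trans ks; rewrite normrM ler_peMl// ger0_norm//.
    by rewrite ler1n.
  have kd : `|k%:R * s| < d.
    apply: le_lt_trans ks; rewrite !normrM ler_wpM2r// !ger0_norm//.
    by rewrite ler_nat.
  by rewrite -natr1 mulrDl mul1r gamM// IH// expgSr.
(* The successor makes the exponent nonzero and the bound on [|t| / N t] strict. *)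
pose N (t : R) := (Num.Def.truncn (`|t| / d)).+1.
have NP t : `|t| / (N t)%:R < d.
  by rewrite ltr_pdivrMr// mulrC -ltr_pdivrMr//; exact: truncnS_gt.
pose Gam (t : R) := (gam (t / (N t)%:R)%R ^+ N t)%g.
have GamE (k : nat) (t : R) : (0 < k)%N -> `|t| / k%:R < d -> Gam t = (gam (t / k%:R)%R ^+ k)%g.
  move=> k0 kd; have k0' : k%:R != 0 :> R by rewrite pnatr_eq0 -lt0n.
  pose s := t / ((N t)%:R * k%:R).
  have F (a b : R) : a != 0 -> b != 0 -> t / a = b * (t / (a * b)).
    by move=> a0 b0; field; rewrite a0 b0.
  have N0 : (N t)%:R != 0 :> R by rewrite pnatr_eq0.
  have E1 : t / (N t)%:R = k%:R * s by exact: F.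
  have E2 : t / k%:R = (N t)%:R * s by rewrite /s [(N t)%:R * k%:R]mulrC; exact: F.
  rewrite /Gam E1 gamX; last by rewrite -E1 normrM normfV normr_nat.
  rewrite E2 gamX; last by rewrite -E2 normrM normfV normr_nat.
  by rewrite -!expgnA mulnC.
have Gam_gam (t : R) : `|t| < d -> Gam t = gam t.
  by move=> td; rewrite (@GamE 1%N) ?divr1.
have GamM s t : Gam (s + t) = (Gam s * Gam t)%g.
  (* [k] is at least each of the three exponents, so [GamE] writes the three values as powers with
     the same exponent. *)
  pose k := (N s + N t + N (s + t)%R)%N.
  have le_k (x : R) m : `|x| / m.+1%:R < d -> (m.+1 <= k)%N -> `|x| / k%:R < d.
    move=> xd mk; apply: le_lt_trans xd; rewrite ler_wpM2l// lef_pV2 ?ler_nat//.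
      by rewrite posrE ltr0n (leq_trans _ mk).
    by rewrite posrE ltr0n.
  have k0 : (0 < k)%N by [].
  have ks : `|s| / k%:R < d by apply: le_k (NP s) _; rewrite /k -addnA leq_addr.
  have kt : `|t| / k%:R < d.
    by apply: le_k (NP t) _; rewrite /k addnAC addnC leq_addr.
  have kst : `|s + t| / k%:R < d by apply: le_k (NP (s + t)) _; rewrite /k leq_addl.
  rewrite !(GamE k)// mulrDl.
  have sk (x : R) : `|x| / k%:R < d -> `|x / k%:R| < d by rewrite normrM normfV normr_nat.
  rewrite gamM ?sk// expgMn//.
  by rewrite /commute -!gamM ?sk// addrC.
exists Gam; split => //; first by rewrite Gam_gam ?normr0.
(* Near [t] the curve is [Gam t] times [gam (s - t)], a left translate of the local curve near 0. *)
move=> t; have I0 : integral_at u gam (1 * t + - t).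
  by apply: gamI; rewrite mul1r subrr normr0.
have := integral_at_ltrans (Gam t) (integral_at_affine I0).
rewrite scale1r; apply: integral_at_near.
apply/nbhs_normP; exists d => //= s; rewrite /ball_ /= distrC => st.
by rewrite mul1r -Gam_gam// -GamM addrC subrK.
Qed.

Lemma integral_smooth_curve u (gam : R -> G) :
  (forall t, integral_at u gam t) -> smooth_curve gam.
Proof.
move=> gI; have gc : continuous gam by move=> t; have [] := gI t.
split=> // c ac k.
apply: (@Ck_on_integral_curve _ _ _ _ (c @` cdom c) (frame c u)).
- by apply: open_comp => [t _|]; [exact: gc|exact: cdom_open].
- by move=> t /= ct; exists (gam t).
- exact: frame_smooth.
- by move=> t /= ct; have [_ _ /(_ _ (conj ac ct))] := gI t; rewrite frameE.
Qed.

Lemma tangent_map_id_coord p q (w : tangent p) c : p = q -> charts_at q c ->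
  tcoord (tangent_map idfun q w) c = tcoord w c.
Proof. by move=> pq; move: w; rewrite pq => w _; rewrite tangent_map_id. Qed.

(** Near [t] the subgroup is [gam t] times [gam (s - t)], so its velocity at [t] is the left
    translate of the velocity at 0. The initial condition, stated through [tangent_map idfun], has
    first to be read in the chart at the identity. *)
Lemma one_parameter_integral u (gam : R -> G) :
  one_parameter_subgroup u gam -> gam 0 = 1%g /\ forall t, integral_at u gam t.
Proof.
move=> [[gc gs] gM g0]; have k1 := charts_at_chart_at (1%g : G).
have g1 : gam 0 = 1%g.
  by apply: (@mulgI _ (gam 0)); rewrite -gM addr0 mulg1.
split => // t; have [ak1 dk1] := k1.
have [gD _] := gs _ ak1 1%N.
have kg : charts_at (gam 0) c1 by rewrite g1.
have {}gD : differentiable (c1 \o gam) 0 by apply: gD; rewrite /= g1.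
have V : velocity_at gam 0 (u : tangent (1%g : G)).
  apply: (velocity_at_chart g1 (gc 0) k1).
  have D1 := diff_derivable gD : derivable (c1 \o gam) 0 1.
  split => //; pose w := tvec (gam 0) c1 ('D_1 (c1 \o gam) 0).
  have V0 : velocity_at gam 0 w.
    by apply: (velocity_at_chart erefl (gc 0) kg); split => //; rewrite /w tvecK.
  rewrite -[in RHS]g0 (tangent_map_id_coord _ g1 k1) (velocity_at_velocity V0 kg).
  by rewrite /w tvecK.
have sV : velocity_at gam (1 * t + - t) (u : tangent (1%g : G)).
  by rewrite mul1r subrr.
have := velocity_at_comp (ltrans_smooth (mulg1 (gam t))) (velocity_at_affine sV).
rewrite scale1r; apply: velocity_at_near; apply: filterE => s /=.
by rewrite /ltrans -gM mul1r addrC subrK.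
Qed.

Lemma integral_one_parameter u (gam : R -> G) :
  gam 0 = 1%g -> (forall s t : R, gam (s + t) = (gam s * gam t)%g) ->
  (forall t, integral_at u gam t) -> one_parameter_subgroup u gam.
Proof.
move=> g0 gM gI; split => //; first exact: integral_smooth_curve gI.
have k1 := charts_at_chart_at (1%g : G).
have kg : charts_at (gam 0) c1 by rewrite g0.
apply: (tangent_chart_inj k1); rewrite (tangent_map_id_coord _ g0 k1).
rewrite (velocity_at_velocity (gI 0) kg).
have -> // : forall p, p = 1%g -> tcoord (left_field u p) c1 = tcoord u c1.
by move=> p ->; rewrite left_field1.
Qed.

(** Uniqueness identifies whatever subgroup the choice returns for [t *: u] with
    [s |-> gam (t * s)], whose value at 1 is [gam t]. The subgroup from [integral_global] shows that
    the default of [xget] is not taken. *)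
Lemma lie_exp_curve u : exists gam : R -> G,
  [/\ smooth_curve gam, forall t, integral_at u gam t &
      forall t : R, lie_exp (t *: u) = gam t].
Proof.
have [gam [g0 gI gM]] := integral_global u.
exists gam; split => //; first exact: integral_smooth_curve gI.
move=> t; have [del [d0 dI dM]] := integral_global (t *: u).
have E : exists g, [set g | exists2 gam, one_parameter_subgroup (t *: u) gam & g = gam 1] g.
  by exists (del 1), del => //; exact: integral_one_parameter.
have [eta /one_parameter_integral[e0 eI] eE] := xgetPex 1%g E.
rewrite /lie_exp eE.
have oT : open (@setT R) by exact: openT.
have cT : connected (@setT R) by exact/connected_intervalP.
rewrite (@integral_unique _ _ _ (t *: u) eta (fun s => gam (t * s + 0)) setT 0 oT cT)//.
- by rewrite mulr1 addr0.
- by rewrite e0 mulr0 addr0.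
- by move=> s _; apply: integral_at_affine.
Qed.

End Exponential.

(** * Randers norms on Euclidean space *)

Section EuclideanRanders.
Variables (R : realType) (n : nat).
Implicit Types (u v w z xi : 'rV[R]_n).

Definition dot u v : R := \sum_i u 0 i * v 0 i.

Lemma dotC u v : dot u v = dot v u.
Proof. by apply: eq_bigr => i _; rewrite mulrC. Qed.

Lemma dotDl u v w k : dot (k *: u + v) w = k * dot u w + dot v w.
Proof.
rewrite /dot mulr_sumr -big_split; apply: eq_bigr => i _ /=.
by rewrite !mxE mulrDl mulrA.
Qed.

Lemma dotDr u v w k : dot w (k *: u + v) = k * dot w u + dot w v.
Proof. by rewrite dotC dotDl !(dotC w). Qed.

Lemma dot0l w : dot 0 w = 0.
Proof. by apply: big1 => i _; rewrite mxE mul0r. Qed.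

Lemma dot0r w : dot w 0 = 0. Proof. by rewrite dotC dot0l. Qed.

Lemma dotZr k u w : dot w (k *: u) = k * dot w u.
Proof. by have := dotDr u 0 w k; rewrite dot0r !addr0. Qed.

Lemma dotZl k u w : dot (k *: u) w = k * dot u w.
Proof. by rewrite dotC dotZr dotC. Qed.

Lemma dotNr u w : dot w (- u) = - dot w u.
Proof. by rewrite -scaleN1r dotZr mulN1r. Qed.

Lemma dotNl u w : dot (- u) w = - dot u w.
Proof. by rewrite dotC dotNr dotC. Qed.

Lemma dotBr u v w : dot w (u - v) = dot w u - dot w v.
Proof. by rewrite -[u]scale1r dotDr mul1r scale1r dotNr. Qed.

Lemma dot_ge0 u : 0 <= dot u u.
Proof. by apply: sumr_ge0 => i _; rewrite -expr2 sqr_ge0. Qed.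

Lemma dot_eq0 u : (dot u u == 0) = (u == 0).
Proof.
apply/eqP/eqP => [u0|->]; last exact: dot0l.
apply/rowP => i; rewrite mxE; apply/eqP; rewrite -sqrf_eq0 expr2.
move/eqP: u0; rewrite psumr_eq0 => [/allP/(_ i)|j _]; last by rewrite -expr2 sqr_ge0.
by rewrite mem_index_enum; apply.
Qed.

Lemma dot_gt0 u : u != 0 -> 0 < dot u u.
Proof. by move=> u0; rewrite lt_def dot_ge0 dot_eq0 u0. Qed.

Lemma dot_inj u v : (forall z, dot u z = dot v z) -> u = v.
Proof.
move=> uv; apply/eqP; rewrite -subr_eq0 -dot_eq0.
have := dotDl u (- v) (u - v) 1; rewrite scale1r mul1r => ->.
by rewrite uv dotNl subrr.
Qed.

Lemma cauchy_schwarz u v : dot u v ^+ 2 <= dot u u * dot v v.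
Proof.
have [->|v0] := eqVneq v 0; first by rewrite !dot0r expr0n mulr0.
(* The squared norm of this combination is [dot v v] times the difference that has to be
   nonnegative. *)
have := dot_ge0 (dot v v *: u + (- dot u v) *: v).
have -> : dot (dot v v *: u + (- dot u v) *: v) (dot v v *: u + (- dot u v) *: v)
    = dot v v * (dot u u * dot v v - dot u v ^+ 2).
  by rewrite dotDl !dotDr !dotZl !dotZr (dotC v u); ring.
by rewrite pmulr_rge0 ?dot_gt0// subr_ge0.
Qed.

Variable xi : 'rV[R]_n.
Hypothesis xi1 : dot xi xi < 1.

Definition alpha u := Num.sqrt (dot u u).

(* [rnorm] is the Minkowski norm of a Randers metric, [rform u] is half the
   differential of its square and [rtensor u] half the Hessian. *)
Definition rnorm u := alpha u + dot xi u.
Definition runit u z := dot u z / alpha u + dot xi z.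
Definition rform u z := rnorm u * runit u z.
Definition rtensor u z w := runit u z * runit u w
  + rnorm u * (dot z w / alpha u - dot u z * dot u w / alpha u ^+ 3).

Lemma alpha_gt0 u : u != 0 -> 0 < alpha u.
Proof. by move=> u0; rewrite sqrtr_gt0 dot_gt0. Qed.

Lemma alpha_sqr u : alpha u ^+ 2 = dot u u.
Proof. by rewrite sqr_sqrtr// dot_ge0. Qed.

(** Cauchy-Schwarz with a drift of norm less than 1 gives [|dot xi u| < alpha u]; this is where the
    strict bound on the drift enters. *)
Lemma rnorm_gt0 u : u != 0 -> 0 < rnorm u.
Proof.
move=> u0; have a0 := alpha_gt0 u0.
suff : `|dot xi u| < alpha u.
  by rewrite ltr_norml => /andP[+ _]; rewrite -subr_gt0 opprK addrC.
rewrite -(@ltr_pXn2r _ 2)// ?nnegrE ?(ltW a0)// alpha_sqr real_normK ?num_real//.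
apply: le_lt_trans (cauchy_schwarz _ _) _.
by rewrite gtr_pMl// dot_gt0.
Qed.

Lemma runitDl u w z k : runit u (k *: w + z) = k * runit u w + runit u z.
Proof. by rewrite /runit !dotDr; ring. Qed.

Lemma rformB u z w : rform u (z - w) = rform u z - rform u w.
Proof. by rewrite /rform /runit !dotBr; ring. Qed.

Lemma rformN u z : rform u (- z) = - rform u z.
Proof. by rewrite /rform /runit !dotNr; ring. Qed.

Lemma rtensorC u z w : rtensor u z w = rtensor u w z.
Proof. by rewrite /rtensor (dotC z w) mulrC [dot u z * _]mulrC. Qed.

Lemma rtensorDl u w z v k : rtensor u (k *: w + z) v = k * rtensor u w v + rtensor u z v.
Proof. by rewrite /rtensor runitDl !dotDr !dotDl; ring. Qed.

Lemma rtensor0l u z : rtensor u 0 z = 0.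
Proof.
by rewrite /rtensor /runit !(dot0l, dot0r) !mul0r addr0 mul0r add0r subr0 mulr0.
Qed.

Lemma runit_self u : u != 0 -> runit u u = rnorm u.
Proof.
by move=> /alpha_gt0 a0; rewrite /runit -alpha_sqr expr2 mulfK// gt_eqF.
Qed.

(* Solving for [w] modulo the direction [u]: evaluating at [z = u] first gives
   [runit u w = 0]. *)
Lemma rtensor_solve u w (b : 'rV[R]_n -> 'rV[R]_n) : u != 0 -> b u = 0 ->
  (forall z, rtensor u w z = - rform u (b z)) ->
  runit u w = 0 /\ forall z, dot w z = dot u w / dot u u * dot u z
    - dot u (b z) - alpha u * dot xi (b z).
Proof.
move=> u0 bu H; have a0 := alpha_gt0 u0; have F0 := rnorm_gt0 u0.
have w0 : runit u w = 0.
  have := H u; rewrite bu /rform /runit !dot0r mul0r addr0 mulr0 oppr0.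
  rewrite /rtensor runit_self// (dotC w u) -alpha_sqr => /eqP.
  have -> : dot u w / alpha u - dot u w * alpha u ^+ 2 / alpha u ^+ 3 = 0.
    by field; rewrite gt_eqF.
  rewrite mulr0 addr0 mulf_eq0 (gt_eqF F0) orbF => /eqP.
  by [].
split=> // z; have := H z; rewrite /rtensor w0 mul0r add0r /rform.
move=> HF; have {HF} := mulfI (lt0r_neq0 F0) (etrans HF (esym (mulrN _ _))); rewrite /runit -alpha_sqr => E.
have -> : dot w z = alpha u * (dot w z / alpha u - dot u w * dot u z / alpha u ^+ 3)
    + dot u w / alpha u ^+ 2 * dot u z by field; rewrite gt_eqF.
by rewrite E; field; rewrite gt_eqF.
Qed.

(** By the case [b = 0] of [rtensor_solve], [w] is a multiple of [u] and [runit u w = 0], while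
    [runit u u] is the positive norm of [u]. This nondegeneracy is what inverts the fundamental
    tensor. *)
Lemma rtensor_inj u w : u != 0 -> (forall z, rtensor u w z = 0) -> w = 0.
Proof.
move=> u0 H; have [|w0 wE] := @rtensor_solve u w (fun=> 0) u0 erefl.
  by move=> z; rewrite H /rform /runit !dot0r mul0r addr0 mulr0 oppr0.
pose k := dot u w / dot u u.
have wk : w = k *: u.
  by apply: dot_inj => z; rewrite wE !dot0r mulr0 !subr0 dotZl.
have := w0; rewrite wk -[k *: u]addr0 runitDl runit_self// /runit !dot0r mul0r !addr0.
move=> /eqP; rewrite mulf_eq0 (gt_eqF (rnorm_gt0 u0)) orbF => /eqP ->.
by rewrite scale0r.
Qed.

Lemma is_derive_dot (V : normedModType R) (f g : V -> 'rV[R]_n) (x v : V) (df dg : 'rV[R]_n) :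
  is_derive x v f df -> is_derive x v g dg ->
  is_derive x v (fun y => dot (f y) (g y)) (dot df (g x) + dot (f x) dg).
Proof.
move=> fd gd.
rewrite (_ : (fun y => _) = \sum_i ((fun y => f y 0 i) * (fun y => g y 0 i))).
  rewrite /dot -big_split /=; apply: is_derive_sum => i.
  have H := is_deriveM (is_derive_coord i fd) (is_derive_coord i gd).
  apply: (is_derive_eq H); rewrite -![_ *: _]/(_ * _); ring.
by apply/funext => y; rewrite fct_sumE.
Qed.

(** A derivative along [v] is the derivative at 0 of a function of one real variable; this gives
    access to the one-variable chain rule for the square root. *)
Lemma is_derive_from_line (V W : normedModType R) (f : V -> W) (x v : V) (l : W) :
  is_derive (0 : R) 1 (fun h => f (h *: v + x)) l -> is_derive x v f l.
Proof.
have E : (fun h : R => h^-1 *: (((fun h => f (h *: v + x)) \o shift 0) (h *: 1)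
            - f (0 *: v + x)))
       = (fun h : R => h^-1 *: ((f \o shift x) (h *: v) - f x)).
  by apply/funext => h; rewrite /= -[h *: 1]/(h * 1) mulr1 !addr0 scale0r add0r.
by move=> [fd fE]; split; rewrite /derivable /derive -E.
Qed.

Lemma is_derive_alpha (V : normedModType R) (f : V -> 'rV[R]_n) (x v : V) (df : 'rV[R]_n) :
  is_derive x v f df -> f x != 0 ->
  is_derive x v (fun y => alpha (f y)) (dot (f x) df / alpha (f x)).
Proof.
move=> fd fx0; apply: is_derive_from_line.
have E0 : f (0 *: v + x) = f x by rewrite scale0r add0r.
have D0 : is_derive (0 : R) 1 (fun h => f (h *: v + x)) df.
  rewrite -(@derive_val _ _ _ _ _ _ _ fd).
  have {2}-> : x = 0 *: v + x by rewrite scale0r add0r.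
  by apply: is_derive_line; rewrite scale0r add0r; exact: ex_derive.
have D1 := is_derive_dot D0 D0; rewrite E0 in D1.
have q0 : 0 < dot (f (0 *: v + x)) (f (0 *: v + x)) by rewrite E0 dot_gt0.
have H := is_derive1_comp (is_derive1_sqrt q0) D1; apply: (is_derive_eq H).
rewrite E0 -/(alpha (f x)) (dotC df); have := alpha_gt0 fx0.
by move=> a0; field; rewrite gt_eqF.
Qed.

Lemma is_derive_rnorm (V : normedModType R) (f : V -> 'rV[R]_n) (x v : V) (df : 'rV[R]_n) :
  is_derive x v f df -> f x != 0 ->
  is_derive x v (fun y => rnorm (f y)) (runit (f x) df).
Proof.
move=> fd fx0; apply: is_deriveD; first exact: is_derive_alpha.
have := is_derive_dot (is_derive_cst xi x v) fd.
by rewrite dot0l add0r.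
Qed.

Lemma is_derive_rnorm_sqr (V : normedModType R) (f : V -> 'rV[R]_n) (x v : V) (df : 'rV[R]_n) :
  is_derive x v f df -> f x != 0 ->
  is_derive x v (fun y => rnorm (f y) ^+ 2) (2 * rform (f x) df).
Proof.
move=> fd fx0; have H := is_derive_rnorm fd fx0.
have H2 := is_deriveX 2 H; apply: (is_derive_eq H2).
by rewrite /rform /= expr1 -![_ *: _]/(_ * _) mulrA mulr_natl.
Qed.

(** Both arguments vary because the formula serves twice: a constant [g] gives the fundamental
    tensor, and the derivative of the coframe as [g] gives the mixed derivatives in the spray. *)
Lemma is_derive_rform (V : normedModType R) (f g : V -> 'rV[R]_n) (x v : V) (df dg : 'rV[R]_n) :
  is_derive x v f df -> is_derive x v g dg -> f x != 0 ->
  is_derive x v (fun y => rform (f y) (g y))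
    (rtensor (f x) (g x) df + rform (f x) dg).
Proof.
move=> fd gd fx0; have a0 := alpha_gt0 fx0.
have H1 := is_derive_rnorm fd fx0.
have H2 := is_derive_dot fd gd.
have H3 := is_derive_dot (is_derive_cst xi x v) gd.
have H4 := is_derive_alpha fd fx0.
have H4' : is_derive x v (fun y => (alpha (f y))^-1)
    (- alpha (f x) ^- 2 *: (dot (f x) df / alpha (f x))).
  have [D4 E4] := H4; have n0 := lt0r_neq0 a0; pose al y := alpha (f y).
  have D := @derivableV _ _ al x v n0 D4; have E := @deriveV _ _ al x v n0 D4.
  by split; [exact: D|rewrite E /al E4].
have H5 := is_deriveM H1 (is_deriveD (is_deriveM H2 H4') H3).
apply: (is_derive_eq H5).
rewrite /rtensor /rform /runit /= !fctE -![_ *: _]/(_ * _) dot0l (dotC df).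
by field; rewrite gt_eqF.
Qed.

End EuclideanRanders.

(** * The Maurer-Cartan form and the spray *)

Lemma self_add0 (V : zmodType) (x : V) : x = x + x -> x = 0.
Proof. by move=> /eqP; rewrite -subr_eq subrr eq_sym => /eqP. Qed.

Lemma differentiable_rV (R : realType) (U : normedModType R) n
    (f : U -> 'rV[R]_n) (x : U) :
  (forall i, differentiable (fun y => f y 0 i) x) -> differentiable f x.
Proof.
move=> fd.
have -> : f = \sum_(i < n) (fun y => f y 0 i *: delta_mx 0 i).
  by apply/funext => y; rewrite fct_sumE; exact: row_sum_delta.
by apply: differentiable_sum => i; exact: differentiableZl.
Qed.

Lemma is_derive_affine_map (R : realType) (U V : normedModType R) (f : U -> V)
    (x v : U) (l : V) :
  (forall h : R, f (h *: v + x) = h *: l + f x) -> is_derive x v f l.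
Proof.
move=> fl; apply: is_derive_from_line.
apply: (@quadratic_is_derive _ _ _ _ 0); apply: filterE => h.
by rewrite addr0 !fl scale0r add0r addrK subrr normr0 mul0r.
Qed.

Section Coframe.
Variables (R : realType) (n : nat) (G : lieGroupType R n).
Implicit Types (p q : G) (c : chart R n G) (u v : lie_algebra G).
Variables (a : metric_tensor G) (E : 'I_n -> lie_algebra G).
Arguments a : clear implicits.
Hypothesis ram : riemannian_metric a.
Hypothesis ainv : left_invariant_metric a.
Hypothesis Eortho : forall i j, a 1%g (E i) (E j) = (i == j)%:R.
Hypothesis Efull : forall u, u = \sum_i a 1%g u (E i) *: E i.

Lemma metricDl p k (u v w : tangent p) : a p (k *: u + v) w = k * a p u w + a p v w.
Proof. by have [H _ _ _] := ram. Qed.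

Lemma metricC p (u v : tangent p) : a p u v = a p v u.
Proof. by have [_ H _ _] := ram. Qed.

Lemma metricDr p k (u v w : tangent p) : a p w (k *: u + v) = k * a p w u + a p w v.
Proof. by rewrite metricC metricDl !(metricC w). Qed.

Lemma metric0r p (w : tangent p) : a p w 0 = 0.
Proof.
by apply: self_add0; have := metricDr 1 0 0 w; rewrite scale1r addr0 mul1r.
Qed.

Lemma metric_sumr p (w : tangent p) (k : 'I_n -> R) (e : 'I_n -> tangent p) :
  a p w (\sum_i k i *: e i) = \sum_i k i * a p w (e i).
Proof.
elim/big_rec2: _ => [|i x y _ <-]; first exact: metric0r.
exact: metricDr.
Qed.

Definition coords u : 'rV[R]_n := \row_i a 1%g (E i) u.

Lemma coords_linear k u v : coords (k *: u + v) = k *: coords u + coords v.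
Proof. by apply/rowP => i; rewrite !mxE metricDr. Qed.

Lemma coords0 : coords 0 = 0.
Proof. by apply/rowP => i; rewrite !mxE metric0r. Qed.

Lemma coords_dot u v : a 1%g u v = dot (coords u) (coords v).
Proof.
rewrite {1}(Efull v) metric_sumr; apply: eq_bigr => i _.
by rewrite !mxE (metricC u) (metricC v) mulrC.
Qed.

Definition uncoords (y : 'rV[R]_n) : lie_algebra G := \sum_i y 0 i *: E i.

Lemma uncoordsK y : coords (uncoords y) = y.
Proof.
apply/rowP => j; rewrite mxE metric_sumr (bigD1 j)//= Eortho eqxx mulr1.
by rewrite big1 ?addr0// => i ij; rewrite Eortho eq_sym (negbTE ij) mulr0.
Qed.

Lemma coords_surj y : exists u, coords u = y.
Proof. by exists (uncoords y); exact: uncoordsK. Qed.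

Lemma coords_inj u v : coords u = coords v -> u = v.
Proof.
move=> uv; rewrite (Efull u) (Efull v); apply: eq_bigr => i _.
have := congr1 (fun y : 'rV[R]_n => y 0 i) uv; rewrite !mxE => e.
by rewrite metricC e metricC.
Qed.

Lemma coords_neq0 u : u != 0 -> coords u != 0.
Proof. by apply: contra_neq => u0; apply: coords_inj; rewrite u0 coords0. Qed.

Lemma tvec_linear p c k (y z : 'rV[R]_n) : charts_at p c ->
  tvec p c (k *: y + z) = k *: tvec p c y + tvec p c z.
Proof.
move=> cp; apply: (tangent_chart_inj cp).
rewrite -[RHS]/(k *: tcoord (tvec p c y) c + tcoord (tvec p c z) c).
by rewrite !(tvecK cp).
Qed.

(** Values are coordinates in the orthonormal basis [E], so the metric at every point becomes the
    fixed product [dot], and the Randers norm depends on [x] only through this map, linear in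
    [y]. *)
Definition coframe c (x y : 'rV[R]_n) : 'rV[R]_n :=
  coords (tangent_map (ltrans (cinv c x)^-1%g) 1%g (tvec (cinv c x) c y)).

Lemma coframeE c p y : cdom c p ->
  coframe c (c p) y = coords (tangent_map (ltrans p^-1%g) 1%g (tvec p c y)).
Proof. by move=> cp; rewrite /coframe cmapK. Qed.

Lemma coframe_linear c p k y z : charts_at p c ->
  coframe c (c p) (k *: y + z) = k *: coframe c (c p) y + coframe c (c p) z.
Proof.
move=> cp; have [_ cdp] := cp; rewrite !coframeE//.
by rewrite tvec_linear// tangent_map_linear coords_linear.
Qed.

Lemma coframe_frame c p u : charts_at p c ->
  coframe c (c p) (frame c u (c p)) = coords u.
Proof.
move=> cp; have [_ cdp] := cp.
by rewrite coframeE// frameE// (tcoordK cp) left_field_inv.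
Qed.

Lemma frame_surj c p y : charts_at p c -> exists u, frame c u (c p) = y.
Proof.
move=> cp; have [_ cdp] := cp; exists (tangent_map (ltrans p^-1%g) 1%g (tvec p c y)).
by rewrite frameE// left_field_surj tvecK.
Qed.

Lemma coframe0 c p : charts_at p c -> coframe c (c p) 0 = 0.
Proof.
move=> cp; apply: self_add0.
by have := coframe_linear 1 0 0 cp; rewrite scale1r addr0 scale1r.
Qed.

Lemma coframe_inj c p y : charts_at p c -> coframe c (c p) y = 0 -> y = 0.
Proof.
move=> cp; have [u <-] := frame_surj y cp; rewrite coframe_frame// => u0.
have -> : u = 0 by apply: coords_inj; rewrite u0 coords0.
by apply: self_add0; have := frame_linear c (c p) 1 0 0; rewrite !scale1r addr0.
Qed.

Lemma coframe_surj c p z : charts_at p c -> exists y, coframe c (c p) y = z.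
Proof.
move=> cp; have [u <-] := coords_surj z.
by exists (frame c u (c p)); exact: coframe_frame.
Qed.

Lemma coframe_sum c p (k : 'I_n -> R) (y : 'I_n -> 'rV[R]_n) : charts_at p c ->
  coframe c (c p) (\sum_i k i *: y i) = \sum_i k i *: coframe c (c p) (y i).
Proof.
move=> cp; elim/big_rec2: _ => [|i z w _ <-]; first exact: coframe0.
exact: coframe_linear.
Qed.

Lemma coframe_delta c p y : charts_at p c ->
  coframe c (c p) y = \sum_j y 0 j *: coframe c (c p) (delta_mx 0 j).
Proof. by move=> cp; rewrite -coframe_sum// -row_sum_delta. Qed.

(** Left invariance of the metric turns the [i]-th component into the product of [y] with the
    left-invariant field of [E i] at [p]. Only the frame and the metric coefficients appear, both
    smooth, so [coframe] can be differentiated without differentiating an inverse translation. *)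
Lemma coframe_coord c p y i : charts_at p c ->
  coframe c (c p) y 0 i
  = \sum_j frame c (E i) (c p) 0 j * a p (tvec p c (delta_mx 0 j)) (tvec p c y).
Proof.
move=> cp; have [_ cdp] := cp.
rewrite coframeE// mxE -{1}(left_field_inv p (E i)) -ainv metricC.
rewrite -{1}(tcoordK cp (left_field (E i) p)) -frameE//.
have -> : tvec p c (frame c (E i) (c p))
    = \sum_j frame c (E i) (c p) 0 j *: tvec p c (delta_mx 0 j).
  rewrite {1}[frame _ _ _]row_sum_delta.
  have t0 : tvec p c 0 = 0.
    by apply: self_add0; have := tvec_linear 1 0 0 cp; rewrite !scale1r addr0.
  by elim/big_rec2: _ => [//|j z w _ <-]; exact: tvec_linear.
by rewrite metric_sumr; apply: eq_bigr => j _; rewrite metricC.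
Qed.

Lemma near_chart c p (P : 'rV[R]_n -> Prop) : charts_at p c ->
  (forall q, charts_at q c -> P (c q)) -> \forall x \near c p, P x.
Proof.
move=> cp H; have [ac _] := cp.
by apply: filterS (chart_img_nbhs cp) => _ [q cq <-]; apply: H.
Qed.

Lemma coframe_differentiable c p y : charts_at p c ->
  differentiable (fun x => coframe c x y) (c p).
Proof.
move=> cp; have [ac cdp] := cp; apply: differentiable_rV => i.
pose f j := fun x => frame c (E i) x 0 j
  * a (cinv c x) (tvec (cinv c x) c (delta_mx 0 j)) (tvec (cinv c x) c y).
have N : \forall x \near c p, (\sum_j f j) x = coframe c x y 0 i.
  apply: near_chart cp _ => q cq; have [_ cdq] := cq.
  by rewrite fct_sumE coframe_coord//; apply: eq_bigr => j _; rewrite /f cmapK.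
apply: (differentiable_near_eq N); apply: differentiable_sum => j.
apply: differentiableM.
  exact: (differentiable_comp (frame_differentiable _ cp) (differentiable_coord _ _ _)).
have [_ _ _ /(_ c ac (delta_mx 0 j) y 1%N)[+ _]] := ram.
by apply; exists p.
Qed.

Definition dcoframe c (x w y : 'rV[R]_n) : 'rV[R]_n :=
  'D_w (fun x => coframe c x y) x.

Lemma dcoframe_linear c p w k y z : charts_at p c ->
  dcoframe c (c p) w (k *: y + z)
  = k *: dcoframe c (c p) w y + dcoframe c (c p) w z.
Proof.
move=> cp; apply: derivative_linear; try exact: coframe_differentiable.
by apply: near_chart cp _ => q cq; exact: coframe_linear.
Qed.

Lemma dcoframe_delta c p w y : charts_at p c ->
  dcoframe c (c p) w y = \sum_j w 0 j *: dcoframe c (c p) (delta_mx 0 j) y.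
Proof.
move=> cp; have d := coframe_differentiable y cp.
by apply: (etrans (deriveE _ d)); exact: diff_delta.
Qed.

Lemma dcoframe_sum c p w (k : 'I_n -> R) (y : 'I_n -> 'rV[R]_n) : charts_at p c ->
  dcoframe c (c p) w (\sum_i k i *: y i) = \sum_i k i *: dcoframe c (c p) w (y i).
Proof.
move=> cp; elim/big_rec2: _ => [|i z x _ <-]; last exact: dcoframe_linear.
by apply: self_add0; have := dcoframe_linear w 1 0 0 cp; rewrite !scale1r addr0.
Qed.

(** On a left-invariant field the coframe takes the constant value [coords u]; the Leibniz rule
    trades the derivative of the form for that of the field. *)
Lemma dcoframe_frame c p u w : charts_at p c ->
  dcoframe c (c p) w (frame c u (c p)) = - coframe c (c p) ('D_w (frame c u) (c p)).
Proof.
move=> cp; have dfr := frame_differentiable u cp.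
have N : \forall x \near c p,
    (\sum_j (fun x => frame c u x 0 j *: coframe c x (delta_mx 0 j))) x = cst (coords u) x.
  apply: near_chart cp _ => q cq.
  by rewrite fct_sumE /= -(coframe_frame _ cq) [RHS](coframe_delta _ cq).
have dc j : differentiable (fun x => frame c u x 0 j) (c p).
  exact: (differentiable_comp dfr (differentiable_coord _ _ _)).
have dF j := derive_scale w (dc j) (coframe_differentiable (delta_mx 0 j) cp).
have := near_eq_derive w N; rewrite derive_cst.
rewrite derive_sum => [|j]; last exact/diff_derivable/(dF j).1.
move=> S0; apply/eqP; rewrite -addr_eq0 addrC; apply/eqP; rewrite -S0.
apply/esym; transitivity (\sum_j ('D_w (frame c u) (c p) 0 j *: coframe c (c p) (delta_mx 0 j)
    + frame c u (c p) 0 j *: dcoframe c (c p) w (delta_mx 0 j))).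
  apply: eq_bigr => j _; apply: (etrans (dF j).2); congr (_ *: _ + _).
  apply: derive_val; apply: is_derive_coord; split => //; exact: diff_derivable.
rewrite big_split /= -coframe_delta//; congr (_ + _).
apply: (etrans (esym (dcoframe_sum _ _ _ cp))).
by rewrite -row_sum_delta.
Qed.

(** By [dcoframe_frame] the left side is minus the coframe of the commutator of the two fields,
    which [frame_bracket] identifies with the left-invariant field of the bracket. *)
Lemma maurer_cartan c p u v : charts_at p c ->
  dcoframe c (c p) (frame c u (c p)) (frame c v (c p))
  - dcoframe c (c p) (frame c v (c p)) (frame c u (c p))
  = - coords (lie_bracket u v).
Proof.
move=> cp; rewrite !dcoframe_frame// -(coframe_frame _ cp) -frame_bracket//.
set y := 'D_(frame c u _) _ _; set z := 'D_(frame c v _) _ _.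
have -> : y - z = (-1) *: z + y by rewrite scaleN1r addrC.
by rewrite coframe_linear// scaleN1r opprD !opprK addrC.
Qed.

(** * The spray of the Randers metric in the left-invariant coframe *)

Variable X : vector_field G.
Hypothesis Xinv : left_invariant_field X.
Hypothesis Xlt1 : Num.sqrt (a 1%g (X 1%g) (X 1%g)) < 1.

Local Notation co := coords.
Local Notation A := coframe.
Local Notation dA := dcoframe.
Local Notation F := (randers a X).
Let xi : 'rV[R]_n := co (X 1%g).

Lemma drift_lt1 : dot xi xi < 1.
Proof.
have x0 := dot_ge0 xi.
move: Xlt1; rewrite coords_dot -/xi -[X in _ < X -> _]sqrtr1.
by rewrite ltr_sqrt.
Qed.

Lemma X_translate p : tangent_map (ltrans p^-1%g) 1%g (X p) = X 1%g.
Proof.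
have H q g h : ltrans g h = q -> X q = tangent_map (ltrans g) q (X h).
  by move=> <-; exact: Xinv.
exact/esym/H/mulVg.
Qed.

Lemma randers_coframe c p y : charts_at p c ->
  local_sqr F c (c p) y = rnorm xi (A c (c p) y) ^+ 2.
Proof.
move=> cp; have [_ cdp] := cp.
rewrite /local_sqr (coframeE _ cdp) /randers cmapK// ainv.
by rewrite [a p (X p) _]ainv X_translate !coords_dot.
Qed.

Lemma coframe_neq0 c p y : charts_at p c -> y != 0 -> A c (c p) y != 0.
Proof. by move=> cp; apply: contra_neq; exact: coframe_inj. Qed.

Lemma is_derive_coframe c p (y v : 'rV[R]_n) : charts_at p c ->
  is_derive y v (A c (c p)) (A c (c p) v).
Proof. by move=> cp; apply: is_derive_affine_map => h; exact: coframe_linear. Qed.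

Lemma is_derive_dcoframe c p (w y v : 'rV[R]_n) : charts_at p c ->
  is_derive y v (dA c (c p) w) (dA c (c p) w v).
Proof. by move=> cp; apply: is_derive_affine_map => h; exact: dcoframe_linear. Qed.

Lemma near_neq0 (y : 'rV[R]_n) : y != 0 -> \forall z \near y, z != 0.
Proof.
move=> y0; apply/nbhs_normP; exists `|y|; first by rewrite /= normr_gt0.
by move=> z; rewrite /ball_ /=; apply: contraTneq => ->; rewrite subr0 ltxx.
Qed.

Lemma pderiv_y_sqr c p i y : charts_at p c -> y != 0 ->
  pderiv_y i (local_sqr F c) (c p) y
  = 2 * rform xi (A c (c p) y) (A c (c p) (delta_mx 0 i)).
Proof.
move=> cp y0; rewrite /pderiv_y.
have -> : local_sqr F c (c p) = fun y => rnorm xi (A c (c p) y) ^+ 2.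
  by apply/funext => z; exact: randers_coframe.
apply: derive_val; apply: is_derive_rnorm_sqr; first exact: is_derive_coframe.
exact: coframe_neq0.
Qed.

Lemma fundamental_tensorE c p i j y : charts_at p c -> y != 0 ->
  fundamental_tensor F c (c p) y i j
  = rtensor xi (A c (c p) y) (A c (c p) (delta_mx 0 i)) (A c (c p) (delta_mx 0 j)).
Proof.
move=> cp y0; rewrite mxE {1}/pderiv_y.
have N : \forall z \near y, pderiv_y i (local_sqr F c) (c p) z
    = 2 * rform xi (A c (c p) z) (A c (c p) (delta_mx 0 i)).
  by apply: filterS (near_neq0 y0) => z; exact: pderiv_y_sqr.
rewrite (near_eq_derive _ N).
have H := is_derive_rform xi (is_derive_coframe y (delta_mx 0 j) cp)
  (is_derive_cst (A c (c p) (delta_mx 0 i)) y (delta_mx 0 j)) (coframe_neq0 cp y0).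
have := is_deriveZ 2 H => /(@derive_val _ _ _ _ _ _ _) ->.
by rewrite /= /rform /runit !dot0r mul0r addr0 mulr0 addr0 -![_ *: _]/(_ * _) mulKf.
Qed.

Lemma pderiv_x_sqr c p m y : charts_at p c -> y != 0 ->
  pderiv_x m (local_sqr F c) (c p) y
  = 2 * rform xi (A c (c p) y) (dA c (c p) (delta_mx 0 m) y).
Proof.
move=> cp y0; rewrite /pderiv_x.
have N : \forall x \near c p, local_sqr F c x y = rnorm xi (A c x y) ^+ 2.
  by apply: near_chart cp _ => q cq; exact: randers_coframe.
rewrite (near_eq_derive _ N); apply: derive_val.
apply: (@is_derive_rnorm_sqr _ _ xi _ (fun x => A c x y)); last exact: coframe_neq0.
by split => //; apply: diff_derivable; exact: coframe_differentiable.
Qed.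

Lemma pderiv_yx_sqr c p l m y : charts_at p c -> y != 0 ->
  pderiv_y l (pderiv_x m (local_sqr F c)) (c p) y
  = 2 * (rtensor xi (A c (c p) y) (dA c (c p) (delta_mx 0 m) y) (A c (c p) (delta_mx 0 l))
    + rform xi (A c (c p) y) (dA c (c p) (delta_mx 0 m) (delta_mx 0 l))).
Proof.
move=> cp y0; rewrite {1}/pderiv_y.
have N : \forall z \near y, pderiv_x m (local_sqr F c) (c p) z
    = 2 * rform xi (A c (c p) z) (dA c (c p) (delta_mx 0 m) z).
  by apply: filterS (near_neq0 y0) => z; exact: pderiv_x_sqr.
rewrite (near_eq_derive _ N).
have H := is_derive_rform xi (is_derive_coframe y (delta_mx 0 l) cp)
  (is_derive_dcoframe (delta_mx 0 m) y (delta_mx 0 l) cp) (coframe_neq0 cp y0).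
exact: (@derive_val _ _ _ _ _ _ _ (is_deriveZ 2 H)).
Qed.

Lemma rtensor_suml (x : 'rV[R]_n) (k : 'I_n -> R) (y : 'I_n -> 'rV[R]_n) (z : 'rV[R]_n) :
  rtensor xi x (\sum_i k i *: y i) z = \sum_i k i * rtensor xi x (y i) z.
Proof.
elim/big_rec2: _ => [|i s t _ <-]; last exact: rtensorDl.
exact: rtensor0l.
Qed.

Lemma rform_sum (x : 'rV[R]_n) (k : 'I_n -> R) (y : 'I_n -> 'rV[R]_n) :
  rform xi x (\sum_i k i *: y i) = \sum_i k i * rform xi x (y i).
Proof.
elim/big_rec2: _ => [|i s t _ <-]; last by rewrite /rform runitDl mulrDr mulrCA.
by rewrite /rform /runit !dot0r mul0r addr0 mulr0.
Qed.

(** If the matrix kills a row vector [v], then [rtensor] pairs the coframe image of [v] to zero with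
    the images of the coordinate vectors, which span; nondegeneracy gives [v = 0]. *)
Lemma fundamental_tensor_unit c p y : charts_at p c -> y != 0 ->
  fundamental_tensor F c (c p) y \in unitmx.
Proof.
move=> cp y0; rewrite -row_free_unit -kermx_eq0; apply/rowV0P => v /sub_kermxP vK.
apply: (coframe_inj cp).
apply: (rtensor_inj drift_lt1 (coframe_neq0 cp y0)) => z.
have [z' <-] := coframe_surj z cp.
rewrite rtensorC (coframe_delta z' cp) rtensor_suml big1// => j _.
rewrite rtensorC (coframe_delta v cp) rtensor_suml.
have := congr1 (fun M : 'rV[R]_n => M 0 j) vK; rewrite !mxE => vKj.
suff -> : \sum_i v 0 i * rtensor xi (A c (c p) y) (A c (c p) (delta_mx 0 i))
    (A c (c p) (delta_mx 0 j)) = 0 by rewrite mulr0.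
by rewrite -[RHS]vKj; apply: eq_bigr => i _; rewrite fundamental_tensorE.
Qed.

(** Undoes the inverse matrix in the definition of the spray. The transpose is there because the
    spray is a row while the inverse acts on columns. *)
Lemma invmx_solve (M : 'M[R]_n) (g : 'rV[R]_n) (k : R) (s : 'cV[R]_n) l :
  M \in unitmx -> g^T = k *: (invmx M *m s) -> \sum_i M l i * g 0 i = k * s l 0.
Proof.
move=> MU gE; have := congr1 (fun N : 'cV[R]_n => N l 0) (congr1 (mulmx M) gE).
by rewrite -scalemxAr mulKVmx// !mxE => <-; apply: eq_bigr => i _; rewrite mxE.
Qed.

(** Lowering the index of the spray leaves the Euler-Lagrange expression of the squared norm. The
    term where the base point of [rform] varies is an [rtensor] of the derivative of the coframe and
    joins the spray to form [w]; the rest is [rform] of the antisymmetrised derivative of the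
    coframe, which [maurer_cartan] evaluates. *)
Lemma spray_euler_lagrange c p u v : charts_at p c -> u != 0 ->
  let y := frame c u (c p) in
  let w := 2 *: A c (c p) (spray F c (c p) y) - dA c (c p) y y in
  rtensor xi (co u) w (co v) = - rform xi (co u) (co (lie_bracket u v)).
Proof.
move=> cp u0 y w; pose U := co u; pose L := local_sqr F c.
have AU : A c (c p) y = U by exact: coframe_frame.
have y0 : y != 0.
  apply: contra_neq u0 => y0; apply: (coords_inj).
  exact: etrans (esym AU) (etrans (congr1 _ y0) (etrans (coframe0 cp) (esym coords0))).
pose M := fundamental_tensor F c (c p) y; pose g := spray F c (c p) y.
pose S l := \sum_m pderiv_y l (pderiv_x m L) (c p) y * y 0 m - pderiv_x l L (c p) y.
have MU : M \in unitmx by exact: fundamental_tensor_unit.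
have ME l i : M l i = rtensor xi U (A c (c p) (delta_mx 0 l)) (A c (c p) (delta_mx 0 i)).
  by rewrite /M fundamental_tensorE// AU.
have MG l : \sum_i M l i * g 0 i = 4^-1 * S l.
  have gE : g^T = 4^-1 *: (invmx M *m \col_l S l).
    by apply/colP => i; rewrite !mxE; congr (_ * _); apply: eq_bigr => k _; rewrite !mxE.
  by rewrite (invmx_solve l MU gE) mxE.
have MG' l : \sum_i M l i * g 0 i = rtensor xi U (A c (c p) g) (A c (c p) (delta_mx 0 l)).
  rewrite (coframe_delta g cp) rtensor_suml.
  by apply: eq_bigr => i _; rewrite ME mulrC rtensorC.
(* The sum over [m] against the coordinates of [y] assembles partial derivatives of the coframe into
   its derivative along [y]. *)
have SE l : S l = 2 * (rtensor xi U (dA c (c p) y y) (A c (c p) (delta_mx 0 l))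
    + rform xi U (dA c (c p) y (delta_mx 0 l)))
    - 2 * rform xi U (dA c (c p) (delta_mx 0 l) y).
  rewrite /S /L pderiv_x_sqr// AU; congr (_ - _).
  rewrite (dcoframe_delta y y cp) (dcoframe_delta y (delta_mx 0 l) cp).
  rewrite rtensor_suml rform_sum -big_split /= mulr_sumr; apply: eq_bigr => m _.
  by rewrite pderiv_yx_sqr// AU; ring.
have H l : rtensor xi U w (A c (c p) (delta_mx 0 l))
    = rform xi U (dA c (c p) y (delta_mx 0 l)) - rform xi U (dA c (c p) (delta_mx 0 l) y).
  have := MG l; rewrite MG' SE => e.
  rewrite /w -scaleN1r addrC rtensorDl -[2 *: _]addr0 rtensorDl rtensor0l.
  have arith (s1 s2 s3 s4 : R) : s1 = 4^-1 * (2 * (s2 + s3) - 2 * s4) ->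
      -1 * s2 + (2 * s1 + 0) = s3 - s4 by move=> ->; field.
  exact: arith e.
have zE := coframe_frame v cp; set z := frame c v (c p) in zE.
have -> : co v = \sum_l z 0 l *: A c (c p) (delta_mx 0 l).
  by rewrite -zE; exact: coframe_delta.
rewrite rtensorC rtensor_suml.
transitivity (\sum_l z 0 l * (rform xi U (dA c (c p) y (delta_mx 0 l))
    - rform xi U (dA c (c p) (delta_mx 0 l) y))).
  by apply: eq_bigr => l _; rewrite rtensorC H.
transitivity (rform xi U (dA c (c p) y z) - rform xi U (dA c (c p) z y)).
  rewrite (dcoframe_delta z y cp) rform_sum.
  have -> : dA c (c p) y z = \sum_l z 0 l *: dA c (c p) y (delta_mx 0 l).
    by rewrite {1}(row_sum_delta z) dcoframe_sum.
  by rewrite rform_sum -sumrB; apply: eq_bigr => l _; rewrite mulrBr.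
by rewrite -rformB maurer_cartan// rformN.
Qed.

Lemma coordsK u : uncoords (co u) = u.
Proof. by apply: coords_inj; rewrite uncoordsK. Qed.

Lemma coordsN u : co (- u) = - co u.
Proof. by rewrite -scaleN1r -[_ *: u]addr0 coords_linear coords0 addr0 scaleN1r. Qed.

Lemma lie_bracketZr k u v : lie_bracket v (k *: u) = k *: lie_bracket v u.
Proof.
have L0 : lie_bracket v 0 = 0.
  by apply: self_add0; have := lie_bracketDr 1 0 0 v; rewrite !scale1r addr0.
by have := lie_bracketDr k u 0 v; rewrite !addr0 L0 addr0.
Qed.

Lemma lie_bracketNl u v : lie_bracket (- u) v = - lie_bracket u v.
Proof.
by rewrite lie_bracketC -[- u]scaleN1r lie_bracketZr scaleN1r opprK lie_bracketC.
Qed.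

Lemma frameZ c x k u : frame c (k *: u) x = k *: frame c u x.
Proof.
have L0 : frame c 0 x = 0.
  by apply: self_add0; have := frame_linear c x 1 0 0; rewrite !scale1r addr0.
by have := frame_linear c x k u 0; rewrite !addr0 L0 addr0.
Qed.

(** This term of the defect is quadratic, so a change of sign of [y] leaves only the sprays to be
    compared. *)
Lemma dcoframe_opp c p y : charts_at p c -> dA c (c p) (- y) (- y) = dA c (c p) y y.
Proof.
move=> cp.
have L0 : dA c (c p) (- y) 0 = 0.
  by apply: self_add0; have := dcoframe_linear (- y) 1 0 0 cp; rewrite !scale1r addr0.
have := dcoframe_linear (- y) (-1) y 0 cp; rewrite !scaleN1r addr0 L0 addr0 => ->.
have d := coframe_differentiable y cp.
rewrite -[RHS]opprK; apply: (congr1 -%R).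
apply: (etrans (deriveE _ d)); apply: (etrans (linearN _ _)).
exact: (congr1 -%R (esym (deriveE _ d))).
Qed.

Definition spray_defect c p y : 'rV[R]_n :=
  2 *: A c (c p) (spray F c (c p) y) - dA c (c p) y y.

(** [rtensor_solve] applies with the adjoint action of [u] as [b]; its condition [b u = 0] is
    [lie_bracket_self]. *)
Lemma spray_defect_solve c p u : charts_at p c -> u != 0 ->
  let w := spray_defect c p (frame c u (c p)) in
  runit xi (co u) w = 0 /\ forall v, dot w (co v)
    = dot (co u) w / dot (co u) (co u) * dot (co u) (co v)
      - dot (co u) (co (lie_bracket u v)) - alpha (co u) * dot xi (co (lie_bracket u v)).
Proof.
move=> cp u0 w; have U0 := coords_neq0 u0.
have [||w1 w2] := @rtensor_solve _ _ xi drift_lt1 (co u) w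
    (fun z => co (lie_bracket u (uncoords z))) U0.
- by rewrite coordsK lie_bracket_self coords0.
- by move=> z; rewrite -{1}(uncoordsK z); exact: spray_euler_lagrange.
split; first exact: w1.
by move=> v; have := w2 (co v); rewrite coordsK.
Qed.

(* The odd part of a Douglas spray is proportional to [y]; for a Randers metric
   it is, up to a multiple of [y], the adjoint of [ad y] applied to the drift. *)
Lemma douglas_bracket : douglas_type F ->
  forall u v, dot xi (co (lie_bracket u v)) = 0.
Proof.
move=> doug u v; have [->|u0] := eqVneq u 0.
  by rewrite lie_bracketC -[0 in X in - X](scale0r v) lie_bracketZr scale0r oppr0
     coords0 dot0r.
pose c := chart_at (1%g : G); have cp : charts_at 1%g c := charts_at_chart_at _.
have [ac cdp] := cp.
have [Gam [P [_ GP]]] := doug _ ac.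
set y := frame c u (c 1%g).
have yN : frame c (- u) (c 1%g) = - y by rewrite -scaleN1r frameZ scaleN1r.
have U0 := coords_neq0 u0.
have Ay : A c (c 1%g) y = co u by exact: coframe_frame.
have y0 : y != 0.
  by apply: contra_neq U0 => y0; rewrite -Ay y0 coframe0.
pose kap := P (c 1%g) y + P (c 1%g) (- y).
(* The quadratic parts of the Douglas form agree at [y] and [- y], so a multiple of [y] remains. [P]
   is only positively homogeneous, so its two values are unrelated and both enter [kap]. *)
have sprayN : spray F c (c 1%g) y = kap *: y + spray F c (c 1%g) (- y).
  have cin : (c @` cdom c) (c 1%g) by exists 1%g.
  have Ny0 : - y != 0 by rewrite oppr_eq0.
  apply/rowP => i; rewrite [RHS]mxE [X in _ = X + _]mxE.
  rewrite (GP _ _ i cin y0) (GP _ _ i cin Ny0) [(- y) 0 i]mxE.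
  have -> : \sum_j \sum_k Gam i j k (c 1%g) * (- y) 0 j * (- y) 0 k
     = \sum_j \sum_k Gam i j k (c 1%g) * y 0 j * y 0 k.
    by apply: eq_bigr => j _; apply: eq_bigr => k _; rewrite !mxE; ring.
  by rewrite /kap; ring.
have wN : spray_defect c 1%g y = (2 * kap) *: co u + spray_defect c 1%g (- y).
  rewrite /spray_defect dcoframe_opp// sprayN coframe_linear// Ay.
  by rewrite scalerDr scalerA addrA.
have [_ w1] := spray_defect_solve cp u0.
have Nu0 : - u != 0 by rewrite oppr_eq0.
have [_ w2] := spray_defect_solve cp Nu0.
rewrite yN in w2; rewrite -/y wN in w1.
have alphaN : alpha (co (- u)) = alpha (co u).
  by rewrite /alpha coordsN dotNl dotNr opprK.
(* Subtracting the solved equations for [u] and [- u] cancels the even term, the product of [u] with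
   its bracket, and doubles the odd term with the drift. *)
have [k kP] : exists k : R, forall z, k * dot (co u) (co z)
    = 2 * alpha (co u) * dot xi (co (lie_bracket u z)).
  move: w1 w2; set w' := spray_defect _ _ _; set k1 := _ / _; set k2 := _ / _ => w1 w2.
  exists (k1 + k2 - 2 * kap) => z.
  have h1 := w1 z; have h2 := w2 z; rewrite dotDl in h1.
  rewrite alphaN lie_bracketNl !coordsN !dotNl !dotNr opprK in h2.
  have arith (ka m1 m2 W D Q al xl : R) : 2 * ka * D + W = m1 * D - Q - al * xl ->
      W = m2 * - D - Q - al * - xl -> (m1 + m2 - 2 * ka) * D = 2 * al * xl.
    by move=> e1 e2; lra.
  exact: arith h1 h2.
have a0 := alpha_gt0 U0.
(* At [z = u] the bracket vanishes while [dot (co u) (co u)] does not. *)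
have k0 : k = 0.
  have := kP u; rewrite lie_bracket_self coords0 dot0r mulr0 => /eqP.
  by rewrite mulf_eq0 dot_eq0 (negbTE U0) orbF => /eqP.
have := kP v; rewrite k0 mul0r => /esym/eqP; rewrite !mulf_eq0 pnatr_eq0 (gt_eqF a0) /=.
by move/eqP.
Qed.

(** Once the drift is orthogonal to brackets the condition is the one for the underlying Riemannian
    metric. The direct implication uses the geodesic equation at time 0 only; the converse also has
    to supply smoothness and a nonvanishing velocity, both inherited from the integral curve. *)
Lemma geodesic_vectorP Y : douglas_type F ->
  geodesic_vector F Y <-> Y != 0 /\ forall Z, a 1%g Y (lie_bracket Y Z) = 0.
Proof.
move=> /douglas_bracket xi0.
have [gam [gs gI gE]] := lie_exp_curve Y.
rewrite /geodesic_vector (_ : (fun t => _) = gam); last by apply/funext.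
have frD c t : charts_at (gam t) c -> \forall s \near t,
    charts_at (gam s) c /\ derive1 (c \o gam) s = frame c Y ((c \o gam) s).
  move=> cg; have [ac cdg] := cg; have [_ gc _] := gI t.
  have := near_continuous gc erefl (chart_dom_near cdg).
  apply: filterS => s cs; split; first by split.
  have [_ _ /(_ _ (conj ac cs)) D] := gI s.
  by rewrite derive1E frameE//; exact: derive_val.
(* Along the curve [x'] is the frame of [Y], so [x''] is the derivative of that frame along itself,
   which the coframe sends to minus [dcoframe] on the same vectors by [dcoframe_frame]. *)
have geo c t : charts_at (gam t) c -> Y != 0 ->
   let x := c \o gam in
   A c (c (gam t)) (derive1 (derive1 x) t + 2 *: spray F c (x t) (derive1 x t))
   = spray_defect c (gam t) (frame c Y (c (gam t))).
  move=> cg Y0 x; have N := frD c t cg.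
  have [_ x1] := nbhs_singleton N.
  have xD : differentiable x t.
    have [_ _ /(_ _ cg) D] := gI t.
    by apply/derivable1_diffP; exact: ex_derive.
  have N' : \forall s \near t, derive1 x s = (frame c Y \o x) s by apply: filterS N => s [].
  have dfr : differentiable (frame c Y) (x t) := frame_differentiable Y cg.
  have x2 : derive1 (derive1 x) t = 'D_(frame c Y (x t)) (frame c Y) (x t).
    apply: (etrans (derive1E _ _)).
    apply: (etrans (near_eq_derive (1 : R) N')).
    apply: (etrans (derive_comp_curve _ xD dfr)).
    apply: (etrans _ (esym (deriveE _ dfr))); apply: (congr1 ('d (frame c Y) (x t))).
    by rewrite -derive1E.
  rewrite x1 x2 addrC coframe_linear// /spray_defect; congr (_ + _).
  by rewrite dcoframe_frame// opprK.
have Lie0 w Z : runit xi (co Y) w = 0 -> (forall v, dot w (co v)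
    = dot (co Y) w / dot (co Y) (co Y) * dot (co Y) (co v)
      - dot (co Y) (co (lie_bracket Y v)) - alpha (co Y) * dot xi (co (lie_bracket Y v))) ->
    w = 0 -> a 1%g Y (lie_bracket Y Z) = 0.
  move=> _ wE w0; have := wE Z; rewrite w0 xi0 dot0l dot0r !mul0r mulr0 sub0r subr0.
  by rewrite coords_dot => /esym/eqP; rewrite oppr_eq0 => /eqP.
split=> [[Y0 [_ _ H]]|[Y0 H]]; split=> //.
  move=> Z; pose c := chart_at (gam 0).
  have cg : charts_at (gam 0) c := charts_at_chart_at _.
  have [ac cdg] := cg.
  have [w1 w2] := spray_defect_solve cg Y0; apply: (Lie0 _ _ w1 w2).
  by rewrite -geo// H// coframe0.
split=> // [t|c ac t cdg].
  have cg := charts_at_chart_at (gam t).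
  apply/eqP => v0; have [_ cdg] := cg.
  have := velocity_at_velocity (gI t) cg; rewrite v0 -frameE// => f0.
  move/eqP: Y0; apply; apply: coords_inj; rewrite -(coframe_frame Y cg) coords0 -f0.
  exact: coframe0.
have cg : charts_at (gam t) c by [].
apply: (coframe_inj cg); rewrite (geo c t cg Y0).
have [w1 w2] := spray_defect_solve cg Y0; move: w1 w2.
set w := spray_defect _ _ _ => w1 w2.
have U0 := coords_neq0 Y0.
(* Both terms of [rform] vanish on brackets with [Y], the metric one by [H] and the drift one by
   [xi0], so nondegeneracy kills the defect. *)
apply: (rtensor_inj drift_lt1 U0) => z.
rewrite -(uncoordsK z) spray_euler_lagrange// /rform /runit xi0 -coords_dot H.
by rewrite mul0r addr0 mulr0 oppr0.
Qed.

End Coframe.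

(** * Dimension five *)

Lemma linear_form5 (R : realType) (V : lmodType R) (f : V -> R)
    (e1 e2 e3 e4 e5 : V) (y1 y2 y3 y4 y5 : R) :
  (forall k u v, f (k *: u + v) = k * f u + f v) ->
  f (y1 *: e1 + y2 *: e2 + y3 *: e3 + y4 *: e4 + y5 *: e5)
  = y1 * f e1 + y2 * f e2 + y3 * f e3 + y4 * f e4 + y5 * f e5.
Proof.
move=> fl.
have fD u v : f (u + v) = f u + f v by rewrite -[u]scale1r fl mul1r scale1r.
have f0 : f 0 = 0 by apply: self_add0; rewrite -fD addr0.
have fZ k u : f (k *: u) = k * f u by rewrite -[k *: u]addr0 fl f0 addr0.
by rewrite !fD !fZ.
Qed.

Lemma linear_form_span (R : realType) (V : vectType R) (f : V -> R) (s : seq V) (v : V) :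
  (forall k u v, f (k *: u + v) = k * f u + f v) ->
  (forall e, e \in s -> f e = 0) -> v \in << s >>%VS -> f v = 0.
Proof.
move=> fl fs vs; have f0 : f 0 = 0.
  by apply: self_add0; have := fl 1 0 0; rewrite scale1r addr0 mul1r.
rewrite (coord_span (X := in_tuple s) vs).
elim/big_rec: _ => [//|i x _ fx].
by rewrite fl fx addr0 fs ?mulr0// mem_nth.
Qed.

Lemma alternating_form5 (R : realType) (V : lmodType R) (t : V -> V -> R)
    (e1 e2 e3 e4 e5 : V) (y1 y2 y3 y4 y5 z1 z2 z3 z4 z5 : R) :
  (forall k u v w, t (k *: u + v) w = k * t u w + t v w) ->
  (forall k u v w, t w (k *: u + v) = k * t w u + t w v) ->
  (forall u, t u u = 0) ->
  t (y1 *: e1 + y2 *: e2 + y3 *: e3 + y4 *: e4 + y5 *: e5)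
    (z1 *: e1 + z2 *: e2 + z3 *: e3 + z4 *: e4 + z5 *: e5)
  = (y1 * z2 - y2 * z1) * t e1 e2 + (y1 * z3 - y3 * z1) * t e1 e3
  + (y1 * z4 - y4 * z1) * t e1 e4 + (y1 * z5 - y5 * z1) * t e1 e5
  + (y2 * z3 - y3 * z2) * t e2 e3 + (y2 * z4 - y4 * z2) * t e2 e4
  + (y2 * z5 - y5 * z2) * t e2 e5 + (y3 * z4 - y4 * z3) * t e3 e4
  + (y3 * z5 - y5 * z3) * t e3 e5 + (y4 * z5 - y5 * z4) * t e4 e5.
Proof.
move=> tl tr tt.
have tC u v : t v u = - t u v.
  have := tt (1 *: u + v); rewrite tl !tr !tt !mul1r add0r addr0 addrC => /eqP.
  by rewrite addr_eq0 => /eqP.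
rewrite (linear_form5 (f := t^~ _)) => [|k u v]; last exact: tl.
rewrite !(linear_form5 (f := t _)) => [|k u v|k u v|k u v|k u v|k u v]; try exact: tr.
rewrite !tt (tC e1 e2) (tC e1 e3) (tC e1 e4) (tC e1 e5) (tC e2 e3) (tC e2 e4)
  (tC e2 e5) (tC e3 e4) (tC e3 e5) (tC e4 e5).
ring.
Qed.

Section CenterEquations.
Variables (R : realFieldType) (lam mu y1 y2 y3 y4 y5 : R).
Hypotheses (lam0 : lam != 0) (mu0 : mu != 0).

(** The zero summands are kept so that the system matches [geodesic_equations] with the bracket
    products filled in. A nonzero [y5] forces the other four coordinates to vanish. *)
Lemma center1_equations :
  [/\ y2 * (lam * y5) + y3 * 0 + y4 * 0 + y5 * 0 = 0,
      y1 * (lam * y5) - y3 * 0 - y4 * 0 - y5 * 0 = 0,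
      y1 * 0 + y2 * 0 - y4 * (mu * y5) - y5 * 0 = 0,
      y1 * 0 + y2 * 0 + y3 * (mu * y5) - y5 * 0 = 0 &
      y1 * 0 + y2 * 0 + y3 * 0 + y4 * 0 = 0]
  <-> y5 = 0 \/ [/\ y1 = 0, y2 = 0, y3 = 0 & y4 = 0].
Proof.
rewrite !mulr0 !addr0 !add0r !subr0.
split=> [[e2 e1 e4 e3 _]|[->|[-> -> -> ->]]]; last 2 first.
- by rewrite !mulr0 oppr0.
- by rewrite !mul0r oppr0.
have [y50|y50] := eqVneq y5 0; [by left|right].
have nl : lam * y5 != 0 by rewrite mulf_neq0.
have nm : mu * y5 != 0 by rewrite mulf_neq0.
by split; [apply: (mulIf nl)|apply: (mulIf nl)|apply: (mulIf nm)|apply: (mulIf nm)];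
  rewrite mul0r//; apply/eqP; rewrite -oppr_eq0; apply/eqP.
Qed.

(** If [y1] is nonzero, the second and third equations give [y4 = y5 = 0]; if it is zero, only the
    first one carries information. *)
Lemma center2_equations :
  [/\ y2 * (lam * y4) + y3 * (mu * y5) + y4 * 0 + y5 * 0 = 0,
      y1 * (lam * y4) - y3 * 0 - y4 * 0 - y5 * 0 = 0,
      y1 * (mu * y5) + y2 * 0 - y4 * 0 - y5 * 0 = 0,
      y1 * 0 + y2 * 0 + y3 * 0 - y5 * 0 = 0 &
      y1 * 0 + y2 * 0 + y3 * 0 + y4 * 0 = 0]
  <-> (y4 = 0 /\ y5 = 0) \/ (y1 = 0 /\ lam * y2 * y4 + mu * y3 * y5 = 0).
Proof.
have E : y2 * (lam * y4) + y3 * (mu * y5) = lam * y2 * y4 + mu * y3 * y5 by ring.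
rewrite !mulr0 !addr0 !subr0 E.
split=> [[e1 e4 e5 _ _]|[[-> ->]|[-> ->]]]; last 2 first.
- by rewrite !mulr0 addr0.
- by rewrite !mul0r.
have [y10|y10] := eqVneq y1 0; [by right|left].
by split; [apply: (mulfI lam0)|apply: (mulfI mu0)];
  apply: (mulfI y10); rewrite !mulr0.
Qed.

Lemma center3_equations :
  [/\ y2 * (lam * y3) + y3 * 0 + y4 * 0 + y5 * 0 = 0,
      y1 * (lam * y3) - y3 * 0 - y4 * 0 - y5 * 0 = 0,
      y1 * 0 + y2 * 0 - y4 * 0 - y5 * 0 = 0,
      y1 * 0 + y2 * 0 + y3 * 0 - y5 * 0 = 0 &
      y1 * 0 + y2 * 0 + y3 * 0 + y4 * 0 = 0]
  <-> y3 = 0 \/ (y1 = 0 /\ y2 = 0).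
Proof.
rewrite !mulr0 !addr0 !subr0.
split=> [[e2 e1 _ _ _]|[->|[-> ->]]]; last 2 first.
- by rewrite !mulr0.
- by rewrite !mul0r.
have [y30|y30] := eqVneq y3 0; [by left|right].
have nl : lam * y3 != 0 by rewrite mulf_neq0.
by split; apply: (mulIf nl); rewrite mul0r.
Qed.

End CenterEquations.

Section FiveDim.
Variables (R : realType) (G : lieGroupType R 5) (a : metric_tensor G).
Variables (E1 E2 E3 E4 E5 : lie_algebra G).
Arguments a : clear implicits.
Local Notation Es := [:: E1; E2; E3; E4; E5].
Hypothesis ram : riemannian_metric a.
Hypothesis bE : basis_of fullv Es.
Hypothesis oE : orthonormal_family a Es.

Lemma orthonormal_ord (i j : 'I_5) : a 1%g Es`_i Es`_j = (i == j)%:R.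
Proof. exact: oE. Qed.

Lemma orthonormal_expansion (u : lie_algebra G) : u = \sum_(i < 5) a 1%g u Es`_i *: Es`_i.
Proof.
have uE := coord_basis (X := [tuple of Es]) bE (memvf u).
rewrite {1}uE; apply: eq_bigr => i _; congr (_ *: _).
have oii : a 1%g Es`_i Es`_i = 1 by rewrite orthonormal_ord eqxx.
rewrite [in RHS]uE (metricC ram) (metric_sumr ram) (bigD1 i)//= oii mulr1.
rewrite big1 ?addr0// => j ji.
by rewrite orthonormal_ord eq_sym (negbTE ji) mulr0.
Qed.

Lemma expansion5 (u : lie_algebra G) : exists z1 z2 z3 z4 z5 : R,
  u = z1 *: E1 + z2 *: E2 + z3 *: E3 + z4 *: E4 + z5 *: E5.
Proof.
exists (a 1%g u E1), (a 1%g u E2), (a 1%g u E3), (a 1%g u E4), (a 1%g u E5).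
by rewrite {1}[u]orthonormal_expansion !big_ord_recl big_ord0 /= addr0 !addrA.
Qed.

Variables y1 y2 y3 y4 y5 : R.
Let Y := y1 *: E1 + y2 *: E2 + y3 *: E3 + y4 *: E4 + y5 *: E5.

Lemma metric_Y (i : 'I_5) : a 1%g Y Es`_i = [:: y1; y2; y3; y4; y5]`_i.
Proof.
have -> : Y = \sum_(j < 5) [:: y1; y2; y3; y4; y5]`_j *: Es`_j.
  by rewrite /Y !big_ord_recl big_ord0 /= addr0 !addrA.
have oii : a 1%g Es`_i Es`_i = 1 by rewrite orthonormal_ord eqxx.
rewrite (metricC ram) (metric_sumr ram) (bigD1 i)//= oii mulr1 big1 ?addr0// => j ji.
by rewrite orthonormal_ord eq_sym (negbTE ji) mulr0.
Qed.

Lemma metric_bracket10 (c12 c13 c14 c15 c23 c24 c25 c34 c35 c45 : R) :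
  let t U V := a 1%g Y (lie_bracket U V) in
  t E1 E2 = c12 -> t E1 E3 = c13 -> t E1 E4 = c14 -> t E1 E5 = c15 ->
  t E2 E3 = c23 -> t E2 E4 = c24 -> t E2 E5 = c25 ->
  t E3 E4 = c34 -> t E3 E5 = c35 -> t E4 E5 = c45 -> forall z1 z2 z3 z4 z5 : R,
  t Y (z1 *: E1 + z2 *: E2 + z3 *: E3 + z4 *: E4 + z5 *: E5)
  = (y1 * z2 - y2 * z1) * c12 + (y1 * z3 - y3 * z1) * c13
  + (y1 * z4 - y4 * z1) * c14 + (y1 * z5 - y5 * z1) * c15
  + (y2 * z3 - y3 * z2) * c23 + (y2 * z4 - y4 * z2) * c24
  + (y2 * z5 - y5 * z2) * c25 + (y3 * z4 - y4 * z3) * c34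
  + (y3 * z5 - y5 * z3) * c35 + (y4 * z5 - y5 * z4) * c45.
Proof.
move=> t <- <- <- <- <- <- <- <- <- <- z1 z2 z3 z4 z5.
apply: (alternating_form5 (t := t)) => [k u v w|k u v w|u].
- exact: (etrans (congr1 (a 1%g Y) (lie_bracketDl k u v w)) (metricDr ram _ _ _ _)).
- exact: (etrans (congr1 (a 1%g Y) (lie_bracketDr k u v w)) (metricDr ram _ _ _ _)).
- exact: (etrans (congr1 (a 1%g Y) (lie_bracket_self u)) (metric0r ram _)).
Qed.

(** Up to the sign of the first, the five expressions are the coefficients of the coordinates of [Z]
    in [t Y Z], so they are read off at the basis vectors. *)
Lemma geodesic_equations (c12 c13 c14 c15 c23 c24 c25 c34 c35 c45 : R) :
  let t U V := a 1%g Y (lie_bracket U V) in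
  t E1 E2 = c12 -> t E1 E3 = c13 -> t E1 E4 = c14 -> t E1 E5 = c15 ->
  t E2 E3 = c23 -> t E2 E4 = c24 -> t E2 E5 = c25 ->
  t E3 E4 = c34 -> t E3 E5 = c35 -> t E4 E5 = c45 ->
  (forall Z, t Y Z = 0) <->
  [/\ y2 * c12 + y3 * c13 + y4 * c14 + y5 * c15 = 0,
      y1 * c12 - y3 * c23 - y4 * c24 - y5 * c25 = 0,
      y1 * c13 + y2 * c23 - y4 * c34 - y5 * c35 = 0,
      y1 * c14 + y2 * c24 + y3 * c34 - y5 * c45 = 0 &
      y1 * c15 + y2 * c25 + y3 * c35 + y4 * c45 = 0].
Proof.
move=> t t12 t13 t14 t15 t23 t24 t25 t34 t35 t45.
have B := metric_bracket10 t12 t13 t14 t15 t23 t24 t25 t34 t35 t45.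
split=> [H|[e1 e2 e3 e4 e5] Z].
  have BH z1 z2 z3 z4 z5 := etrans (esym (B z1 z2 z3 z4 z5)) (H _).
  have := BH 1 0 0 0 0; have := BH 0 1 0 0 0; have := BH 0 0 1 0 0.
  have := BH 0 0 0 1 0; have := BH 0 0 0 0 1.
  by move=> {t12 t13 t14 t15 t23 t24 t25 t34 t35 t45 B H BH} ? ? ? ? ?; split; lra.
have [z1 [z2 [z3 [z4 [z5 ->]]]]] := expansion5 Z.
apply: (etrans (B _ _ _ _ _)).
transitivity (- z1 * (y2 * c12 + y3 * c13 + y4 * c14 + y5 * c15)
  + z2 * (y1 * c12 - y3 * c23 - y4 * c24 - y5 * c25)
  + z3 * (y1 * c13 + y2 * c23 - y4 * c34 - y5 * c35)
  + z4 * (y1 * c14 + y2 * c24 + y3 * c34 - y5 * c45)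
  + z5 * (y1 * c15 + y2 * c25 + y3 * c35 + y4 * c45)); first by ring.
by rewrite e1 e2 e3 e4 e5 !mulr0 !addr0.
Qed.

Lemma metric_Y_scale (k c : R) (U W : lie_algebra G) :
  U = k *: W -> a 1%g Y W = c -> a 1%g Y U = k * c.
Proof. by move=> -> <-; rewrite -[k *: W]addr0 (metricDr ram) (metric0r ram) addr0. Qed.

(** Orthonormality makes each coordinate the product with a basis vector, which vanishes on the span
    of the others. Index lists treat all the spans of the theorem at once. *)
Lemma mem_span_Y (I : seq nat) : all (fun i => i < 5)%N I ->
  Y \in << [seq Es`_i | i <- I] >>%VS <->
  forall i : 'I_5, (i : nat) \notin I -> [:: y1; y2; y3; y4; y5]`_i = 0.
Proof.
move=> /allP I5; split=> [YI i iI|yI].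
  rewrite -metric_Y.
  apply: (linear_form_span (f := fun u => a 1%g u Es`_i)) YI => [k u v|e].
    exact: metricDl.
  move=> /mapP[j jI ->]; apply: (etrans (oE (I5 j jI) (ltn_ord i))).
  by rewrite (_ : (j == i :> nat) = false)//; apply/negbTE; apply: contraNneq iI => <-.
have -> : Y = \sum_(j < 5) [:: y1; y2; y3; y4; y5]`_j *: Es`_j.
  by rewrite /Y !big_ord_recl big_ord0 /= addr0 !addrA.
apply: memv_suml => i _; have [iI|iI] := boolP ((i : nat) \in I).
  by apply: memvZ; apply: memv_span; exact: map_f.
by rewrite yI// scale0r mem0v.
Qed.

End FiveDim.

(* The span in the first equivalence is the one of E1, E2, E3, E4.  With E1
   omitted the equivalence fails: replacing (E1, E2) by (E2, - E1) preserves
   every hypothesis, so E1 is a geodesic vector if and only if E2 is one. *)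
Theorem theorem2p1 (R : realType) (G : lieGroupType R 5)
    (a : metric_tensor G) (X : vector_field G)
    (E1 E2 E3 E4 E5 : lie_algebra G) (y1 y2 y3 y4 y5 : R) :
  simply_connected R G ->
  two_step_nilpotent G ->
  riemannian_metric a ->
  left_invariant_metric a ->
  basis_of fullv [:: E1; E2; E3; E4; E5] ->
  orthonormal_family a [:: E1; E2; E3; E4; E5] ->
  left_invariant_field X ->
  (forall p : G, Num.sqrt (a p (X p) (X p)) < 1) ->
  left_invariant_finsler (randers a X) ->
  douglas_type (randers a X) ->
  let Y : lie_algebra G :=
    y1 *: E1 + y2 *: E2 + y3 *: E3 + y4 *: E4 + y5 *: E5 in
  Y != 0 ->
  (forall lam mu : R, mu <= lam -> 0 < mu ->
     brackets_center1 lam mu E1 E2 E3 E4 E5 ->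
     (geodesic_vector (randers a X) Y <->
        Y \in <<[:: E1; E2; E3; E4]>>%VS \/ Y \in <<[:: E5]>>%VS)) /\
  (forall lam mu : R, mu <= lam -> 0 < mu ->
     brackets_center2 lam mu E1 E2 E3 E4 E5 ->
     (geodesic_vector (randers a X) Y <->
        Y \in <<[:: E1; E2; E3]>>%VS \/
        (Y \in <<[:: E2; E3; E4; E5]>>%VS /\
         lam * y2 * y4 + mu * y3 * y5 = 0))) /\
  (forall lam : R, 0 < lam ->
     brackets_center3 lam E1 E2 E3 E4 E5 ->
     (geodesic_vector (randers a X) Y <->
        Y \in <<[:: E1; E2; E4; E5]>>%VS \/
        Y \in <<[:: E3; E4; E5]>>%VS)).
Proof.
move=> _ _ ram ainv bE oE Xinv Xlt1 _ doug Y Y0.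
have P := geodesic_vectorP ram ainv (orthonormal_ord oE)
  (orthonormal_expansion ram bE oE) Xinv (Xlt1 1%g) Y doug.
have mY := metric_Y ram oE y1 y2 y3 y4 y5.
have Y3 : a 1%g Y E3 = y3 := mY (@Ordinal 5 2 isT).
have Y4 : a 1%g Y E4 = y4 := mY (@Ordinal 5 3 isT).
have Y5 : a 1%g Y E5 = y5 := mY (@Ordinal 5 4 isT).
have span I := mem_span_Y ram oE y1 y2 y3 y4 y5 (I := I).
have eqs := geodesic_equations ram bE oE (y1 := y1) (y2 := y2) (y3 := y3) (y4 := y4) (y5 := y5).
have z U V : lie_bracket U V = 0 -> a 1%g Y (lie_bracket U V) = 0.
  by move=> ->; exact: (metric0r ram).
have {}P (C : Prop) : ((forall Z, a 1%g Y (lie_bracket Y Z) = 0) <-> C) ->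
    (geodesic_vector (randers a X) Y <-> C).
  by move=> [PC CP]; split=> [/P[_ /PC]//|/CP H]; apply/P.
split; last split.
- move=> lam mu le_mu mu0 [[b12 b13 b14 b15] [[b23 b24 b25] [b34 b35 b45]]].
  have lam0 : 0 < lam := lt_le_trans mu0 le_mu.
  apply: P; apply: (iff_trans (eqs _ _ _ _ _ _ _ _ _ _
    (metric_Y_scale ram b12 Y5) (z _ _ b13) (z _ _ b14) (z _ _ b15) (z _ _ b23)
    (z _ _ b24) (z _ _ b25) (metric_Y_scale ram b34 Y5) (z _ _ b35) (z _ _ b45))).
  have s1 : Y \in << [:: E1; E2; E3; E4] >>%VS <-> y5 = 0.
    (* Indices start from 0: the list stands for [E1] to [E4], and the ordinal 4 for the coordinate
       [y5]. *)
    apply: (iff_trans (span [:: 0; 1; 2; 3]%N isT)); split=> H.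
      exact: (H (@Ordinal 5 4 isT) isT).
    by case=> [[|[|[|[|[|m]]]]] im].
  have s2 : Y \in << [:: E5] >>%VS <-> [/\ y1 = 0, y2 = 0, y3 = 0 & y4 = 0].
    apply: (iff_trans (span [:: 4]%N isT)); split=> [H|[? ? ? ?]].
      by split; [exact: (H (@Ordinal 5 0 isT) isT)|exact: (H (@Ordinal 5 1 isT) isT)
        |exact: (H (@Ordinal 5 2 isT) isT)|exact: (H (@Ordinal 5 3 isT) isT)].
    by case=> [[|[|[|[|[|m]]]]] im].
  apply: iff_trans (center1_equations _ _ _ _ _ _ _) _; rewrite ?gt_eqF//.
  by split=> [[/s1|/s2]|[/s1|/s2]]; [left|right|left|right].
- move=> lam mu le_mu mu0 [[b12 b13 b14 b15] [[b23 b24 b25] [b34 b35 b45]]].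
  have lam0 : 0 < lam := lt_le_trans mu0 le_mu.
  apply: P; apply: (iff_trans (eqs _ _ _ _ _ _ _ _ _ _
    (metric_Y_scale ram b12 Y4) (metric_Y_scale ram b13 Y5) (z _ _ b14) (z _ _ b15)
    (z _ _ b23) (z _ _ b24) (z _ _ b25) (z _ _ b34) (z _ _ b35) (z _ _ b45))).
  have s1 : Y \in << [:: E1; E2; E3] >>%VS <-> y4 = 0 /\ y5 = 0.
    apply: (iff_trans (span [:: 0; 1; 2]%N isT)); split=> [H|[? ?]].
      by split; [exact: (H (@Ordinal 5 3 isT) isT)|exact: (H (@Ordinal 5 4 isT) isT)].
    by case=> [[|[|[|[|[|m]]]]] im].
  have s2 : Y \in << [:: E2; E3; E4; E5] >>%VS <-> y1 = 0.
    apply: (iff_trans (span [:: 1; 2; 3; 4]%N isT)); split=> H.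
      exact: (H (@Ordinal 5 0 isT) isT).
    by case=> [[|[|[|[|[|m]]]]] im].
  apply: iff_trans (center2_equations _ _ _ _ _ _ _) _; rewrite ?gt_eqF//.
  by split=> [[/s1|[/s2]]|[/s1|[/s2]]]; [left|right|left|right].
- move=> lam lam0 [[b12 b13 b14 b15] [[b23 b24 b25] [b34 b35 b45]]].
  apply: P; apply: (iff_trans (eqs _ _ _ _ _ _ _ _ _ _
    (metric_Y_scale ram b12 Y3) (z _ _ b13) (z _ _ b14) (z _ _ b15) (z _ _ b23)
    (z _ _ b24) (z _ _ b25) (z _ _ b34) (z _ _ b35) (z _ _ b45))).
  have s1 : Y \in << [:: E1; E2; E4; E5] >>%VS <-> y3 = 0.
    apply: (iff_trans (span [:: 0; 1; 3; 4]%N isT)); split=> H.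
      exact: (H (@Ordinal 5 2 isT) isT).
    by case=> [[|[|[|[|[|m]]]]] im].
  have s2 : Y \in << [:: E3; E4; E5] >>%VS <-> y1 = 0 /\ y2 = 0.
    apply: (iff_trans (span [:: 2; 3; 4]%N isT)); split=> [H|[? ?]].
      by split; [exact: (H (@Ordinal 5 0 isT) isT)|exact: (H (@Ordinal 5 1 isT) isT)].
    by case=> [[|[|[|[|[|m]]]]] im].
  apply: iff_trans (center3_equations _ _ _ _ _ _) _; rewrite ?gt_eqF//.
  by split=> [[/s1|/s2]|[/s1|/s2]]; [left|right|left|right].
Qed.
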